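(* Let $k\geq 0$. For any module $M\in\mathcal{U}_{k}$, the cochain complex $\Lambda_{k}(M)$ has length at most $k$ (that is, $\Lambda_k^s(M)=0$ unless $0\le s\le k$), and $$H^{s,a}(\Lambda_{k}(M))\cong \mathrm{Ext}^{s}_{\mathcal{U}_{k}}(M,S_{k}(a))\quad\text{for all } s\ge 0,\ a\geq 0.$$
   Context: **The category $\mathcal{U}_k$.** A ringoid is a small preadditive category; a left module over it is a covariant additive functor to abelian groups. Let $A$ be the mod 2 Steenrod algebra. Let $\mathcal{A}$ be the ringoid with objects all integers, $\mathcal{A}(a,b)=A^{b-a}$, and composition given by multiplication ($g\circ f=gf$). Let $\mathcal{Q}$ be the quotient of $\mathcal{A}$ by the ideal generated by the morphisms $\mathrm{Sq}^{i}:n\to n+i$ with $i\geq 0$, $i>n$. Let $\mathcal{Q}_{k}$ be the subringoid of $\mathcal{Q}$ (all objects; morphism sets subgroups closed under composition, containing identities) generated by $\mathrm{Sq}^{i}:n\to n+i$ with $i\geq 0$, $n-i<k$. $\mathcal{U}_{k}$ is the category of left $\mathcal{Q}_{k}$-modules; $M^n$ denotes the degree $n$ part (value at $n$) of $M$. It is zero for $n<0$. For $a\ge 0$, $S_k(a)$ is the module in $\mathcal{U}_k$ equal to $\mathbb{F}_2$ in degree $a$ and zero in other degrees. **The $\Lambda$ algebra.** Binomial coefficients are taken mod 2, with $\binom{a}{b}=0$ if $a<0$ or $b<0$. $\Lambda$ is the associative unital differential bigraded $\mathbb{F}_2$-algebra with generators $\lambda_i$ ($i\ge 0$) of bidegree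 $(s,t)=(1,i+1)$, relations $$\lambda_{i}\lambda_{2i+1+j}=\sum_{t\ge 0}\binom{j-t-1}{t}\lambda_{i+j-t}\lambda_{2i+1+t}\quad (i,j\geq 0),$$ and differential, a derivation, with $d(\lambda_i)=\sum_{j\ge1}\binom{i-j}{j}\lambda_{i-j}\lambda_{j-1}$. The grading $s$ is the cohomological degree, $t$ the internal degree. A monomial $\lambda_I=\lambda_{I(1)}\cdots\lambda_{I(s)}$ is admissible if $2I(r)\ge I(r+1)$ for $1\le r<s$; admissible monomials form a basis of $\Lambda$. Its excess is $\mathrm{excess}(I)=\sum_{r=1}^{s-1}(2I(r)-I(r+1))$. For $m\ge 0$, $\Lambda(m)\subseteq\Lambda$ is the span of the admissible monomials with $I(1)<m$ together with $1$; it is a subcomplex. **The complexes $\Lambda_k(m)$ and $\Lambda_k(M)$.** For $m,k\ge0$, $\Gamma(m,k)\subseteq\Lambda(m)$ is the span of the admissible monomials $\lambda_I$ of length $s\geq 1$ with $I(1)<m$ and $\mathrm{excess}(I)+(s-1)>I(1)-(m-k)$ (the monomial $1$ is not in it). It is a subcomplex, and $\Lambda_k(m):=\Lambda(m)/\Gamma(m,k)$. For $M\in\mathcal{U}_k$ let $M_m=\mathrm{Hom}(M^m,\mathbb{F}_2)$, on which operations act from the right: for $x\in M_m$, $x\mathrm{Sq}^i\in M_{m-i}$ is $y\mapsto x(\mathrm{Sq}^i y)$. Define $$\Lambda_{k}(M)=\bigoplus_{m}\Lambda_{k}(m)\otimes M_{m},\qquad d(\lambda_{I}\otimes x)=d(\lambda_{I})\otimes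 x+\sum_{i\geq 1,\ 0\leq m-2i<k}\lambda_{i-1}\lambda_{I}\otimes x\,\mathrm{Sq}^{i}\quad (x\in M_m),$$ which is a well-defined cochain complex. It is bigraded: $\lambda_I\otimes x$ with $x\in M_m$ has cohomological degree $s$ equal to the length of $I$ and absolute internal degree $a$ equal to $m$ plus the internal degree of $\lambda_I$; $d$ raises $s$ by one and preserves $a$. $H^{s,a}$ denotes the absolute internal degree $a$ part of the $s$-th cohomology. *)

(* Defs.v *)
From HB Require Import structures.
From mathcomp Require Import all_boot all_order all_algebra.
From mathcomp Require Import generic_quotient ring_quotient boolp classical_sets.
From mathcomp Require Import finmap.
From mathcomp.multinomials Require Import monalg.

Set Implicit Arguments.
Unset Strict Implicit.
Unset Printing Implicit Defensive.

Import Order.TTheory GRing.Theory Num.Theory.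
Local Open Scope ring_scope.
Local Open Scope quotient_scope.

Record subgroup (V : zmodType) := Subgroup {
  sg_mem :> V -> Prop;
  sg_mem0 : sg_mem 0;
  sg_memB : forall x y, sg_mem x -> sg_mem y -> sg_mem (x - y) }.

Section Subgroups.
Variable V : zmodType.

Definition sg_pred (P : subgroup V) : V -> bool := fun x => `[< P x >].

Lemma sg_pred_closed (P : subgroup V) : zmod_closed (sg_pred P).
Proof.
split=> [|x y /asboolP Px /asboolP Py]; apply/asboolP; first exact: sg_mem0.
exact: sg_memB.
Qed.

HB.instance Definition _ P :=
  GRing.isZmodClosed.Build V (sg_pred P) (sg_pred_closed P).

Definition sub (P : subgroup V) := {x : V | sg_pred P x}.
HB.instance Definition _ P := SubChoice.on (sub P).
HB.instance Definition _ P := [SubChoice_isSubZmodule of sub P by <:].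

Definition mksub (P : subgroup V) (x : V) (Px : P x) : sub P :=
  Sub x (asboolT Px).

Lemma subP (P : subgroup V) (x : sub P) : P (val x).
Proof. exact: asboolW (valP x). Qed.

Definition quo (P : subgroup V) :=
  Quotient.quot (GRing.ZmodClosed.clone V (sg_pred P) _).
HB.instance Definition _ P := GRing.Zmodule.on (quo P).

Definition cl (P : subgroup V) (x : V) : quo P := \pi x.

Lemma cl_is_zmod_morphism (P : subgroup V) : zmod_morphism (cl P).
Proof. exact: pi_is_zmod_morphism. Qed.

HB.instance Definition _ P :=
  GRing.isZmodMorphism.Build V (quo P) (cl P) (cl_is_zmod_morphism P).

Lemma cl_eq (P : subgroup V) x y : cl P x = cl P y <-> P (x - y).
Proof.
rewrite /cl; split.
  by move/eqP; rewrite -Quotient.idealrBE => /asboolP.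
by move=> Pxy; apply/eqP; rewrite -Quotient.idealrBE; apply/asboolP.
Qed.

Lemma cl_repr (P : subgroup V) (u : quo P) : cl P (repr u) = u.
Proof. exact: reprK. Qed.

Lemma repr_cl (P : subgroup V) x : P (repr (cl P x) - x).
Proof. by apply/cl_eq; rewrite cl_repr. Qed.

Inductive gen_mem (S : V -> Prop) : V -> Prop :=
| gen_in x : S x -> gen_mem S x
| gen_0 : gen_mem S 0
| gen_sub x y : gen_mem S x -> gen_mem S y -> gen_mem S (x - y).

Definition gen (S : V -> Prop) : subgroup V :=
  Subgroup (gen_0 S) (@gen_sub S).

End Subgroups.

Lemma sg_memD (V : zmodType) (P : subgroup V) x y : P x -> P y -> P (x + y).
Proof.
move=> Px Py; rewrite -[y]opprK; apply: sg_memB => //.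
by rewrite -sub0r; apply: sg_memB => //; apply: sg_mem0.
Qed.

Lemma sg_memN (V : zmodType) (P : subgroup V) x : P x -> P (- x).
Proof. by move=> Px; rewrite -sub0r; apply: sg_memB => //; apply: sg_mem0. Qed.

Lemma gen_min (V : zmodType) (S : V -> Prop) (P : subgroup V) :
  (forall x, S x -> P x) -> forall x, gen S x -> P x.
Proof.
move=> SP x; elim=> {x} [x /SP//||x y _ Px _ Py]; first exact: sg_mem0.
exact: sg_memB.
Qed.

Lemma qlift_zmod_morphism (V W : zmodType) (P : subgroup V) (f : {additive V -> W}) :
  (forall x, P x -> f x = 0) ->
  zmod_morphism (fun u : quo P => f (repr u)) /\
  (forall x, f (repr (cl P x)) = f x).
Proof.
move=> fP; have fE x : f (repr (cl P x)) = f x.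
  by apply/eqP; rewrite -subr_eq0 -raddfB fP //; apply: repr_cl.
split=> // u v; rewrite -[u]cl_repr -[v]cl_repr -raddfB /= !fE.
by rewrite raddfB.
Qed.

Section Subquotient.
Variables (V : zmodType) (Z B : subgroup V).

Definition restr_mem (x : sub Z) : Prop := B (val x).

Lemma restr0 : restr_mem 0.
Proof. by rewrite /restr_mem raddf0; apply: sg_mem0. Qed.

Lemma restrB x y : restr_mem x -> restr_mem y -> restr_mem (x - y).
Proof. by rewrite /restr_mem raddfB; apply: sg_memB. Qed.

Definition restr_sg : subgroup (sub Z) := Subgroup restr0 restrB.

(* Z / (Z :&: B) *)
Definition subquo : zmodType := quo restr_sg.

End Subquotient.

Definition prodz (I : Type) (V : I -> zmodType) := forall i, V i.

Section Product.
Variables (I : Type) (V : I -> zmodType).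

HB.instance Definition _ := gen_eqMixin (prodz V).
HB.instance Definition _ := gen_choiceMixin (prodz V).

Definition prodz_add (f g : prodz V) : prodz V := fun i => f i + g i.
Definition prodz_opp (f : prodz V) : prodz V := fun i => - f i.
Definition prodz_zero : prodz V := fun i => 0.

Lemma prodz_addA : associative prodz_add.
Proof. by move=> f g h; apply: functional_extensionality_dep => i; apply: addrA. Qed.
Lemma prodz_addC : commutative prodz_add.
Proof. by move=> f g; apply: functional_extensionality_dep => i; apply: addrC. Qed.
Lemma prodz_add0 : left_id prodz_zero prodz_add.
Proof. by move=> f; apply: functional_extensionality_dep => i; apply: add0r. Qed.
Lemma prodz_addN : left_inverse prodz_zero prodz_opp prodz_add.
Proof. by move=> f; apply: functional_extensionality_dep => i; apply: addNr. Qed.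

HB.instance Definition _ :=
  GRing.isZmodule.Build (prodz V) prodz_addA prodz_addC prodz_add0 prodz_addN.

Lemma prodzB (f g : prodz V) i : (f - g) i = f i - g i.
Proof. by []. Qed.

Definition finsupp_mem (f : prodz V) : Prop :=
  exists s : seq {classic I}, forall i, f i != 0 -> (i : {classic I}) \in s.

Lemma finsupp0 : finsupp_mem 0.
Proof. by exists [::] => i; rewrite eqxx. Qed.

Lemma finsuppB f g : finsupp_mem f -> finsupp_mem g -> finsupp_mem (f - g).
Proof.
move=> [s sP] [t tP]; exists (s ++ t) => i fg; rewrite mem_cat.
have [fi|/sP->//] := eqVneq (f i) 0.
have [gi|/tP->] := eqVneq (g i) 0; last by rewrite orbT.
by rewrite prodzB fi gi subr0 eqxx in fg.
Qed.

Definition dsum : zmodType := sub (Subgroup finsupp0 finsuppB).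

Lemma dinj_subproof i (x : V i) :
  finsupp_mem (fun j => if pselect (i = j) is left e
                        then eq_rect i (fun j => V j : Type) x j e else 0).
Proof.
exists [:: (i : {classic I})] => j; case: pselect => [e _|_]; last first.
  by rewrite eqxx.
by rewrite -e mem_seq1.
Qed.

Definition dinj i (x : V i) : dsum :=
  @mksub _ (Subgroup finsupp0 finsuppB) _ (dinj_subproof x).

End Product.

Arguments dinj {I} V i x.

Section Hom.
Variables V W : zmodType.

Definition hom_mem (f : prodz (fun _ : V => W)) : Prop :=
  forall x y, f (x - y) = f x - f y.

Lemma hom0 : hom_mem 0. Proof. by move=> x y; rewrite /= subr0. Qed.

Lemma homB f g : hom_mem f -> hom_mem g -> hom_mem (f - g).
Proof.
move=> fP gP x y; rewrite !prodzB fP gP !opprD !opprK addrACA.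
by congr (_ + _); rewrite addrC.
Qed.

Definition Hom : zmodType := sub (Subgroup hom0 homB).

Definition app (f : Hom) : V -> W := val f.

Lemma appB f : zmod_morphism (app f).
Proof. exact: (subP f). Qed.

HB.instance Definition _ f := GRing.isZmodMorphism.Build V W (app f) (appB f).

Definition mkHom (f : V -> W) (fP : zmod_morphism f) : Hom :=
  @mksub _ (Subgroup hom0 homB) f fP.

End Hom.

(* The abelian group with generators [sym x] and relations [S]. *)
Section Presented.
Variables (X : Type) (S : {malg int[{classic X}]} -> Prop).

Definition pres : zmodType := quo (gen S).
Definition free_sym (x : X) : {malg int[{classic X}]} :=
  << 1 *g (x : {classic X}) >>.
Definition sym (x : X) : pres := cl (gen S) (free_sym x).

Definition free_lift (W : zmodType) (f : X -> W) (g : {malg int[{classic X}]}) : W :=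
  \sum_(k <- msupp g) f k *~ (g@_k).

Lemma free_liftEw (W : zmodType) (f : X -> W) (d : {fset {classic X}}) g :
  (msupp g `<=` d)%fset -> free_lift f g = \sum_(k <- d) f k *~ (g@_k).
Proof.
move=> le; rewrite [LHS](big_fset_incl _ le) => //= x xd /mcoeff_outdom ->.
by rewrite mulr0z.
Qed.

Lemma free_lift_zmod_morphism (W : zmodType) (f : X -> W) :
  zmod_morphism (free_lift f).
Proof.
move=> g1 g2; pose d := (msupp g1 `|` msupp g2 `|` msupp (g1 - g2))%fset.
have d1 : (msupp g1 `<=` d)%fset by rewrite /d -fsetUA fsubsetUl.
have d2 : (msupp g2 `<=` d)%fset.
  by rewrite /d; apply: fsubsetU; rewrite fsubsetUr.
have d3 : (msupp (g1 - g2) `<=` d)%fset by rewrite /d fsubsetUr.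
rewrite (free_liftEw _ d1) (free_liftEw _ d2) (free_liftEw _ d3).
by rewrite -sumrB; apply: eq_bigr => k _; rewrite mcoeffB mulrzBr.
Qed.

HB.instance Definition _ W f := GRing.isZmodMorphism.Build
  {malg int[{classic X}]} W (free_lift f) (free_lift_zmod_morphism f).

Lemma free_lift_sym (W : zmodType) (f : X -> W) x :
  free_lift f (free_sym x) = f x.
Proof.
rewrite (@free_liftEw _ _ [fset (x : {classic X})]%fset) ?msuppU_le //.
by rewrite big_seq_fset1 mcoeffUU.
Qed.

Lemma pres_lift (W : zmodType) (f : X -> W) :
  (forall g, S g -> free_lift f g = 0) ->
  exists h : Hom pres W, forall x, app h (sym x) = f x.
Proof.
move=> fS.
have [|addh hE] := @qlift_zmod_morphism _ _ (gen S) (free_lift f).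
  move=> x; elim=> {x} [x /fS//||x y _ fx _ fy]; first exact: raddf0.
  by rewrite raddfB fx fy subr0.
exists (mkHom addh) => x; rewrite /app /mkHom /mksub /= /sym hE.
exact: free_lift_sym.
Qed.

Lemma pres_ind (P : subgroup pres) : (forall x, P (sym x)) -> forall u, P u.
Proof.
move=> Ps u; rewrite -[u]cl_repr; move: (repr u) => g {u}.
rewrite [g]monalgE raddf_sum; elim/big_rec: _ => [|k u _ Pu].
  exact: sg_mem0.
apply: sg_memD => //.
have -> : << g@_k *g k >> = free_sym k *~ g@_k :> {malg int[{classic X}]}.
  by rewrite /free_sym -raddfMz intz.
rewrite raddfMz -/(sym k).
have PM n : P (sym k *+ n).
  elim: n => [|n IH]; first by rewrite mulr0n; apply: sg_mem0.
  by rewrite mulrS; apply: sg_memD.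
case: (g@_k) => n; first exact: PM.
by rewrite NegzE mulrNz; apply: sg_memN; apply: PM.
Qed.

Lemma pres_hom_ext (W : zmodType) (f g : Hom pres W) :
  (forall x, app f (sym x) = app g (sym x)) -> forall u, app f u = app g u.
Proof.
move=> fg u.
have P0 : app f 0 = app g 0 by rewrite [LHS]raddf0 [RHS]raddf0.
have PB x y : app f x = app g x -> app f y = app g y -> app f (x - y) = app g (x - y).
  by move=> fx fy; rewrite [LHS]appB [RHS]appB; congr (_ - _).
exact: (@pres_ind (@Subgroup pres (fun u => app f u = app g u) P0 PB) fg u).
Qed.

End Presented.

Section Tensor.
Variables U V : zmodType.

Inductive tensor_rel : {malg int[{classic (U * V)}]} -> Prop :=
| tensor_rel_l u u' v :
    tensor_rel (free_sym (u + u', v) - free_sym (u, v) - free_sym (u', v))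
| tensor_rel_r u v v' :
    tensor_rel (free_sym (u, v + v') - free_sym (u, v) - free_sym (u, v')).

(* U (x)_Z V; for F_2-vector spaces this is the tensor product over F_2. *)
Definition tensor : zmodType := pres tensor_rel.
Definition tens (u : U) (v : V) : tensor := sym tensor_rel (u, v).

End Tensor.

Section RingQuotient.
Variables (R : pzRingType) (S : R -> Prop).

Inductive ideal_mem : R -> Prop :=
| ideal_in x : S x -> ideal_mem x
| ideal_0 : ideal_mem 0
| ideal_sub x y : ideal_mem x -> ideal_mem y -> ideal_mem (x - y)
| ideal_mul a x b : ideal_mem x -> ideal_mem (a * x * b).

Definition ideal : subgroup R := Subgroup ideal_0 ideal_sub.

Definition rquo := quo ideal.
HB.instance Definition _ := GRing.Zmodule.on rquo.

Definition rquo_one : rquo := cl ideal 1.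
Definition rquo_mul (u v : rquo) : rquo := cl ideal (repr u * repr v).

Lemma cl_mul x y : cl ideal (x * y) = rquo_mul (cl ideal x) (cl ideal y).
Proof.
apply/cl_eq; rewrite -[_ - _]opprB; apply: sg_memN.
set x' := repr _; set y' := repr _.
have -> : x' * y' - x * y = (x' - x) * y' + x * (y' - y).
  by rewrite mulrBl mulrBr addrA subrK.
apply: sg_memD.
  by rewrite -[(x' - x)]mul1r; apply: ideal_mul; exact: (repr_cl ideal x).
by rewrite -[_ * _]mulr1; apply: ideal_mul; exact: (repr_cl ideal y).
Qed.

Lemma rquo_mulA : associative rquo_mul.
Proof.
move=> x y z; rewrite -[x]cl_repr -[y]cl_repr -[z]cl_repr -!cl_mul.
by rewrite mulrA.
Qed.
Lemma rquo_mul1 : left_id rquo_one rquo_mul.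
Proof. by move=> x; rewrite -[x]cl_repr -cl_mul mul1r. Qed.
Lemma rquo_mulr1 : right_id rquo_one rquo_mul.
Proof. by move=> x; rewrite -[x]cl_repr -cl_mul mulr1. Qed.
Lemma rquo_mulDl : left_distributive rquo_mul +%R.
Proof.
move=> x y z; rewrite -[x]cl_repr -[y]cl_repr -[z]cl_repr -raddfD -!cl_mul.
by rewrite mulrDl raddfD.
Qed.
Lemma rquo_mulDr : right_distributive rquo_mul +%R.
Proof.
move=> x y z; rewrite -[x]cl_repr -[y]cl_repr -[z]cl_repr -raddfD -!cl_mul.
by rewrite mulrDr raddfD.
Qed.

HB.instance Definition _ := GRing.Zmodule_isPzRing.Build rquo
  rquo_mulA rquo_mul1 rquo_mulr1 rquo_mulDl rquo_mulDr.

Definition rcl (x : R) : rquo := cl ideal x.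

Lemma rcl_zmod_morphism : zmod_morphism rcl.
Proof. exact: raddfB. Qed.
Lemma rcl_monoid_morphism : monoid_morphism rcl.
Proof. by split=> // x y; apply: cl_mul. Qed.
HB.instance Definition _ :=
  GRing.isZmodMorphism.Build R rquo rcl rcl_zmod_morphism.
HB.instance Definition _ :=
  GRing.isMonoidMorphism.Build R rquo rcl rcl_monoid_morphism.

End RingQuotient.

Record ringoid := Ringoid {
  ob : Type;
  rhom : ob -> ob -> zmodType;
  rid : forall a, rhom a a;
  rcomp : forall a b c, rhom b c -> rhom a b -> rhom a c;
  rcompA : forall a b c d (h : rhom c d) (g : rhom b c) (f : rhom a b),
    rcomp h (rcomp g f) = rcomp (rcomp h g) f;
  rcomp1f : forall a b (f : rhom a b), rcomp (rid b) f = f;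
  rcompf1 : forall a b (f : rhom a b), rcomp f (rid a) = f;
  rcompBl : forall a b c (g g' : rhom b c) (f : rhom a b),
    rcomp (g - g') f = rcomp g f - rcomp g' f;
  rcompBr : forall a b c (g : rhom b c) (f f' : rhom a b),
    rcomp g (f - f') = rcomp g f - rcomp g f' }.

Arguments rid {r} a.
Arguments rcomp {r a b c} g f.

Section QuotientRingoid.
Variables (R : ringoid) (S : forall a b : ob R, rhom a b -> Prop).

Inductive rideal_mem : forall a b : ob R, rhom a b -> Prop :=
| rideal_in a b (f : rhom a b) : S f -> rideal_mem f
| rideal_0 a b : rideal_mem (0 : rhom a b)
| rideal_sub a b (f g : rhom a b) :
    rideal_mem f -> rideal_mem g -> rideal_mem (f - g)
| rideal_comp a b c d (h : rhom c d) (f : rhom b c) (g : rhom a b) :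
    rideal_mem f -> rideal_mem (rcomp (rcomp h f) g).

Definition rideal a b : subgroup (rhom a b) :=
  Subgroup (rideal_0 a b) (@rideal_sub a b).

Definition qcomp a b c (g : quo (rideal b c)) (f : quo (rideal a b)) :
  quo (rideal a c) := cl _ (rcomp (repr g) (repr f)).

Lemma cl_comp a b c (g : rhom b c) (f : rhom a b) :
  cl (rideal a c) (rcomp g f) = qcomp (cl _ g) (cl _ f).
Proof.
apply/cl_eq; rewrite -[_ - _]opprB; apply: sg_memN.
set g' := repr _; set f' := repr _.
have -> : rcomp g' f' - rcomp g f = rcomp (g' - g) f' + rcomp g (f' - f).
  by rewrite rcompBl rcompBr addrA subrK.
apply: sg_memD.
  rewrite -[g' - g]rcomp1f; apply: rideal_comp; exact: (repr_cl (rideal b c) g).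
rewrite -[rcomp _ _]rcompf1; apply: rideal_comp; exact: (repr_cl (rideal a b) f).
Qed.

Lemma qcompA a b c d (h : quo (rideal c d)) (g : quo (rideal b c))
  (f : quo (rideal a b)) : qcomp h (qcomp g f) = qcomp (qcomp h g) f.
Proof. by rewrite -[h]cl_repr -[g]cl_repr -[f]cl_repr -!cl_comp rcompA. Qed.
Lemma qcomp1f a b (f : quo (rideal a b)) : qcomp (cl _ (rid b)) f = f.
Proof. by rewrite -[f]cl_repr -!cl_comp rcomp1f. Qed.
Lemma qcompf1 a b (f : quo (rideal a b)) : qcomp f (cl _ (rid a)) = f.
Proof. by rewrite -[f]cl_repr -!cl_comp rcompf1. Qed.
Lemma qcompBl a b c (g g' : quo (rideal b c)) (f : quo (rideal a b)) :
  qcomp (g - g') f = qcomp g f - qcomp g' f.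
Proof.
by rewrite -[g]cl_repr -[g']cl_repr -[f]cl_repr -raddfB -!cl_comp rcompBl raddfB.
Qed.
Lemma qcompBr a b c (g : quo (rideal b c)) (f f' : quo (rideal a b)) :
  qcomp g (f - f') = qcomp g f - qcomp g f'.
Proof.
by rewrite -[g]cl_repr -[f]cl_repr -[f']cl_repr -raddfB -!cl_comp rcompBr raddfB.
Qed.

Definition quotient_ringoid : ringoid := @Ringoid (ob R)
  (fun a b => quo (rideal a b)) (fun a => cl _ (rid a)) qcomp
  qcompA qcomp1f qcompf1 qcompBl qcompBr.

End QuotientRingoid.

Section Subringoid.
Variables (R : ringoid) (S : forall a b : ob R, rhom a b -> Prop).

Inductive subringoid_mem : forall a b : ob R, rhom a b -> Prop :=
| subringoid_in a b (f : rhom a b) : S f -> subringoid_mem f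
| subringoid_id a : subringoid_mem (rid a)
| subringoid_0 a b : subringoid_mem (0 : rhom a b)
| subringoid_sub a b (f g : rhom a b) :
    subringoid_mem f -> subringoid_mem g -> subringoid_mem (f - g)
| subringoid_comp a b c (g : rhom b c) (f : rhom a b) :
    subringoid_mem g -> subringoid_mem f -> subringoid_mem (rcomp g f).

Definition subringoid_sg a b : subgroup (rhom a b) :=
  Subgroup (subringoid_0 a b) (@subringoid_sub a b).

Let H a b := sub (subringoid_sg a b).

Definition scomp a b c (g : H b c) (f : H a b) : H a c :=
  @mksub _ (subringoid_sg a c) _ (subringoid_comp (subP g) (subP f)).
Definition sid a : H a a := @mksub _ (subringoid_sg a a) _ (subringoid_id a).

Lemma scompA a b c d (h : H c d) (g : H b c) (f : H a b) :
  scomp h (scomp g f) = scomp (scomp h g) f.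
Proof. by apply: val_inj; apply: rcompA. Qed.
Lemma scomp1f a b (f : H a b) : scomp (sid b) f = f.
Proof. by apply: val_inj; apply: rcomp1f. Qed.
Lemma scompf1 a b (f : H a b) : scomp f (sid a) = f.
Proof. by apply: val_inj; apply: rcompf1. Qed.
Lemma scompBl a b c (g g' : H b c) (f : H a b) :
  scomp (g - g') f = scomp g f - scomp g' f.
Proof. by apply: val_inj; apply: rcompBl. Qed.
Lemma scompBr a b c (g : H b c) (f f' : H a b) :
  scomp g (f - f') = scomp g f - scomp g f'.
Proof. by apply: val_inj; apply: rcompBr. Qed.

Definition generated_subringoid : ringoid := @Ringoid (ob R)
  (fun a b => H a b) sid scomp scompA scomp1f scompf1 scompBl scompBr.

End Subringoid.

(* Left modules, i.e. covariant additive functors to abelian groups. *)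
Record rmodule (R : ringoid) := RModule {
  mob :> ob R -> zmodType;
  act : forall a b, rhom a b -> mob a -> mob b;
  act_id : forall a x, act (rid a) x = x;
  act_comp : forall a b c (g : rhom b c) (f : rhom a b) x,
    act (rcomp g f) x = act g (act f x);
  actBl : forall a b (f g : rhom a b) x, act (f - g) x = act f x - act g x;
  actBr : forall a b (f : rhom a b) x y, act f (x - y) = act f x - act f y }.

Arguments act {R} r {a b} f x.

Section NaturalTransformations.
Variables (R : ringoid) (M N : rmodule R).

Definition nat_mem (f : prodz (fun a => Hom (M a) (N a))) : Prop :=
  forall a b (g : rhom a b) x, app (f b) (act M g x) = act N g (app (f a) x).

Lemma act0 a b (g : rhom a b) : act N g 0 = 0.
Proof. by rewrite -(subrr 0) actBr subrr. Qed.

Lemma nat_mem0 : nat_mem 0.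
Proof. by move=> a b g x; rewrite act0. Qed.

Lemma nat_memB f f' : nat_mem f -> nat_mem f' -> nat_mem (f - f').
Proof.
move=> fP fP' a b g x.
rewrite -[LHS]/(app (f b) (act M g x) - app (f' b) (act M g x)).
by rewrite fP fP' -actBr.
Qed.

Definition Nat : zmodType := sub (Subgroup nat_mem0 nat_memB).

Definition napp (f : Nat) (a : ob R) (x : M a) : N a := app (val f a) x.

Lemma napp_is_zmod_morphism (f : Nat) (a : ob R) : zmod_morphism (@napp f a).
Proof. exact: raddfB. Qed.

HB.instance Definition _ (f : Nat) (a : ob R) :=
  GRing.isZmodMorphism.Build (M a) (N a) (@napp f a) (@napp_is_zmod_morphism f a).

Lemma nappP (f : Nat) a b (g : rhom a b) x :
  napp f (act M g x) = act N g (napp f x).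
Proof. exact: (subP f). Qed.

Definition mkNat (f : forall a, M a -> N a) (fB : forall a, zmod_morphism (f a))
  (fP : forall a b (g : rhom a b) x, f b (act M g x) = act N g (f a x)) : Nat :=
  @mksub _ (Subgroup nat_mem0 nat_memB) (fun a => mkHom (fB a)) fP.

End NaturalTransformations.

Arguments napp {R M N} f a x.

Lemma ncomp_subproof (R : ringoid) (L M N : rmodule R) (g : Nat M N) (f : Nat L M) :
  forall a b (h : rhom a b) x,
  napp g b (napp f b (act L h x)) = act N h (napp g a (napp f a x)).
Proof. by move=> a b h x; rewrite !nappP. Qed.

Definition ncomp (R : ringoid) (L M N : rmodule R) (g : Nat M N) (f : Nat L M) :
    Nat L N :=
  mkNat (fun a x y => etrans (congr1 (napp g a) (raddfB (napp f a) x y))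
                             (raddfB (napp g a) _ _))
        (ncomp_subproof g f).

Lemma nat_ext (R : ringoid) (M N : rmodule R) (f g : Nat M N) :
  (forall a x, napp f a x = napp g a x) -> f = g.
Proof.
move=> fg; apply: val_inj; apply: functional_extensionality_dep => a.
by apply: val_inj; apply: functional_extensionality_dep => x; apply: fg.
Qed.

Lemma ncompB (R : ringoid) (L M N : rmodule R) (g g' : Nat M N) (f : Nat L M) :
  ncomp (g - g') f = ncomp g f - ncomp g' f.
Proof. exact: nat_ext. Qed.

Lemma ncomp0 (R : ringoid) (L M N : rmodule R) (f : Nat L M) :
  ncomp (0 : Nat M N) f = 0.
Proof. exact: nat_ext. Qed.

(* The epimorphisms of modules are the pointwise surjective morphisms. *)
Definition projective (R : ringoid) (P : rmodule R) : Prop :=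
  forall (M N : rmodule R) (p : Nat M N) (f : Nat P N),
  (forall a (y : N a), exists x, napp p a x = y) ->
  exists g : Nat P M, ncomp p g = f.

Record projective_resolution (R : ringoid) (M : rmodule R) := {
  res :> nat -> rmodule R;
  res_proj : forall s, projective (res s);
  res_d : forall s, Nat (res s.+1) (res s);
  res_aug : Nat (res 0%N) M;
  res_surj : forall a (x : M a), exists y, napp res_aug a y = x;
  res_exact0 : forall a (x : res 0%N a),
    napp res_aug a x = 0 <-> exists y, napp (res_d 0) a y = x;
  res_exact : forall s a (x : res s.+1 a),
    napp (res_d s) a x = 0 <-> exists y, napp (res_d s.+1) a y = x }.

Section Ext.
Variables (R : ringoid) (M : rmodule R) (P : projective_resolution M).
Variables (N : rmodule R) (s : nat).

Definition ext_cocycle_mem (f : Nat (P s) N) : Prop := ncomp f (res_d P s) = 0.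

Definition ext_coboundary_mem : Nat (P s) N -> Prop :=
  match s with
  | 0 => fun f => f = 0
  | s'.+1 => fun f => exists g : Nat (P s') N, f = ncomp g (res_d P s')
  end.

Lemma ext_cocycle0 : ext_cocycle_mem 0.
Proof. exact: ncomp0. Qed.

Lemma ext_cocycleB f g :
  ext_cocycle_mem f -> ext_cocycle_mem g -> ext_cocycle_mem (f - g).
Proof. by rewrite /ext_cocycle_mem ncompB => -> ->; rewrite subr0. Qed.

Lemma ext_coboundary0 : ext_coboundary_mem 0.
Proof. by rewrite /ext_coboundary_mem; case: s => [|s'] //; exists 0; rewrite ncomp0. Qed.

Lemma ext_coboundaryB f g :
  ext_coboundary_mem f -> ext_coboundary_mem g -> ext_coboundary_mem (f - g).
Proof.
rewrite /ext_coboundary_mem; move: f g; case: s => [|s'] f g.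
  by move=> -> ->; rewrite subr0.
by case=> [f' ->] [g' ->]; exists (f' - g'); rewrite ncompB.
Qed.

(* Ext^s(M, N), computed as H^s(Hom(P, N)); resolutions P exist by
   projective_resolution_exists. *)
Definition Ext : zmodType :=
  subquo (Subgroup ext_cocycle0 ext_cocycleB)
         (Subgroup ext_coboundary0 ext_coboundaryB).

End Ext.

Section FreeModule.
Variables (R : ringoid) (M : rmodule R).

Definition free_gen b := {a : ob R & (M a * rhom a b)%type}.
Definition fgen b a (x : M a) (h : rhom a b) : free_gen b :=
  existT (fun a => (M a * rhom a b)%type) a (x, h).

Inductive free_rel b : {malg int[{classic (free_gen b)}]} -> Prop :=
| FreeRel a (x : M a) (h h' : rhom a b) :
    free_rel (free_sym (fgen x (h - h')) - (free_sym (fgen x h) - free_sym (fgen x h'))).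

Definition fsym b a (x : M a) (h : rhom a b) : pres (@free_rel b) :=
  sym (@free_rel b) (fgen x h).

Lemma fsymB b a (x : M a) (h h' : rhom a b) :
  fsym x (h - h') = fsym x h - fsym x h'.
Proof.
apply/eqP; rewrite -subr_eq0 /fsym /sym -!raddfB -(raddf0 (cl _)).
apply/eqP/cl_eq; rewrite subr0; apply: gen_in; exact: FreeRel.
Qed.

Lemma free_module_lift b (W : zmodType) (f : forall a, M a -> rhom a b -> W) :
  (forall a x, zmod_morphism (f a x)) ->
  exists h : Hom (pres (@free_rel b)) W, forall a x g, app h (fsym x g) = f a x g.
Proof.
move=> fB; pose F (t : free_gen b) := f (projT1 t) (projT2 t).1 (projT2 t).2.
have [|h hP] := @pres_lift _ (@free_rel b) W F; last by exists h => a x g; apply: hP.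
by move=> _ [a x g g']; rewrite !free_lift_zmod_morphism !free_lift_sym /F /= fB subrr.
Qed.

Lemma free_act_ex b c (f : rhom b c) :
  exists h : Hom (pres (@free_rel b)) (pres (@free_rel c)),
  forall a (x : M a) (g : rhom a b), app h (fsym x g) = fsym x (rcomp f g).
Proof.
apply: (@free_module_lift b _ (fun a x g => fsym x (rcomp f g))).
by move=> a x g g'; rewrite rcompBr fsymB.
Qed.

Definition free_act b c (f : rhom b c) := projT1 (cid (free_act_ex f)).
Lemma free_actE b c (f : rhom b c) a (x : M a) (g : rhom a b) :
  app (free_act f) (fsym x g) = fsym x (rcomp f g).
Proof. exact: (projT2 (cid (free_act_ex f))). Qed.

Lemma free_hom_ext b (W : zmodType) (f g : pres (@free_rel b) -> W) :
  zmod_morphism f -> zmod_morphism g ->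
  (forall a (x : M a) h, f (fsym x h) = g (fsym x h)) -> forall u, f u = g u.
Proof.
move=> fB gB fg; apply: (@pres_hom_ext _ _ _ (mkHom fB) (mkHom gB)).
by case=> a [x h]; apply: fg.
Qed.

Definition free_module : rmodule R.
Proof.
refine (@RModule R (fun b => pres (@free_rel b))
  (fun b c f => app (free_act f)) _ _ _ _).
- move=> b; apply: (free_hom_ext (g := id)) => [x y|x y|a x h] //.
    exact: raddfB.
  by rewrite free_actE rcomp1f.
- move=> b c d g f.
  apply: (free_hom_ext (f := app (free_act (rcomp g f)))
     (g := fun u => app (free_act g) (app (free_act f) u))) => [x y|x y|a x h].
  + exact: raddfB.
  + by rewrite !raddfB.
  + by rewrite !free_actE rcompA.
- move=> b c f g.
  apply: (free_hom_ext (f := app (free_act (f - g)))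
     (g := fun u => app (free_act f) u - app (free_act g) u)) => [x y|x y|a x h].
  + exact: raddfB.
  + rewrite (appB (free_act f)) (appB (free_act g)) !opprD !opprK addrACA.
    by congr (_ + _); rewrite addrC.
  + by rewrite !free_actE rcompBl fsymB.
- by move=> b c f x y; rewrite raddfB.
Defined.

Lemma free_module_projective : projective free_module.
Proof.
move=> N N' p f psurj.
have [y yP] : exists y : forall a, M a -> N a,
    forall a x, napp p a (y a x) = napp f a (fsym x (rid a)).
  exists (fun a x => projT1 (cid (psurj a (napp f a (fsym x (rid a)))))).
  by move=> a x; apply: (projT2 (cid (psurj a _))).
have gex b : exists h : Hom (pres (@free_rel b)) (N b),
    forall a x g, app h (fsym x g) = act N g (y a x).
  apply: (@free_module_lift b _ (fun a x g => act N g (y a x))).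
  by move=> a x g g'; rewrite actBl.
pose g b := projT1 (cid (gex b)).
have gE b a (x : M a) h : app (g b) (fsym x h) = act N h (y a x).
  exact: (projT2 (cid (gex b))).
have gB b : zmod_morphism (app (g b)) by exact: raddfB.
have gN a b (h : rhom a b) (x : free_module a) :
    app (g b) (act free_module h x) = act N h (app (g a) x).
  move: x; apply: (free_hom_ext (f := fun x => app (g b) (app (free_act h) x))
     (g := fun x => act N h (app (g a) x))) => [x z|x z|c x k].
  - by rewrite !raddfB.
  - by rewrite raddfB actBr.
  - by rewrite free_actE !gE act_comp.
exists (@mkNat R free_module N (fun b => app (g b)) gB gN); apply: nat_ext => b.
apply: (free_hom_ext (f := fun u => napp p b (app (g b) u)) (g := napp f b)).
- by move=> x z; rewrite !raddfB.
- exact: raddfB.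
move=> a x h; rewrite gE nappP yP -nappP; congr (napp f b _).
by rewrite [LHS]free_actE rcompf1.
Qed.

Lemma free_cover_ex :
  exists p : Nat free_module M, forall a x, exists y, napp p a y = x.
Proof.
have gex b : exists h : Hom (pres (@free_rel b)) (M b),
    forall a x g, app h (fsym x g) = act M g (x : M a).
  apply: (@free_module_lift b _ (fun a x g => act M g x)).
  by move=> a x g g'; rewrite actBl.
pose g b := projT1 (cid (gex b)).
have gE b a (x : M a) h : app (g b) (fsym x h) = act M h x.
  exact: (projT2 (cid (gex b))).
have gB b : zmod_morphism (app (g b)) by exact: raddfB.
have gN a b (h : rhom a b) (x : free_module a) :
    app (g b) (act free_module h x) = act M h (app (g a) x).
  move: x; apply: (free_hom_ext (f := fun x => app (g b) (app (free_act h) x))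
     (g := fun x => act M h (app (g a) x))) => [x z|x z|c x k].
  - by rewrite !raddfB.
  - by rewrite raddfB actBr.
  - by rewrite free_actE !gE act_comp.
exists (@mkNat R free_module M (fun b => app (g b)) gB gN) => a x; exists (fsym x (rid a)).
by rewrite [LHS]gE act_id.
Qed.

End FreeModule.

Section Kernel.
Variables (R : ringoid) (M N : rmodule R) (f : Nat M N).

Lemma ker0 a : napp f a 0 = 0. Proof. exact: raddf0. Qed.
Lemma kerB a x y : napp f a x = 0 -> napp f a y = 0 -> napp f a (x - y) = 0.
Proof. by move=> fx fy; rewrite napp_is_zmod_morphism fx fy subr0. Qed.

Definition ker_sg a := @Subgroup _ (fun x => napp f a x = 0) (ker0 a) (@kerB a).

Lemma ker_act a b (g : rhom a b) (x : sub (ker_sg a)) : ker_sg b (act M g (val x)).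
Proof. by rewrite /= nappP (subP x) act0. Qed.

Definition ker : rmodule R.
Proof.
refine (@RModule R (fun a => sub (ker_sg a))
  (fun a b g x => mksub (ker_act g x)) _ _ _ _).
- by move=> a x; apply: val_inj; apply: act_id.
- by move=> a b c g h x; apply: val_inj; apply: act_comp.
- by move=> a b g h x; apply: val_inj; apply: actBl.
- by move=> a b g x y; apply: val_inj; apply: actBr.
Defined.

Definition ker_incl : Nat ker M.
Proof.
refine (@mkNat R ker M (fun a (x : sub (ker_sg a)) => val x) _ _).
- by move=> a x y; apply: raddfB.
- by [].
Defined.

End Kernel.

Lemma projective_resolution_exists (R : ringoid) (M : rmodule R) :
  inhabited (projective_resolution M).
Proof.
pose cov K := projT1 (cid (@free_cover_ex R K)).
have covP (K : rmodule R) a (x : K a) : exists y, napp (cov K) a y = x.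
  exact: (projT2 (cid (@free_cover_ex R K))).
pose K := fix K n := if n is m.+1 then ker (cov (K m)) else M.
pose d s : Nat (free_module (K s.+1)) (free_module (K s)) :=
  ncomp (ker_incl (cov (K s))) (cov (K s.+1)).
have ex s a (x : free_module (K s) a) :
    napp (cov (K s)) a x = 0 <-> exists y, napp (d s) a y = x.
  split=> [x0|[y <-]]; last exact: (subP (napp (cov (K s.+1)) a y)).
  have [y yE] := @covP (K s.+1) a (@mksub _ (ker_sg (cov (K s)) a) x x0).
  by exists y; rewrite -[LHS]/(val (napp (cov (K s.+1)) a y)) yE.
constructor; apply: (@Build_projective_resolution R M
  (fun s => free_module (K s)) _ d (cov M)).
- by move=> s; apply: free_module_projective.
- exact: covP.
- exact: (ex 0).
- move=> s a x; rewrite -ex; split=> e.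
    by apply: val_inj.
  by rewrite -[LHS]/(val (napp (cov (K s.+1)) a x)) e.
Qed.

Definition free_alg := {malg 'F_2[{fmonom nat}]}.
Definition fvar (i : nat) : free_alg := << 1 *g fmu i >>.

(* Sq^0 is a generator here, identified with 1 by a relation. In the Adem
   relation 0 < i < 2j and t <= i/2, so j - t - 1 and i - 2t do not truncate. *)
Inductive steenrod_rel : free_alg -> Prop :=
| steenrod_sq0 : steenrod_rel (fvar 0 - 1)
| steenrod_adem (i j : nat) : (0 < i)%N -> (i < 2 * j)%N ->
    steenrod_rel (fvar i * fvar j
      - \sum_(0 <= t < (i %/ 2).+1)
          (fvar (i + j - t) * fvar t) *+ 'C(j - t - 1, i - 2 * t)).

Definition steenrod : pzRingType := rquo steenrod_rel.
Definition Sq (i : nat) : steenrod := rcl steenrod_rel (fvar i).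

(* The homogeneous part A^n; it is 0 for n < 0. *)
Definition steenrod_deg (n : int) : subgroup steenrod :=
  gen (fun x => exists w : seq nat,
                (sumn w)%:Z = n /\ x = \prod_(i <- w) Sq i).

Lemma steenrod_deg1 n : n = 0 -> steenrod_deg n 1.
Proof. by move=> ->; apply: gen_in; exists [::]; rewrite big_nil. Qed.

Lemma steenrod_degM n m p x y : p = n + m ->
  steenrod_deg n x -> steenrod_deg m y -> steenrod_deg p (x * y).
Proof.
move=> -> + Hy; elim=> {x} [_ [w [wn ->]]||x x' _ IHx _ IHx'].
- elim: Hy => {y} [_ [v [vm ->]]||y y' _ IHy _ IHy'].
  + apply: gen_in; exists (w ++ v); rewrite sumn_cat big_cat.
    by rewrite -wn -vm PoszD.
  + by rewrite mulr0; apply: gen_0.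
  + rewrite mulrBr. exact: sg_memB.
- by rewrite mul0r; apply: gen_0.
- rewrite mulrBl. exact: sg_memB.
Qed.

Section RingoidA.

Let H (a b : int) := sub (steenrod_deg (b - a)).

Lemma Acomp_subproof a b c (g : H b c) (f : H a b) :
  steenrod_deg (c - a) (val g * val f).
Proof. by apply: steenrod_degM (subP g) (subP f); rewrite addrA subrK. Qed.

Lemma Aid_subproof (a : int) : steenrod_deg (a - a) 1.
Proof. by apply: steenrod_deg1; rewrite subrr. Qed.

Definition Acomp a b c (g : H b c) (f : H a b) : H a c :=
  mksub (Acomp_subproof g f).
Definition Aid a : H a a := mksub (Aid_subproof a).

Lemma AcompA a b c d (h : H c d) (g : H b c) (f : H a b) :
  Acomp h (Acomp g f) = Acomp (Acomp h g) f.
Proof. by apply: val_inj; apply: mulrA. Qed.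
Lemma Acomp1f a b (f : H a b) : Acomp (Aid b) f = f.
Proof. by apply: val_inj; apply: mul1r. Qed.
Lemma Acompf1 a b (f : H a b) : Acomp f (Aid a) = f.
Proof. by apply: val_inj; apply: mulr1. Qed.
Lemma AcompBl a b c (g g' : H b c) (f : H a b) :
  Acomp (g - g') f = Acomp g f - Acomp g' f.
Proof. by apply: val_inj; apply: mulrBl. Qed.
Lemma AcompBr a b c (g : H b c) (f f' : H a b) :
  Acomp g (f - f') = Acomp g f - Acomp g f'.
Proof. by apply: val_inj; apply: mulrBr. Qed.

Definition ringoidA : ringoid := @Ringoid int
  (fun a b => H a b) Aid Acomp AcompA Acomp1f Acompf1 AcompBl AcompBr.

End RingoidA.

(* Sq^i as a morphism a -> b; only meaningful for b = a + i. *)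
Definition SqA (i : nat) (a b : int) : @rhom ringoidA a b :=
  insubd (0 : sub (steenrod_deg (b - a))) (Sq i).

Lemma SqAE i a b : b = a + i%:Z -> val (SqA i a b) = Sq i.
Proof.
move=> ->; apply: insubdK; apply/asboolP; apply: gen_in; exists [:: i].
by rewrite /= addn0 big_seq1 addrAC subrr add0r.
Qed.

Inductive unstable_rel : forall a b : ob ringoidA, rhom a b -> Prop :=
| UnstableRel (i : nat) (n : int) : n < i%:Z ->
    @unstable_rel n (n + i%:Z) (SqA i n (n + i%:Z)).

Definition ringoidQ : ringoid := quotient_ringoid unstable_rel.

Definition clQ (a b : int) (f : @rhom ringoidA a b) : @rhom ringoidQ a b :=
  cl (rideal unstable_rel a b) f.

Inductive Qk_gen (k : nat) : forall a b : ob ringoidQ, rhom a b -> Prop :=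
| QkGen (i : nat) (n : int) : n - i%:Z < k%:Z ->
    @Qk_gen k n (n + i%:Z) (clQ (SqA i n (n + i%:Z))).

Definition Qk (k : nat) : ringoid := generated_subringoid (@Qk_gen k).

(* Sq^i as a morphism a -> b; only meaningful for b = a + i and a - i < k. *)
Definition SqQk (k i : nat) (a b : int) : @rhom (Qk k) a b :=
  insubd (0 : sub (subringoid_sg (@Qk_gen k) a b)) (clQ (SqA i a b)).

Lemma SqQkE k i a b : b = a + i%:Z -> a - i%:Z < k%:Z ->
  val (SqQk k i a b) = clQ (SqA i a b).
Proof.
move=> -> ak; apply: insubdK; apply/asboolP; apply: subringoid_in.
exact: QkGen.
Qed.

Definition zero_word (w : {fmonom nat}) : 'F_2 := (all (pred1 0%N) w)%:R.

Lemma zero_word_mmorphism : mmorphism zero_word.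
Proof.
split=> [w v|]; last by rewrite /zero_word fm1.
by rewrite /zero_word fmM all_cat; do 2 case: all; rewrite /= ?mulr0 ?mulr1 ?mul0r.
Qed.

HB.instance Definition _ :=
  isMultiplicative.Build {fmonom nat} 'F_2 zero_word zero_word_mmorphism.

Definition faug : free_alg -> 'F_2 := mmap idfun zero_word.

HB.instance Definition _ := GRing.RMorphism.copy faug (mmap idfun zero_word).

Lemma faug_var i : faug (fvar i) = (i == 0%N)%:R.
Proof. by rewrite /faug mmapU /= mul1r /zero_word fmU /= andbT. Qed.

Lemma faugM x y : faug (x * y) = faug x * faug y.
Proof. exact: rmorphM. Qed.

Lemma faugB x y : faug (x - y) = faug x - faug y.
Proof. exact: rmorphB. Qed.

Lemma faug1 : faug 1 = 1.
Proof. exact: rmorph1. Qed.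

Lemma faugMn x n : faug (x *+ n) = faug x *+ n.
Proof. exact: rmorphMn. Qed.

Lemma faug_sum m n (F : nat -> free_alg) :
  faug (\sum_(m <= t < n) F t) = \sum_(m <= t < n) faug (F t).
Proof. exact: rmorph_sum. Qed.

Lemma faug_ideal x : ideal steenrod_rel x -> faug x = 0.
Proof.
elim=> {x} [_ [|i j i0 ij]||x y _ hx _ hy|a x b _ hx].
- by rewrite faugB faug_var faug1 eqxx subrr.
- rewrite faugB faug_sum faugM !faug_var (gtn_eqF i0) mul0r big_nat big1 ?subr0 //.
  move=> t /andP[_]; rewrite ltnS => ti; rewrite faugMn faugM !faug_var.
  have /negbTE -> : (i + j - t != 0)%N.
    rewrite -lt0n subn_gt0 (leq_ltn_trans ti) // (leq_ltn_trans (leq_div i 2)) //.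
    by rewrite -[X in (X < _)%N]addn0 ltn_add2l; case: j ij.
  by rewrite mul0r mul0rn.
- exact: rmorph0.
- by rewrite faugB hx hy subr0.
- by rewrite !faugM hx mulr0 mul0r.
Qed.

Definition aug (x : steenrod) : 'F_2 := faug (repr x).

Lemma aug_cl x : aug (rcl steenrod_rel x) = faug x.
Proof.
apply/eqP; rewrite -subr_eq0 -rmorphB; apply/eqP; apply: faug_ideal.
exact: (repr_cl (ideal steenrod_rel) x).
Qed.

Lemma rclK (x : steenrod) : rcl steenrod_rel (repr x) = x.
Proof. exact: (cl_repr (x : quo (ideal steenrod_rel))). Qed.

Lemma augB x y : aug (x - y) = aug x - aug y.
Proof. by rewrite -[x]rclK -[y]rclK -rmorphB !aug_cl rmorphB. Qed.

Lemma augM x y : aug (x * y) = aug x * aug y.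
Proof. by rewrite -[x]rclK -[y]rclK -rmorphM !aug_cl rmorphM. Qed.

Lemma aug1 : aug 1 = 1.
Proof. by rewrite -(rmorph1 (rcl steenrod_rel)) aug_cl rmorph1. Qed.

Lemma aug0 : aug 0 = 0.
Proof. by rewrite -(rmorph0 (rcl steenrod_rel)) aug_cl rmorph0. Qed.

Lemma aug_deg n x : steenrod_deg n x -> n != 0 -> aug x = 0.
Proof.
move=> + n0; elim=> {x} [_ [w [wn ->]]||x y _ hx _ hy].
- have : sumn w != 0%N by apply: contraNneq n0 => w0; rewrite -wn w0.
  elim: w {wn} => [//|i w IH]; rewrite big_cons augM /Sq aug_cl faug_var /=.
  by case: i => [/IH ->|i _]; rewrite ?mulr0 ?mul0r.
- exact: aug0.
- by rewrite augB hx hy subr0.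
Qed.

Lemma steenrod_deg_lt0 n x : n < 0 -> steenrod_deg n x -> x = 0.
Proof.
move=> n0; elim=> {x} [_ [w [wn ->]]|//|x y _ -> _ ->]; last by rewrite subr0.
by rewrite -wn in n0.
Qed.

Lemma aug_unstable a b (f : @rhom ringoidA a b) : 0 <= (a : int) ->
  rideal unstable_rel a b f -> aug (val f) = 0.
Proof.
move=> + fI; elim: fI => {a b f} [a b _ [i n ni] n0|a b _|a b f g _ hf _ hg a0|].
- rewrite SqAE // /Sq aug_cl faug_var; case: i ni => // /(le_lt_trans n0).
  by rewrite ltxx.
- exact: aug0.
- by rewrite raddfB augB hf // hg // subr0.
move=> a b c d h f g _ hf a0.
have [b0|b0] := ltP (b : int) 0; last by rewrite /= !augM hf // mulr0 mul0r.
have g0 : val g = 0.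
  by apply: steenrod_deg_lt0 (subP g); rewrite subr_lt0 (lt_le_trans b0).
by rewrite /= g0 mulr0 aug0.
Qed.

Definition augQ a b (f : @rhom ringoidQ a b) : 'F_2 := aug (val (repr f)).

Lemma augQ_cl a b (f : @rhom ringoidA a b) : 0 <= (a : int) ->
  augQ (clQ f) = aug (val f).
Proof.
move=> a0; apply/eqP; rewrite -subr_eq0 -augB -raddfB; apply/eqP.
by apply: aug_unstable => //; apply: (repr_cl (rideal unstable_rel a b) f).
Qed.

Lemma augQB a b (f g : @rhom ringoidQ a b) : 0 <= (a : int) ->
  augQ (f - g) = augQ f - augQ g.
Proof.
move=> a0; have -> : f - g = clQ (repr f - repr g).
  by rewrite /clQ raddfB /= !cl_repr.
by rewrite augQ_cl // raddfB augB.
Qed.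

Lemma augQM a b c (g : @rhom ringoidQ b c) (f : @rhom ringoidQ a b) :
  0 <= (a : int) -> augQ (rcomp g f) = augQ g * augQ f.
Proof.
move=> a0; rewrite -[rcomp g f]/(clQ (rcomp (repr g) (repr f))) augQ_cl //.
exact: augM.
Qed.

Lemma augQ1 a : 0 <= (a : int) -> augQ (@rid ringoidQ a) = 1.
Proof.
move=> a0; rewrite -[@rid ringoidQ a]/(clQ (@rid ringoidA a)) augQ_cl //.
exact: aug1.
Qed.

Lemma augQ_deg (a b : int) (f : @rhom ringoidQ a b) : b != a -> augQ f = 0.
Proof. by move=> ba; apply: aug_deg (subP (repr f)) _; rewrite subr_eq0. Qed.

Section SphereModule.
Variables (k a : nat).

(* F_2 in degree n = a, and 0 in the other degrees. *)
Definition sphere_mem (n : int) (x : 'F_2) : Prop := n = a%:Z \/ x = 0.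

Lemma sphere0 n : sphere_mem n 0. Proof. by right. Qed.
Lemma sphereB n x y : sphere_mem n x -> sphere_mem n y -> sphere_mem n (x - y).
Proof. by case=> [->|->]; [left|case=> [->|->]; [left|right; rewrite subr0]]. Qed.
Definition sphere_sg n := Subgroup (sphere0 n) (@sphereB n).

Lemma sphere_act_subproof b c (f : @rhom (Qk k) b c) (x : sub (sphere_sg b)) :
  sphere_sg c (augQ (val f) * val x).
Proof.
case: (subP x) => [ba|->]; last by right; rewrite mulr0.
have [ca|ca] := eqVneq (c : int) a%:Z; [by left|right].
by rewrite augQ_deg ?mul0r // ba.
Qed.

Lemma sphere_case b (x : sub (sphere_sg b)) : val x = 0 \/ 0 <= (b : int).
Proof. by case: (subP x) => [e|e]; [right; rewrite e|left]. Qed.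

(* S_k(a): the morphisms act through the augmentation, which is the only
   action of Q_k on these groups. *)
Definition sphere : rmodule (Qk k).
Proof.
refine (@RModule (Qk k) (fun n => sub (sphere_sg n))
  (fun b c f x => mksub (sphere_act_subproof f x)) _ _ _ _).
- move=> b x; apply: val_inj => /=.
  have [x0|b0] := sphere_case x; first by rewrite !x0 mulr0.
  by rewrite (@augQ1 b) // mul1r.
- move=> b c d g f x; apply: val_inj => /=.
  have [x0|b0] := sphere_case x; first by rewrite !x0 !mulr0.
  by rewrite (@augQM b) // mulrA.
- move=> b c f g x; apply: val_inj.
  rewrite -[LHS]/(augQ (val f - val g) * val x).
  rewrite -[RHS]/(augQ (val f) * val x - augQ (val g) * val x).
  have [x0|b0] := sphere_case x; first by rewrite !x0 !mulr0 subr0.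
  by rewrite (@augQB b) // mulrBl.
- by move=> b c f x y; apply: val_inj; apply: mulrBr.
Defined.

End SphereModule.

(* The summation bounds t < j express that binom(j-t-1, t) = 0 for t >= j,
   where the truncated subtraction would give a wrong value. *)
Inductive lambda_rel : free_alg -> Prop :=
| LambdaRel (i j : nat) :
    lambda_rel (fvar i * fvar (2 * i + 1 + j)
      - \sum_(0 <= t < j)
          (fvar (i + j - t) * fvar (2 * i + 1 + t)) *+ 'C(j - t - 1, t)).

Definition Lambda : pzRingType := rquo lambda_rel.
Definition lam (i : nat) : Lambda := rcl lambda_rel (fvar i).
Definition lam_mon (I : seq nat) : Lambda := \prod_(i <- I) lam i.

Definition is_lambda_diff (d : Hom Lambda Lambda) : Prop :=
  (forall x y, app d (x * y) = app d x * y + x * app d y) /\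
  (forall i, app d (lam i) =
     \sum_(1 <= j < i.+1) (lam (i - j) * lam (j - 1)) *+ 'C(i - j, j)).

(* The unique derivation with the prescribed values on the generators (its
   existence is a property of Lambda; xget returns 0 if there were none). *)
Definition lambda_d : Hom Lambda Lambda := xget 0 is_lambda_diff.

Definition admissible (I : seq nat) : bool := sorted (fun i j => j <= 2 * i)%N I.

Definition internal_degree (I : seq nat) : nat := (\sum_(i <- I) i.+1)%N.

Definition excess (I : seq nat) : int :=
  \sum_(0 <= r < (size I).-1) ((2 * nth 0 I r)%N%:Z - (nth 0%N I r.+1)%:Z).

(* The basis monomials of Lambda(m) and of Gamma(m, k). *)
Definition in_Lambda (m : nat) (I : seq nat) : bool :=
  admissible I && ((I == [::]) || (head 0%N I < m)%N).

Definition in_Gamma (m k : nat) (I : seq nat) : bool :=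
  [&& admissible I, I != [::], (head 0%N I < m)%N &
      (head 0%N I)%:Z - (m%:Z - k%:Z) < excess I + ((size I)%:Z - 1)].

Definition Lambda_sub (m : nat) : subgroup Lambda :=
  gen (fun x => exists I, in_Lambda m I /\ x = lam_mon I).

Definition Gamma (m k : nat) : subgroup Lambda :=
  gen (fun x => exists I, in_Gamma m k I /\ x = lam_mon I).

Definition Lambda_k (k m : nat) : zmodType := subquo (Lambda_sub m) (Gamma m k).

(* The class in Lambda_k(m) of an element of Lambda(m); only meaningful for such
   elements. *)
Definition Lambda_k_cl (k m : nat) (x : Lambda) : Lambda_k k m :=
  cl (restr_sg (Lambda_sub m) (Gamma m k)) (insubd (0 : sub (Lambda_sub m)) x).

Section LambdaComplex.
Variables (k : nat) (M : rmodule (Qk k)).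

Definition dual (m : nat) : zmodType := Hom (M m%:Z) 'F_2.

Lemma dual_Sq_subproof m i (x : dual m) :
  zmod_morphism (fun y : M (m - i)%N%:Z =>
                   app x (act M (SqQk k i (m - i)%N%:Z m%:Z) y)).
Proof. by move=> y z; rewrite actBr appB. Qed.

(* x Sq^i, for x in M_m; only meaningful for i <= m and m - 2i < k. *)
Definition dual_Sq (m i : nat) (x : dual m) : dual (m - i) :=
  mkHom (@dual_Sq_subproof m i x).

Definition Lambda_kM_fam (m : nat) : zmodType := tensor (Lambda_k k m) (dual m).

Definition Lambda_kM : zmodType := dsum Lambda_kM_fam.

(* The element y (x) x of Lambda_k(M), for y in Lambda(m) and x in M_m. *)
Definition elt m (y : Lambda) (x : dual m) : Lambda_kM :=
  dinj Lambda_kM_fam m (tens (Lambda_k_cl k m y) x).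

Definition is_Lambda_kM_diff (d : Hom Lambda_kM Lambda_kM) : Prop :=
  forall m (I : seq nat) (x : dual m), in_Lambda m I ->
  app d (elt (lam_mon I) x) = elt (app lambda_d (lam_mon I)) x +
    \sum_(1 <= i < m.+1 | (2 * i <= m)%N && (m - 2 * i < k)%N)
      elt (lam (i - 1) * lam_mon I) (dual_Sq i x).

(* The elements elt (lam_mon I) x generate Lambda_k(M), so that at most one
   additive map satisfies this formula; see the remark on lambda_d. *)
Definition Lambda_kM_d : Hom Lambda_kM Lambda_kM := xget 0 is_Lambda_kM_diff.

Definition Lambda_kM_s (s : nat) : subgroup Lambda_kM :=
  gen (fun u => exists m (I : seq nat) (x : dual m),
    [/\ in_Lambda m I, size I = s & u = elt (lam_mon I) x]).

Definition Lambda_kM_sa (s a : nat) : subgroup Lambda_kM :=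
  gen (fun u => exists m (I : seq nat) (x : dual m),
    [/\ in_Lambda m I, size I = s, (m + internal_degree I)%N = a
      & u = elt (lam_mon I) x]).

Definition cocycle_mem s a (u : Lambda_kM) : Prop :=
  Lambda_kM_sa s a u /\ app Lambda_kM_d u = 0.

Definition coboundary_mem s a (u : Lambda_kM) : Prop :=
  match s with
  | 0 => u = 0
  | s'.+1 => exists2 v, Lambda_kM_sa s' a v & u = app Lambda_kM_d v
  end.

Lemma cocycle0 s a : cocycle_mem s a 0.
Proof. by split; [apply: sg_mem0|apply: raddf0]. Qed.
Lemma cocycleB s a u v :
  cocycle_mem s a u -> cocycle_mem s a v -> cocycle_mem s a (u - v).
Proof.
case=> [us du] [vs dv]; split; first exact: sg_memB.
by rewrite appB du dv subr0.
Qed.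

Lemma coboundary0 s a : coboundary_mem s a 0.
Proof. by case: s => [|s] //; exists 0; [apply: sg_mem0|rewrite raddf0]. Qed.
Lemma coboundaryB s a u v :
  coboundary_mem s a u -> coboundary_mem s a v -> coboundary_mem s a (u - v).
Proof.
case: s => [|s]; first by move=> -> ->; apply: subr0.
case=> [u' hu ->] [v' hv ->]; exists (u' - v'); first exact: sg_memB.
by rewrite appB.
Qed.

Definition Hsa (s a : nat) : zmodType :=
  subquo (Subgroup (cocycle0 s a) (@cocycleB s a))
         (Subgroup (coboundary0 s a) (@coboundaryB s a)).

End LambdaComplex.

Definition isomorphic (U V : zmodType) : Prop :=
  exists f : {additive U -> V}, bijective f.

(* Main.v *)
From Pilot Require Import Defs.
From HB Require Import structures.
From mathcomp Require Import all_boot all_order all_algebra.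
From mathcomp Require Import generic_quotient ring_quotient boolp classical_sets.
From mathcomp Require Import finmap zify ring.
From mathcomp.multinomials Require Import monalg.
Import Pilot.Defs.

Set Implicit Arguments.
Unset Strict Implicit.
Unset Printing Implicit Defensive.

Import Order.TTheory GRing.Theory Num.Theory.
Local Open Scope ring_scope.

(* Write Sq_r for the square Sq^i on classes of degree i + r. Reading lambda_i as
   Sq^(i+1), a monomial lambda_I started in degree m spells Sq_(r_1), Sq_(r_2), ...
   with lower indices r_1 = m - 1 - I(1), r_(j+1) = r_j + 2 I(j) - I(j+1) + 1.
   The basis of Lambda(m) consists of the I with 0 <= r_1 < r_2 < ..., and
   Gamma(m, k) of those whose last lower index is at least k; hence Lambda_k(m)
   vanishes above length k.

   For the comparison with Ext, replace Lambda_k(M) by the Lambda-valued cochains on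
   M, modulo Gamma; on a projective resolution P of M they form a double complex.
   It is exact in the direction of P because functionals extend from subspaces. It
   is exact in the other direction in positive lengths because every P_s is regular:
   if Sq_r x is a sum of images of the Sq_q with q < r, then so is x. By
   induction on k, a cocycle is cohomologous to one whose last lower indices are all
   k - 1. Its last letter can be split off, which leaves a shorter cocycle modulo
   Gamma(m, k - 1); this is a coboundary or has length 0, and in length 0 regularity
   lets it be divided by Sq_(k-1). The cocycles of length 0 on P_s are the functionals
   that vanish on all images of the Sq_q, which are the maps to the spheres.

   In a free module the sums of images of the Sq_q with q < r are detected by mapping
   each generator of degree a to x_1 ... x_a in F_2[x_1, ..., x_a]: they are the elements
   whose images contain no monomial of exponent 1 in all of x_1, ..., x_r. On the
   cofactor of x_1 ... x_r, Sq_r acts as the top square, which is the injective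
   Frobenius; so the free modules are regular. *)

(** Both differentials are picked by [xget] with default 0, so nothing can be computed before maps
    with the required properties are exhibited. For Lambda this needs a derivation compatible with
    the relations, and every use of Gamma(m, k) needs the linear independence of the admissible
    monomials. Both rest on identities between polynomials in x, y, z: a functional sending x^i y^j
    z^l to the value of the word k_i k_j k_l, with k_i = lambda_(i-1), turns the relations into (x
    y^2)^p (x + y)^n and the differential into x^n |-> (x + y)^n.

    Cochains are kept with values in Lambda itself. Their operator squares to zero only modulo
    Gamma(m, r), but r can then run from 0 to k on one and the same space, which the induction on
    the lower index requires; the quotient by Gamma is taken at the end, in coordinates. In a fixed
    bidegree only m <= a and finitely many words occur, so cochains and tensors carry the same
    information there.

    P_s can be infinite in each degree; functionals are therefore extended by Zorn's lemma. *)

Lemma F2P (c : 'F_2) : c = 0 \/ c = 1.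
Proof. by case: c => [[|[|n]] // h]; [left|right]; apply: val_inj. Qed.

Lemma zmorph0 (U V : zmodType) (f : U -> V) : zmod_morphism f -> f 0 = 0.
Proof. by move=> fB; rewrite -[X in f X](subrr 0) fB subrr. Qed.

(** * Abelian groups of exponent 2 as vector spaces over F_2 *)

Definition exp2 (V : zmodType) := forall v : V, v + v = 0.

Lemma exp2N (V : zmodType) : exp2 V -> forall v : V, - v = v.
Proof. by move=> h v; apply/eqP; rewrite eq_sym -addr_eq0 h. Qed.

Lemma exp2B (V : zmodType) : exp2 V -> forall u v : V, u - v = u + v.
Proof. by move=> h u v; rewrite (exp2N h). Qed.

Lemma exp2_eq (V : zmodType) : exp2 V -> forall u v : V, u + v = 0 <-> u = v.
Proof. by move=> h u v; split=> [/eqP|-> //]; rewrite addr_eq0 (exp2N h) => /eqP. Qed.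

Lemma exp2_odd (V : zmodType) : exp2 V -> forall (v : V) n, v *+ n = v *+ odd n.
Proof.
move=> h v n; rewrite -{1}(odd_double_half n) mulrnDr -muln2 mulnC mulrnA.
by rewrite mulr2n h mul0rn addr0.
Qed.

Lemma exp2_F2 : exp2 'F_2.
Proof. by move=> c; case: (F2P c) => ->; apply: val_inj. Qed.

(** Scalar multiplication by F_2 on a bare abelian group; it is additive in the scalar when the
    group has exponent 2. *)
Definition scF (V : zmodType) (c : 'F_2) (v : V) : V := v *+ (c != 0).

Lemma scF0 (V : zmodType) (v : V) : scF 0 v = 0. Proof. by rewrite /scF eqxx. Qed.
Lemma scF1 (V : zmodType) (v : V) : scF 1 v = v. Proof. by []. Qed.
Lemma scFDl (V : zmodType) : exp2 V ->
  forall c d (v : V), scF (c + d) v = scF c v + scF d v.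
Proof.
move=> h c d v; case: (F2P c) => ->; case: (F2P d) => ->;
  rewrite ?scF0 ?add0r ?addr0 ?scF0 //.
Qed.
Lemma scFB (V : zmodType) c (u v : V) : scF c (u - v) = scF c u - scF c v.
Proof. exact: mulrnBl. Qed.
Lemma scFr0 (V : zmodType) c : scF c (0 : V) = 0.
Proof. exact: mul0rn. Qed.
Lemma scFA (V : zmodType) c d (v : V) : scF c (scF d v) = scF (c * d) v.
Proof. by case: (F2P c) => ->; rewrite ?mul0r ?scF0 ?mul1r ?scF1. Qed.
Lemma scFf (V W : zmodType) (f : V -> W) c v : zmod_morphism f ->
  f (scF c v) = scF c (f v).
Proof.
move=> h; have h0 : f 0 = 0 by rewrite -(subrr 0) h subrr.
by case: (F2P c) => ->; rewrite ?scF0 ?scF1.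
Qed.

(** * Operators extended to actions of the free algebra *)

Section FreeAction.
Variables (V : zmodType) (V2 : exp2 V) (op : nat -> V -> V).
Hypothesis opB : forall i, zmod_morphism (op i).

Definition wact (w : seq nat) (v : V) : V := foldr op v w.

Lemma wactB w : zmod_morphism (wact w).
Proof.
elim: w => [|i w IH] u v //.
by have e z : wact (i :: w) z = op i (wact w z) by []; rewrite !e IH opB.
Qed.

Definition fact (x : free_alg) (v : V) : V :=
  \sum_(k <- msupp x) scF (x@_k) (wact k v).

Lemma factEw (d : {fset {fmonom nat}}) x v : (msupp x `<=` d)%fset ->
  fact x v = \sum_(k <- d) scF (x@_k) (wact k v).
Proof.
move=> le; rewrite [LHS](big_fset_incl _ le) => //= k kd /mcoeff_outdom ->.
by rewrite scF0.
Qed.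

Lemma factBl x y v : fact (x - y) v = fact x v - fact y v.
Proof.
pose d := (msupp x `|` msupp y `|` msupp (x - y))%fset.
have d1 : (msupp x `<=` d)%fset by rewrite /d -fsetUA fsubsetUl.
have d2 : (msupp y `<=` d)%fset.
  by rewrite /d; apply: fsubsetU; rewrite fsubsetUr.
have d3 : (msupp (x - y) `<=` d)%fset by rewrite /d fsubsetUr.
rewrite (factEw _ d1) (factEw _ d2) (factEw _ d3).
rewrite -sumrB; apply: eq_bigr => k _; rewrite mcoeffB (exp2B V2) (exp2B exp2_F2).
exact: scFDl.
Qed.

Lemma factBr x : zmod_morphism (fact x).
Proof.
move=> u v; rewrite /fact -sumrB; apply: eq_bigr => k _.
by rewrite wactB scFB.
Qed.

Lemma fact_suml I (r : seq I) (F : I -> free_alg) v :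
  fact (\sum_(i <- r) F i) v = \sum_(i <- r) fact (F i) v.
Proof.
by rewrite -[LHS]/(app (mkHom (fun x y => factBl x y v)) _) raddf_sum.
Qed.

Lemma fact0l v : fact 0 v = 0.
Proof. by rewrite -[LHS]/(app (mkHom (fun x y => factBl x y v)) _) raddf0. Qed.

Lemma factMnl x n v : fact (x *+ n) v = fact x v *+ n.
Proof. by rewrite -[LHS]/(app (mkHom (fun x y => factBl x y v)) _) raddfMn. Qed.

Lemma fact_sumr I (r : seq I) (F : I -> V) x :
  fact x (\sum_(i <- r) F i) = \sum_(i <- r) fact x (F i).
Proof. by rewrite -[LHS]/(app (mkHom (factBr x)) _) raddf_sum. Qed.

Lemma factU c (k : {fmonom nat}) v : fact << c *g k >> v = scF c (wact k v).
Proof.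
rewrite (@factEw [fset k]%fset) ?msuppU_le // big_seq_fset1.
by rewrite mcoeffUU.
Qed.

Lemma fact1 v : fact 1 v = v.
Proof. have -> : (1 : free_alg) =
    (<< (1 : 'F_2) *g (@mone _ : {fmonom nat}) >> : {malg 'F_2[{fmonom nat}]}).
  by [].
by rewrite factU scF1 /wact fm1. Qed.

Lemma fact_var i v : fact (fvar i) v = op i v.
Proof. by rewrite factU scF1 /wact fmU. Qed.

Lemma factM x y v : fact (x * y) v = fact x (fact y v).
Proof.
rewrite [x]monalgE [y]monalgE mulr_suml !fact_suml; apply: eq_bigr => k _.
rewrite mulr_sumr fact_suml fact_sumr; apply: eq_bigr => l _.
rewrite -[<< _ *g k >> * _]/(fgmul _ _) fgmulUU !factU.
rewrite (scFf _ _ (@wactB k)) scFA; congr scF.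
by rewrite /wact fmM foldr_cat.
Qed.

End FreeAction.

Lemma subgroup_ext (V : zmodType) (S T : subgroup V) :
  (forall x, S x <-> T x) -> S = T.
Proof.
case: S T => [S S0 SB] [T T0 TB] /= ST.
have e : S = T by apply: funext => x; apply: propext.
move: S0 SB; rewrite e => S0 SB.
by rewrite (Prop_irrelevance S0 T0) (Prop_irrelevance SB TB).
Qed.

(** * Extension of functionals with values in F_2 *)

Section Separation.
Local Open Scope classical_set_scope.
Variables (V : zmodType) (V2 : exp2 V).

(** A subgroup maximal among those containing [S] and avoiding [x] has index 2, and [f] is the
    quotient map by it. *)
Lemma separation (S : subgroup V) (x : V) : ~ S x ->
  exists f : Hom V 'F_2, (forall y, S y -> app f y = 0) /\ app f x = 1.
Proof.
move=> Sx.
pose G := {T : subgroup V | (forall y, S y -> T y) /\ ~ T x}.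
pose le (T U : G) := `[< forall y, sval T y -> sval U y >].
pose S0 : G := exist _ S (conj (fun y h => h) Sx).
have [||||T Tmax] := @Zorn G le.
- by move=> T; apply/asboolP.
- by move=> T U W /asboolP h1 /asboolP h2; apply/asboolP => y /h1 /h2.
- move=> [T hT] [U hU] /asboolP /= h1 /asboolP /= h2.
  have e : T = U by apply: subgroup_ext => y; split; [apply: h1|apply: h2].
  by move: hT hU; rewrite e => hT hU; congr exist; apply: Prop_irrelevance.
- move=> A tot.
  have [[T0 AT0]|nA] := pselect (exists T, A T); last first.
    by exists S0 => T AT; case: nA; exists T.
  pose U (y : V) := exists2 T, A T & sval T y.
  have U0 : U 0 by exists T0 => //; apply: sg_mem0.
  have UB y z : U y -> U z -> U (y - z).
    move=> [T AT Ty] [W AW Wz]; have [/asboolP h|/asboolP h] := tot _ _ AT AW.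
      by exists W => //; apply: sg_memB => //; apply: h.
    by exists T => //; apply: sg_memB => //; apply: h.
  have hU : (forall y, S y -> (Subgroup U0 UB) y) /\ ~ (Subgroup U0 UB) x.
    split=> [y Sy|[T AT Tx]]; last by case: (svalP T).
    by exists T0 => //; case: (svalP T0) => h _; apply: h.
  exists (exist _ (Subgroup U0 UB) hU) => T AT.
  by apply/asboolP => y Ty; exists T.
case: T Tmax => T [ST Tx] Tmax.
(* Otherwise adjoining [y] to [T] gives a larger subgroup that still avoids [x]. *)
have Tor y : T y \/ T (x + y).
  have [?|Ty] := pselect (T y); [by left|right].
  apply: contrapT => Txy.
  pose U z := T z \/ T (z + y).
  have U0 : U 0 by left; apply: sg_mem0.
  have UB z w : U z -> U w -> U (z - w).
    rewrite /U (exp2B V2); move=> [h1|h1] [h2|h2].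
    - by left; apply: sg_memD.
    - by right; rewrite -addrA; apply: sg_memD.
    - by right; rewrite addrAC; apply: sg_memD.
    - left; have -> : z + w = (z + y) + (w + y) by rewrite addrACA V2 addr0.
      exact: sg_memD.
  have hU : (forall y, S y -> (Subgroup U0 UB) y) /\ ~ (Subgroup U0 UB) x.
    split=> [z Sz|h]; first by left; apply: (ST).
    by case: h => h; [apply: (Tx)|apply: (Txy)].
  have e := Tmax (exist _ (Subgroup U0 UB) hU) (asboolT (fun z Tz => or_introl Tz)).
  apply: Ty; have := congr1 (fun W : G => sg_mem (sval W) y) e => /= <-.
  by right; rewrite V2; apply: sg_mem0.
pose f y : 'F_2 := (~~ `[< T y >])%:R.
have fB : zmod_morphism f.
  move=> y z; rewrite /f (exp2B V2) (exp2B exp2_F2).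
  have [Ty|nTy] := pselect (T y); have [Tz|nTz] := pselect (T z).
  - by rewrite !asboolT ?addr0 //; apply: sg_memD.
  - rewrite (asboolT Ty) (asboolF nTz) asboolF ?add0r // => h; apply: nTz.
    by rewrite -[z](addKr y); apply: sg_memD => //; apply: sg_memN.
  - rewrite (asboolT Tz) (asboolF nTy) asboolF ?addr0 // => h; apply: nTy.
    by rewrite -[y](addrK z); apply: sg_memB.
  - rewrite (asboolF nTy) (asboolF nTz) asboolT ?exp2_F2 //.
    case: (Tor y) => // hy; case: (Tor z) => // hz.
    have -> : y + z = (x + y) + (x + z) by rewrite addrACA V2 add0r.
    exact: sg_memD.
exists (mkHom fB); split=> [y Sy|]; first by rewrite /app /= /f asboolT //; apply: (ST).
by rewrite /app /= /f asboolF.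
Qed.

(** Since [D] contains 0, the hypothesis makes [f] vanish on the kernel of [g]. Over F_2 a nonzero
    functional is determined by its kernel and one point [u0] of value 1, so it suffices to separate
    the image of [u0] from the sum of [D] and the image of the kernel of [f]. *)
Lemma functional_extension (U : zmodType) (g : Hom U V) (D : subgroup V)
    (f : Hom U 'F_2) : (forall u, D (app g u) -> app f u = 0) ->
  exists h : Hom V 'F_2, (forall y, D y -> app h y = 0) /\
                         forall u, app h (app g u) = app f u.
Proof.
move=> fD; have [f0|nf0] := pselect (forall u, app f u = 0).
  by exists 0; split=> // u; rewrite f0.
have [u0 fu0] : exists u0, app f u0 = 1.
  apply: contrapT => h; apply: nf0 => u; case: (F2P (app f u)) => // e.
  by case: h; exists u.
pose S y := exists d u, [/\ D d, app f u = 0 & y = d + app g u].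
have S0 : S 0.
  by exists 0, 0; rewrite !raddf0 addr0; split=> //; apply: sg_mem0.
have SB y z : S y -> S z -> S (y - z).
  move=> [d [u [Dd fu ->]]] [e [v [De fv ->]]]; exists (d - e), (u - v).
  by rewrite !appB fu fv subrr opprD addrACA; split=> //; apply: sg_memB.
have [|h [hS hg]] := @separation (Subgroup S0 SB) (app g u0).
  move=> [d [u [Dd fu e]]]; have : app f (u0 - u) = 0.
    by apply: fD; rewrite appB e addrK.
  by rewrite appB fu fu0 subr0 => /eqP; rewrite oner_eq0.
exists h; split=> [y Dy|u].
  by apply: hS; exists y, 0; rewrite !raddf0 addr0.
have zz v : app f v = 0 -> app h (app g v) = 0.
  by move=> fv; apply: hS; exists 0, v; rewrite add0r; split=> //; apply: sg_mem0.
case: (F2P (app f u)) => fu; first by rewrite fu zz.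
have : app h (app g (u - u0)) = 0 by apply: zz; rewrite appB fu fu0 subrr.
by rewrite !appB hg fu => /eqP; rewrite subr_eq0 => /eqP.
Qed.

End Separation.

(** * Isomorphisms of subquotients *)

Section Isomorphic.

Lemma isoI (U V : zmodType) (f : Hom U V) : bijective (app f) -> isomorphic U V.
Proof. by move=> fb; exists (GRing.Additive.clone _ _ (app f) _). Qed.

Lemma isomorphic_refl (U : zmodType) : isomorphic U U.
Proof. by apply: (isoI (f := @mkHom U U id (fun x y => erefl))); exists id. Qed.

Lemma isomorphic_trans (U V W : zmodType) :
  isomorphic U V -> isomorphic V W -> isomorphic U W.
Proof.
move=> [f fb] [g gb].
have B : zmod_morphism (g \o f) by move=> x y; rewrite /= !raddfB.
by apply: (isoI (f := mkHom B)); apply: bij_comp.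
Qed.

(* An additive relation inducing a bijection modulo [B1] and [B2] is an
   isomorphism of the subquotients. *)
Lemma subquo_iso (V1 V2 : zmodType) (Z1 B1 : subgroup V1) (Z2 B2 : subgroup V2)
    (R : V1 -> V2 -> Prop) :
  (forall u v u' v', R u v -> R u' v' -> R (u - u') (v - v')) ->
  (forall u, Z1 u -> exists2 v, Z2 v & R u v) ->
  (forall v, Z2 v -> exists2 u, Z1 u & R u v) ->
  (forall u v, Z1 u -> Z2 v -> R u v -> (B1 u <-> B2 v)) ->
  isomorphic (subquo Z1 B1) (subquo Z2 B2).
Proof.
move=> RB R1 R2 RBB.
rewrite /subquo; set Q1 := quo _; set Q2 := quo _.
pose C1 := cl (restr_sg Z1 B1); pose C2 := cl (restr_sg Z2 B2).
have K1 (a : Q1) : C1 (repr a) = a by exact: cl_repr.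
have K2 (a : Q2) : C2 (repr a) = a by exact: cl_repr.
have C1B x y : C1 (x - y) = C1 x - C1 y by exact: raddfB.
have C2B x y : C2 (x - y) = C2 x - C2 y by exact: raddfB.
have ex (a : Q1) : exists v : sub Z2, R (val (repr a)) (val v).
  by have [v Zv Rv] := R1 _ (subP (repr a)); exists (mksub Zv).
pose g a := projT1 (cid (ex a)); have gP a : R (val (repr a)) (val (g a)).
  exact: (projT2 (cid (ex a))).
pose f a : Q2 := C2 (g a).
have fE (u : sub Z1) (v : sub Z2) : R (val u) (val v) -> f (C1 u) = C2 v.
  move=> Ruv; apply/cl_eq; rewrite /restr_sg /= /restr_mem /=.
  have := RB _ _ _ _ (gP (C1 u)) Ruv; rewrite -!raddfB => h.
  have [+ _] := RBB _ _ (subP _) (subP _) h; apply.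
  exact: (repr_cl (restr_sg Z1 B1) u).
have fB : zmod_morphism f.
  move=> a b; have -> : a - b = C1 (repr a - repr b).
    by rewrite C1B !K1.
  rewrite (fE _ (g a - g b)); first by rewrite /f C2B.
  by rewrite !raddfB; apply: RB; apply: gP.
apply: (isoI (f := mkHom fB)).
have finj : injective f.
  move=> a b e; rewrite -[a]K1 -[b]K1; apply/cl_eq.
  have : C2 (g a - g b) = C2 0.
    by rewrite C2B -(subrr 0) C2B subrr; apply/eqP; rewrite subr_eq0; apply/eqP.
  move/cl_eq; rewrite subr0 => h.
  have Rab : R (val (repr a - repr b)) (val (g a - g b)).
    by rewrite !raddfB; apply: RB; apply: gP.
  by have [_] := RBB _ _ (subP (repr a - repr b)) (subP (g a - g b)) Rab; apply.
have fsurj b : exists a, f a = b.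
  have [u Zu Ru] := R2 _ (subP (repr b)).
  by exists (C1 (mksub Zu)); rewrite (fE _ (repr b)).
pose h b := projT1 (cid (fsurj b)).
have hK b : f (h b) = b by exact: (projT2 (cid (fsurj b))).
by exists h => // a; apply: finj; rewrite hK.
Qed.

End Isomorphic.

(* A first-quadrant double complex with exact rows and columns, except at the
   edges: the cohomology of the left edge (kernels of [h]) agrees with that of
   the bottom edge (kernels of [d]). *)
Section DoubleComplex.
Variables (A : nat -> nat -> zmodType).
Variables (d : forall p q, Hom (A p q) (A p q.+1)).
Variables (h : forall p q, Hom (A p q) (A p.+1 q)).
Hypothesis dd : forall p q x, app (d p q.+1) (app (d p q) x) = 0.
Hypothesis hh : forall p q x, app (h p.+1 q) (app (h p q) x) = 0.
Hypothesis hd : forall p q x, app (h p q.+1) (app (d p q) x) = app (d p.+1 q) (app (h p q) x).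
Hypothesis d_exact : forall p q x, app (d p q.+1) x = 0 ->
  exists y, app (d p q) y = x.
Hypothesis h_exact : forall p q x, app (h p.+1 q) x = 0 ->
  exists y, app (h p q) y = x.

Definition dc_cycle_mem p q (x : A p q) : Prop := app (d p q) x = 0 /\ app (h p q) x = 0.

Lemma dc_cycle0 p q : @dc_cycle_mem p q 0. Proof. by split; apply: raddf0. Qed.
Lemma dc_cycleB p q x y : @dc_cycle_mem p q x -> dc_cycle_mem y -> dc_cycle_mem (x - y).
Proof. by case=> ax bx [ay by_]; split; rewrite appB ?ax ?ay ?bx ?by_ subrr. Qed.
Definition dc_cycle p q := Subgroup (dc_cycle0 p q) (@dc_cycleB p q).

Definition left_bound_mem p q : A p q -> Prop :=
  if q is q'.+1 then fun x => exists2 y, app (h p q') y = 0 & x = app (d p q') y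
  else fun x => x = 0.
Definition bot_bound_mem p q : A p q -> Prop :=
  if p is p'.+1 then fun x => exists2 y, app (d p' q) y = 0 & x = app (h p' q) y
  else fun x => x = 0.

Lemma left_bound0 p q : @left_bound_mem p q 0.
Proof. by case: q => [|q] //; exists 0; rewrite raddf0. Qed.
Lemma left_boundB p q x y : @left_bound_mem p q x -> @left_bound_mem p q y ->
  @left_bound_mem p q (x - y).
Proof.
case: q x y => [|q] x y /=; first by move=> -> ->; rewrite subr0.
by move=> [u hu ->] [v hv ->]; exists (u - v); rewrite appB // hu hv subr0.
Qed.
Definition left_bound p q := Subgroup (left_bound0 p q) (@left_boundB p q).

Lemma bot_bound0 p q : @bot_bound_mem p q 0.
Proof. by case: p => [|p] //; exists 0; rewrite raddf0. Qed.
Lemma bot_boundB p q x y : @bot_bound_mem p q x -> @bot_bound_mem p q y ->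
  @bot_bound_mem p q (x - y).
Proof.
case: p x y => [|p] x y /=; first by move=> -> ->; rewrite subr0.
by move=> [u hu ->] [v hv ->]; exists (u - v); rewrite appB // hu hv subr0.
Qed.
Definition bot_bound p q := Subgroup (bot_bound0 p q) (@bot_boundB p q).

(** Away from the edges, exactness in the other direction shows that both kinds of boundaries are
    the d h z with z at position (p, q). *)
Lemma left_bot p q x : @dc_cycle_mem p.+1 q.+1 x ->
  left_bound p.+1 q.+1 x <-> bot_bound p.+1 q.+1 x.
Proof.
move=> _; split=> /= -[y hy ->].
  by have [z <-] := h_exact hy; exists (app (d p q) z); rewrite ?dd ?hd.
by have [z <-] := d_exact hy; exists (app (h p q) z); rewrite ?hh ?hd.
Qed.

(** A cycle x at (p, q+1) is d y for some y, and h y is the corresponding cycle at (p+1, q). The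
    choice of y is ambiguous by the kernel of d on one side and by the kernel of h on the other, and
    these produce exactly the boundaries. *)
Lemma staircase_step p q :
  isomorphic (subquo (dc_cycle p q.+1) (left_bound p q.+1))
             (subquo (dc_cycle p.+1 q) (bot_bound p.+1 q)).
Proof.
apply: (subquo_iso (R := fun x z => exists y, x = app (d p q) y /\ z = app (h p q) y)).
- by move=> ? ? ? ? [y [-> ->]] [y' [-> ->]]; exists (y - y'); rewrite !appB.
- move=> x [dx hx]; have [y yx] := d_exact dx.
  exists (app (h p q) y); last by exists y.
  by split; rewrite ?hh // -hd yx.
- move=> z [dz hz]; have [y yz] := h_exact hz.
  exists (app (d p q) y); last by exists y.
  by split; rewrite ?dd // hd yz.
- move=> x z _ _ [y [-> ->]]; split=> /= -[y' e1 e2].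
    by exists (y - y'); rewrite appB ?e1 ?e2 ?subrr ?subr0.
  by exists (y - y'); rewrite appB ?e1 ?e2 ?subrr ?subr0.
Qed.

Lemma left_bot_iso p q :
  isomorphic (subquo (dc_cycle p.+1 q.+1) (bot_bound p.+1 q.+1))
             (subquo (dc_cycle p.+1 q.+1) (left_bound p.+1 q.+1)).
Proof.
apply: (subquo_iso (R := eq)) => [? ? ? ? -> -> //|u ?|u ?|u v + _ <-].
- by exists u.
- by exists u.
- by move/left_bot => [? ?]; split.
Qed.

Lemma staircase s :
  isomorphic (subquo (dc_cycle 0 s) (left_bound 0 s))
             (subquo (dc_cycle s 0) (bot_bound s 0)).
Proof.
case: s => [|s].
  have -> : left_bound 0 0 = bot_bound 0 0 by apply: subgroup_ext.
  exact: isomorphic_refl.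
suff step p q : isomorphic (subquo (dc_cycle p q.+1) (left_bound p q.+1))
             (subquo (dc_cycle (p + q.+1)%N 0) (bot_bound (p + q.+1)%N 0)).
  exact: step.
elim: q p => [|q IH] p; first by rewrite addn1; apply: staircase_step.
apply: isomorphic_trans (staircase_step p q.+1) _.
by apply: isomorphic_trans (left_bot_iso p q) _; rewrite addnS -addSn; apply: IH.
Qed.

End DoubleComplex.

(** * Quadratic relations of Lambda and their generating polynomials *)

Section BinomialForms.
Variables (G : zmodType) (G2 : exp2 G).
Implicit Types (T : nat -> nat -> G) (p n j : nat).

(* [T i j] stands for the value of the word k_i k_j, with k_i = lambda_(i-1).
   The relations of Lambda are k_p k_(2p) = 0 and all their derivatives under
   the derivation k_i |-> k_(i+1). *)
Definition der_form T p n : G :=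
  \sum_(0 <= c < n.+1) T (p + c)%N (2 * p + n - c)%N *+ 'C(n, c).

(** The defining relation of Lambda for lambda_i lambda_(2i+1+j) with p = i + 1, brought to one
    side. *)
Definition adm_form T p j : G := T p (2 * p + j)%N +
  \sum_(0 <= t < j) T (p + j - t)%N (2 * p + t)%N *+ 'C(j - t - 1, t).

Definition shiftD T i j : G := T i.+1 j + T i j.+1.

Lemma der_form_shift T p n : der_form T p n.+1 = der_form (shiftD T) p n.
Proof.
rewrite /der_form /shiftD.
under [RHS]eq_bigr => c _ do rewrite mulrnDl.
rewrite big_split /= [LHS]big_nat_recl // [in RHS]addrC.
under [X in _ + X = _]eq_bigr => c _ do rewrite binS mulrnDr.
rewrite big_split /= addrA; congr (_ + _); last first.
  by rewrite !big_nat; apply: eq_bigr => c ?; congr (T _ _ *+ _); lia.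
rewrite [in RHS]big_nat_recl // [X in _ + X]big_nat_recr //= (@bin_small n n.+1) // mulr0n addr0.
congr (_ + _); first by rewrite !bin0; congr (T _ _ *+ _); lia.
by rewrite !big_nat; apply: eq_bigr => c ?; congr (T _ _ *+ _); lia.
Qed.

Lemma mulrn_par (v : G) m n : odd m = odd n -> v *+ m = v *+ n.
Proof. by move=> e; rewrite (exp2_odd G2) e -(exp2_odd G2). Qed.

(** The counterpart of [der_form_shift] for the admissible coefficients. Modulo 2, C(j-t, t+2) is
    the sum of C(j-t-1, t+2), C(j-t, t+1) and C(j-t-1, t); the last family belongs to the relation
    with p + 1. *)
Lemma adm_form_shift T p j :
  adm_form T p j.+3 = adm_form (shiftD T) p j.+2 + adm_form T p.+1 j.
Proof.
pose S t := T (p + j.+3 - t)%N (2 * p + t)%N.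
have -> : adm_form T p j.+3 = T p (2 * p + j.+3)%N +
    (S 0%N + (S 1%N *+ j.+1 + \sum_(0 <= t < j) S t.+2 *+ 'C(j - t, t.+2))).
  rewrite /adm_form; congr (_ + _); rewrite big_nat_recl // big_nat_recl //.
  rewrite [X in _ + (_ + X)]big_nat_recr //=.
  rewrite [in X in _ + (_ + (_ + X))]bin_small ?mulr0n ?addr0; last by lia.
  rewrite bin0 mulr1n bin1; congr (_ + (_ *+ _ + _)).
  by rewrite !big_nat; apply: eq_bigr => t ?; congr (_ *+ 'C(_, _)); lia.
have -> : adm_form (shiftD T) p j.+2 = shiftD T p (2 * p + j.+2)%N +
   ((S 0%N + (S 1%N *+ j + \sum_(0 <= t < j) S t.+2 *+ 'C(j - t - 1, t.+2))) +
   (S 1%N + \sum_(0 <= t < j) S t.+2 *+ 'C(j - t, t.+1))).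
  rewrite /adm_form /shiftD; congr (_ + _).
  under eq_bigr => t _ do rewrite mulrnDl.
  rewrite big_split /=; congr (_ + _).
    rewrite big_nat_recl // big_nat_recl // bin0 mulr1n bin1.
    congr (_ + (_ *+ _ + _)); rewrite /S; try by congr (T _ _); lia.
    - by lia.
    - by rewrite !big_nat; apply: eq_bigr => t ?; congr (T _ _ *+ 'C(_, _)); lia.
  rewrite big_nat_recl // [X in _ + X]big_nat_recr //=.
  rewrite [in X in _ + (_ + X)]bin_small ?mulr0n ?addr0; last by lia.
  rewrite bin0 mulr1n; congr (_ + _); first by rewrite /S; congr (T _ _); lia.
  rewrite !big_nat; apply: eq_bigr => t ?; rewrite /S.
  by congr (T _ _ *+ 'C(_, _)); lia.
have -> : adm_form T p.+1 j = T p.+1 (2 * p + j.+2)%N +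
    \sum_(0 <= t < j) S t.+2 *+ 'C(j - t - 1, t).
  rewrite /adm_form /S; congr (_ + _); first by congr (T _ _); lia.
  rewrite !big_nat; apply: eq_bigr => t ?.
  by congr (T _ _ *+ 'C(_, _)); lia.
have -> : \sum_(0 <= t < j) S t.+2 *+ 'C(j - t, t.+2) =
   \sum_(0 <= t < j) S t.+2 *+ 'C(j - t - 1, t.+2) +
   \sum_(0 <= t < j) S t.+2 *+ 'C(j - t, t.+1) +
   \sum_(0 <= t < j) S t.+2 *+ 'C(j - t - 1, t).
  rewrite -!big_split /= !big_nat; apply: eq_bigr => t tj.
  rewrite -!mulrnDr; apply: mulrn_par.
  have -> : (j - t = (j - t - 1).+1)%N by lia.
  rewrite !subn1 /= !binS !oddD.
  by do 3 case: (odd _).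
rewrite /shiftD addnS mulrS.
set A := \sum_(_ <= _ < _) _; set B := \sum_(_ <= _ < _) _.
set C := \sum_(_ <= _ < _) _; set X := T p.+1 _; set Y := T p _.
have e : X + X = 0 by [].
rewrite -!addrA 6?(addrCA _ X) [X + (X + _)]addrA e add0r.
by rewrite !(addrCA _ (S 1%N)).
Qed.

(** Both forms obey the same recursion under [shiftD], up to [adm_form T p.+1 _], which vanishes by
    induction. For p = 0 this turns the binomial form of the differential into its admissible
    form. *)
Lemma adm_der_form j T p : (forall p' n, (p < p')%N -> der_form T p' n = 0) ->
  adm_form T p j = der_form T p j.
Proof.
elim/ltn_ind: j T p => -[|[|[|j]]] IH T p H.
- by rewrite /adm_form /der_form big_geq // big_nat1 addr0 addn0 addn0 subn0.
- rewrite /adm_form /der_form /index_iota /= !big_cons !big_nil.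
  by rewrite !addr0 !addn0 !subn0 addnK.
- rewrite /adm_form /der_form /index_iota /= !big_cons !big_nil /= !addr0 !addn0.
  by rewrite !subn0 bin1 mulr2n G2 !mulr1n !add0r addnK.
rewrite adm_form_shift (IH j.+2) // => [|p' n pp']; last first.
  by rewrite -der_form_shift H.
have -> : adm_form T p.+1 j = 0.
  by rewrite IH ?H //; [lia|move=> p' n pp'; apply: H; lia].
by rewrite addr0 -der_form_shift.
Qed.

(** All words of a relation have the same index sum 3p + n, so [T] can be cut off outside one degree
    and only relations of that degree are needed. *)
Definition trunc_deg T N i j := if (i + j == N)%N then T i j else 0.

Lemma adm_form_trunc T N p j : adm_form (trunc_deg T N) p j =
  if (3 * p + j == N)%N then adm_form T p j else 0.
Proof.
rewrite /adm_form /trunc_deg; case: ((3 * p + j)%N =P N) => [e|ne].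
  congr (_ + _); first by case: eqP => //; lia.
  by rewrite !big_nat; apply: eq_bigr => t ?; case: eqP => //; lia.
case: eqP => [|_]; first by lia.
rewrite add0r big_nat big1 // => t ?.
by case: eqP => [|_]; [lia|rewrite mul0rn].
Qed.

Lemma der_form_trunc T N p n : der_form (trunc_deg T N) p n =
  if (3 * p + n == N)%N then der_form T p n else 0.
Proof.
rewrite /der_form /trunc_deg; case: ((3 * p + n)%N =P N) => [e|ne].
  by rewrite !big_nat; apply: eq_bigr => t ?; case: eqP => //; lia.
rewrite big_nat big1 // => t ?.
by case: eqP => [|_]; [lia|rewrite mul0rn].
Qed.

Lemma adm_der_form_deg T p j : (forall p' n, (p < p')%N ->
    (3 * p' + n = 3 * p + j)%N -> der_form T p' n = 0) ->
  adm_form T p j = der_form T p j.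
Proof.
move=> H; have := adm_form_trunc T (3 * p + j) p j; rewrite eqxx => <-.
rewrite adm_der_form ?der_form_trunc ?eqxx // => p' n pp'.
by rewrite der_form_trunc; case: eqP => // /H ->.
Qed.

(** In bounded degree 3p + n only finitely many p occur, so descending induction on p applies. *)
Lemma der_form_eq0 T (p0 : nat) : (forall p j, (p0 <= p)%N -> adm_form T p j = 0) ->
  forall p n, (p0 <= p)%N -> der_form T p n = 0.
Proof.
move=> H p n; move: {2}(3 * p + n)%N (leqnn (3 * p + n)%N) => N.
have [m] := ubnP (N - p)%N; elim: m p n => // m IH p n Nm pN pp.
rewrite -adm_der_form_deg ?H // => p' n' lt e.
by apply: IH; lia.
Qed.

(* The functional on polynomials in x, y, z with x^i y^j z^l |-> T i j l; it turns
   [der_form] into the polynomials (x y^2)^p (x + y)^n. *)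
Section Functional.
Variable T : nat -> nat -> nat -> G.

Definition polyF (R : nzRingType) (f : nat -> R -> G) (P : {poly R}) : G :=
  \sum_(i < size P) f i P`_i.

Lemma polyFE (R : nzRingType) (f : nat -> R -> G) (P : {poly R}) n :
  (forall i, zmod_morphism (f i)) -> (size P <= n)%N ->
  polyF f P = \sum_(i < n) f i P`_i.
Proof.
move=> fB Pn; have f0 i : f i 0 = 0 by apply: zmorph0.
rewrite /polyF (big_ord_widen n (fun i => f i P`_i)) // big_mkcond /=.
apply: eq_bigr => i _; case: ifP => // /negbT; rewrite -leqNgt => h.
by rewrite nth_default.
Qed.

Lemma polyFB (R : nzRingType) (f : nat -> R -> G) :
  (forall i, zmod_morphism (f i)) -> zmod_morphism (polyF f).
Proof.
move=> fB P Q; pose n := maxn (size (P - Q)) (maxn (size P) (size Q)).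
rewrite !(@polyFE _ _ _ n) //; try by rewrite /n; lia.
by rewrite -sumrB; apply: eq_bigr => i _; rewrite coefB; apply: fB.
Qed.

Lemma polyF_mono (R : nzRingType) (f : nat -> R -> G) c i :
  (forall i, zmod_morphism (f i)) -> polyF f (c%:P * 'X^i) = f i c.
Proof.
move=> fB; have f0 j : f j 0 = 0 by apply: zmorph0.
rewrite (@polyFE _ _ _ i.+1) //; last first.
  by apply: leq_trans (size_polyMleq _ _) _; rewrite size_polyXn size_polyC; case: eqP.
rewrite big_ord_recr /= big1 ?add0r => [|j _].
  by rewrite coefCM coefXn eqxx mulr1.
by rewrite coefCM coefXn ltn_eqF // mulr0 f0.
Qed.

Definition R3 : comNzRingType := {poly {poly {poly 'F_2}}}.

Definition ell (P : R3) : G :=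
  polyF (fun l => polyF (fun j => polyF (fun i c => scF c (T i j l)))) P.

Lemma ellB : zmod_morphism ell.
Proof.
apply: polyFB => l; apply: polyFB => j; apply: polyFB => i c d.
by rewrite (exp2B exp2_F2) (exp2B G2) (scFDl G2).
Qed.

Lemma ell_sum (I : Type) (r : seq I) (Q : pred I) (F : I -> R3) :
  ell (\sum_(i <- r | Q i) F i) = \sum_(i <- r | Q i) ell (F i).
Proof. by rewrite -[LHS]/(app (mkHom ellB) _) raddf_sum. Qed.

Lemma ellMn P n : ell (P *+ n) = ell P *+ n.
Proof. by rewrite -[LHS]/(app (mkHom ellB) _) raddfMn. Qed.

Local Notation x := ((('X : {poly 'F_2})%:P)%:P : R3).
Local Notation y := (('X : {poly {poly 'F_2}})%:P : R3).
Local Notation z := ('X : R3).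

Lemma ellM i j l : ell (x ^+ i * y ^+ j * z ^+ l) = T i j l.
Proof.
have -> : x ^+ i * y ^+ j * z ^+ l =
   ((((1%:P * 'X^i)%:P * 'X^j)%:P * 'X^l) : R3).
  by rewrite polyC1 mul1r polyCM !polyC_exp.
rewrite /ell polyF_mono => [|k]; last first.
  apply: polyFB => m; apply: polyFB => i' c d.
  by rewrite (exp2B exp2_F2) (exp2B G2) (scFDl G2).
rewrite polyF_mono => [|k]; last first.
  by apply: polyFB => i' c d; rewrite (exp2B exp2_F2) (exp2B G2) (scFDl G2).
rewrite polyF_mono ?scF1 // => k c d.
by rewrite (exp2B exp2_F2) (exp2B G2) (scFDl G2).
Qed.

Lemma ell_xy p n l : ell ((x * y ^+ 2) ^+ p * (x + y) ^+ n * z ^+ l) =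
  der_form (fun i j => T i j l) p n.
Proof.
rewrite /der_form (addrC x) exprDn mulr_sumr mulr_suml ell_sum big_mkord.
apply: eq_bigr => c _; rewrite mulrnAr mulrnAl ellMn; congr (_ *+ _).
rewrite -ellM; congr ell; rewrite exprMn -exprM.
have -> : (2 * p + n - c = 2 * p + (n - c))%N by have := ltn_ord c; lia.
by rewrite !exprD; ring.
Qed.

Lemma ell_yz p n i : ell (x ^+ i * ((y * z ^+ 2) ^+ p * (y + z) ^+ n)) =
  der_form (T i) p n.
Proof.
rewrite /der_form (addrC y) exprDn !mulr_sumr ell_sum big_mkord.
apply: eq_bigr => c _; rewrite !mulrnAr ellMn; congr (_ *+ _).
rewrite -ellM; congr ell; rewrite exprMn -exprM.
have -> : (2 * p + n - c = 2 * p + (n - c))%N by have := ltn_ord c; lia.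
by rewrite !exprD; ring.
Qed.

Lemma R3_2 (P : R3) : P + P = 0.
Proof.
apply/polyP => l; apply/polyP => j; apply/polyP => i.
by rewrite !coefD !coef0 exp2_F2.
Qed.

(* The polynomial (x+y+z)^b (x y^2 + x z^2 + y z^2)^a (x y^2 z^4)^p is a
   combination of relations in the variables y, z as well as of relations in the
   variables x, y. *)
Lemma overlap p a b : (0 < p)%N ->
  (forall i p' n, (0 < p')%N -> der_form (T i) p' n = 0) ->
  (forall l p' n, (l < 4 * p + 2 * a + b)%N -> (0 < p')%N ->
     der_form (fun i j => T i j l) p' n = 0) ->
  der_form (fun i j => T i j (4 * p + 2 * a + b)%N) p a = 0.
Proof.
move=> p0 Hyz Hxy; pose P := x * y ^+ 2; pose u := (x + y) * z ^+ 2.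
pose q := y * z ^+ 2; pose v := x * (y + z) ^+ 2.
pose E := ((x + y) + z) ^+ b * ((P + u) ^+ a) * (P * z ^+ 4) ^+ p.
have E1 : E = (x + (y + z)) ^+ b * ((v + q) ^+ a) * (x * q ^+ 2) ^+ p.
  rewrite /E addrA; congr (_ * _ ^+ _ * _ ^+ _); rewrite /P /u /q /v; last by ring.
  rewrite -[LHS]addr0 -(R3_2 (x * y * z)); ring.
(* Expanded in q and y + z, every term contains a positive power of q and is a relation in y, z. *)
have E0 : ell E = 0.
  rewrite E1 exprDn [X in _ * X * _]exprDn !mulr_suml ell_sum big1 // => s _.
  rewrite mulr_sumr mulr_suml ell_sum big1 // => w _.
  rewrite !(mulrnAl, mulrnAr) !ellMn.
  have -> : ell (x ^+ (b - s) * (y + z) ^+ s * (v ^+ (a - w) * q ^+ w) *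
     (x * q ^+ 2) ^+ p) = 0; last by rewrite !mul0rn.
  rewrite -(Hyz (b - s + (a - w) + p)%N (2 * p + w)%N (s + 2 * (a - w))%N);
    last by lia.
  rewrite -ell_yz; congr ell; rewrite /v -/q !exprD !exprMn; ring.
(* Expanded in P and x + y, the terms whose exponent of z is below 4p + 2a + b vanish by [Hxy]; the
   only other one, s = b and w = a, is the claim. *)
have := E0; rewrite /E exprDn [X in _ * X * _]exprDn !mulr_suml ell_sum.
rewrite big_ord_recr big1 /= ?add0r => [|s _]; last first.
  rewrite mulr_sumr mulr_suml ell_sum big1 // => w _.
  rewrite !(mulrnAl, mulrnAr) !ellMn.
  have -> : ell ((x + y) ^+ (b - s) * z ^+ s * (P ^+ (a - w) * u ^+ w) *
     (P * z ^+ 4) ^+ p) = 0; last by rewrite !mul0rn.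
  have sb := ltn_ord s; have wa := ltn_ord w.
  rewrite -(Hxy (s + 2 * w + 4 * p)%N (a - w + p)%N (b - s + w)%N); try by lia.
  by rewrite -ell_xy; congr ell; rewrite /u -/P !exprD !exprMn; ring.
rewrite subnn expr0 mul1r binn mulr1n mulr_sumr mulr_suml ell_sum.
rewrite big_ord_recr big1 /= ?add0r => [|w _]; last first.
  rewrite !(mulrnAl, mulrnAr) !ellMn.
  have -> : ell (z ^+ b * (P ^+ (a - w) * u ^+ w) * (P * z ^+ 4) ^+ p) = 0;
    last by rewrite !mul0rn.
  have wa := ltn_ord w.
  rewrite -(Hxy (b + 2 * w + 4 * p)%N (a - w + p)%N w); try by lia.
  by rewrite -ell_xy; congr ell; rewrite /u -/P !exprD !exprMn; ring.
rewrite subnn expr0 mul1r binn mulr1n => <-; rewrite -ell_xy; congr ell.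
by rewrite /u -/P !exprD !exprMn; ring.
Qed.

(* The relations form a subspace stable under the differential
   x^n |-> (x+y)^n - x^n - y^n: with P = x y^2, q = y z^2, u = (x+y) z^2 and
   v = x (y+z)^2 one has P + u = q + v. *)
Lemma derivation_relation p n : (0 < p)%N ->
  (forall i p' m, (0 < p')%N -> der_form (T i) p' m = 0) ->
  (forall l p' m, (0 < p')%N -> der_form (fun i j => T i j l) p' m = 0) ->
  \sum_(0 <= c < n.+1) (ell ((x + y) ^+ (p + c) * z ^+ (2 * p + n - c)) +
     ell (x ^+ (p + c) * (y + z) ^+ (2 * p + n - c))) *+ 'C(n, c) = 0.
Proof.
move=> p0 Hyz Hxy; pose P := x * y ^+ 2; pose u := (x + y) * z ^+ 2.
pose q := y * z ^+ 2; pose v := x * (y + z) ^+ 2; pose e := x + y + z.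
have -> : \sum_(0 <= c < n.+1) (ell ((x + y) ^+ (p + c) * z ^+ (2 * p + n - c)) +
     ell (x ^+ (p + c) * (y + z) ^+ (2 * p + n - c))) *+ 'C(n, c) =
   ell (e ^+ n * u ^+ p) + ell (e ^+ n * v ^+ p).
  under eq_bigr => c _ do rewrite mulrnDl.
  rewrite big_split /= /e; congr (_ + _).
    rewrite (addrC _ z) exprDn mulr_suml ell_sum big_mkord; apply: eq_bigr => c _.
    rewrite mulrnAl ellMn; congr (ell _ *+ _).
    have -> : (2 * p + n - c = 2 * p + (n - c))%N by have := ltn_ord c; lia.
    by rewrite /u !exprD !exprMn; ring.
  rewrite -addrA (addrC x) exprDn mulr_suml ell_sum big_mkord; apply: eq_bigr => c _.
  rewrite mulrnAl ellMn; congr (ell _ *+ _).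
  have -> : (2 * p + n - c = 2 * p + (n - c))%N by have := ltn_ord c; lia.
  by rewrite /v !exprD !exprMn; ring.
(* Every further term of (P + u)^p has a factor P, hence is a relation in x, y. *)
have e1 : ell (e ^+ n * u ^+ p) = ell (e ^+ n * (P + u) ^+ p).
  rewrite (addrC P) [(u + P) ^+ p]exprDn mulr_sumr ell_sum big_ord_recl big1 ?addr0.
    by rewrite subn0 expr0 mulr1 bin0 mulr1n.
  move=> w _; rewrite mulrnAr ellMn /e exprDn mulr_suml ell_sum big1 ?mul0rn // => s _.
  rewrite mulrnAl ellMn.
  have -> : ell ((x + y) ^+ (n - s) * z ^+ s *
      (u ^+ (p - lift ord0 w) * P ^+ lift ord0 w)) = 0; last by rewrite mul0rn.
  rewrite -(Hxy (s + 2 * (p - lift ord0 w))%N (lift ord0 w) (n - s + (p - lift ord0 w))%N) //.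
  by rewrite -ell_xy; congr ell; rewrite /u -/P !exprD !exprMn; ring.
have e2 : ell (e ^+ n * v ^+ p) = ell (e ^+ n * (q + v) ^+ p).
  rewrite (addrC q) [(v + q) ^+ p]exprDn mulr_sumr ell_sum big_ord_recl big1 ?addr0.
    by rewrite subn0 expr0 mulr1 bin0 mulr1n.
  move=> w _; rewrite mulrnAr ellMn /e -addrA exprDn mulr_suml ell_sum big1 ?mul0rn // => s _.
  rewrite mulrnAl ellMn.
  have -> : ell (x ^+ (n - s) * (y + z) ^+ s *
      (v ^+ (p - lift ord0 w) * q ^+ lift ord0 w)) = 0; last by rewrite mul0rn.
  rewrite -(Hyz (n - s + (p - lift ord0 w))%N (lift ord0 w) (s + 2 * (p - lift ord0 w))%N) //.
  by rewrite -ell_yz; congr ell; rewrite /v -/q !exprD !exprMn; ring.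
have Puqv : P + u = q + v.
  rewrite /P /u /q /v -[LHS]addr0 -(R3_2 (x * y * z)); ring.
by rewrite e1 e2 Puqv.
Qed.

End Functional.

End BinomialForms.

(** * The admissible basis of Lambda *)

Local Notation deg := internal_degree.

Section DualOperators.
Implicit Types (w u : seq nat) (eta : seq nat -> 'F_2).

Lemma deg_nil : deg [::] = 0%N. Proof. by rewrite /deg big_nil. Qed.
Lemma deg_cons i w : deg (i :: w) = (i.+1 + deg w)%N.
Proof. by rewrite /deg big_cons. Qed.

Lemma adm_cons i l w : admissible (i :: l :: w) = (l <= 2 * i)%N && admissible (l :: w).
Proof. by []. Qed.

Lemma adm_behead i w : admissible (i :: w) -> admissible w.
Proof. by case: w => // l w /andP[]. Qed.

(* The transpose of left multiplication by lambda_i, on the functions on the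
   admissible monomials; [n] is a bound on the recursion. *)
Fixpoint lmulT_rec n i eta w : 'F_2 :=
  if w is l :: w' then
    if (l <= 2 * i)%N then eta (i :: w) else
    if n is n'.+1 then
      \sum_(0 <= t < (l - (2 * i + 1))%N)
        lmulT_rec n' (2 * i + 1 + t)%N
          (lmulT_rec n' (i + (l - (2 * i + 1)) - t)%N eta) w'
          *+ 'C(l - (2 * i + 1) - t - 1, t)
    else 0
  else eta [:: i].

Definition lmulT i eta w := lmulT_rec (deg w) i eta w.

(** Independence of the bound, together with locality: only the values on words of the degree of
    lambda_i w matter, and only on admissible ones if w is admissible. *)
Lemma lmulT_rec_stable n n' i eta eta' w : (deg w <= n)%N -> (deg w <= n')%N ->
  (forall u, deg u = (i.+1 + deg w)%N -> (admissible w -> admissible u) ->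
     eta u = eta' u) ->
  lmulT_rec n i eta w = lmulT_rec n' i eta' w.
Proof.
elim: n n' i eta eta' w => [|n IH] [|n'] i eta eta' [|l w];
  rewrite ?deg_cons ?deg_nil //= => wn wn' h;
  try by apply: h; rewrite ?deg_cons ?deg_nil.
case: ifP => li.
  apply: h; first by rewrite !deg_cons.
  by move=> aw; apply/andP.
rewrite !big_nat; apply: eq_bigr => t tl; congr (_ *+ _).
apply: (IH); [lia|lia|move=> u du au].
apply: IH; [lia|lia|move=> v dv av].
apply: h; first by rewrite dv du; lia.
by move=> lw; apply/av/au/(adm_behead lw).
Qed.

Lemma lmulT_local i eta eta' w :
  (forall u, deg u = (i.+1 + deg w)%N -> (admissible w -> admissible u) ->
     eta u = eta' u) -> lmulT i eta w = lmulT i eta' w.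
Proof. exact: lmulT_rec_stable. Qed.

Lemma lmulT_nil i eta : lmulT i eta [::] = eta [:: i].
Proof. by rewrite /lmulT deg_nil. Qed.

Lemma lmulT_adm i eta l w : (l <= 2 * i)%N -> lmulT i eta (l :: w) = eta [:: i, l & w].
Proof. by move=> li; rewrite /lmulT deg_cons /= li. Qed.

Lemma lmulT_inadm i eta j w : lmulT i eta ((2 * i + 1 + j)%N :: w) =
  \sum_(0 <= t < j) lmulT (2 * i + 1 + t)%N (lmulT (i + j - t)%N eta) w *+ 'C(j - t - 1, t).
Proof.
rewrite /lmulT deg_cons addSn [LHS]/= ifF; last by lia.
rewrite addKn !big_nat; apply: eq_bigr => t tj; congr (_ *+ _).
apply: lmulT_rec_stable; [lia|lia|move=> u du au].
by apply: lmulT_rec_stable => //; lia.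
Qed.

Lemma lmulTB i eta eta' w :
  lmulT i (fun u => eta u - eta' u) w = lmulT i eta w - lmulT i eta' w.
Proof.
have H n : forall i eta eta' w, (deg w <= n)%N ->
    lmulT i (fun u => eta u - eta' u) w = lmulT i eta w - lmulT i eta' w.
  elim: n => [|n IH] {}i {}eta {}eta' [|l {}w]; rewrite ?deg_cons ?lmulT_nil // => wn.
  have [li|] := leqP l (2 * i)%N; first by rewrite !lmulT_adm.
  move=> il; have -> : l = (2 * i + 1 + (l - (2 * i + 1)))%N by lia.
  rewrite !lmulT_inadm -sumrB !big_nat; apply: eq_bigr => t tl; rewrite -mulrnBl.
  congr (_ *+ _); rewrite -IH; last by lia.
  by apply: lmulT_local => u du au; apply: IH; lia.
exact: (H (deg w)).
Qed.

Lemma lmulT0 i eta w : (forall u, deg u = (i.+1 + deg w)%N ->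
  (admissible w -> admissible u) -> eta u = 0) -> lmulT i eta w = 0.
Proof.
move=> h; rewrite (lmulT_local (eta' := fun u => eta u - eta u)).
  by rewrite lmulTB subrr.
by move=> u du au; rewrite subrr h.
Qed.

Lemma lmulTD i eta eta' w :
  lmulT i (fun u => eta u + eta' u) w = lmulT i eta w + lmulT i eta' w.
Proof.
rewrite -(exp2B exp2_F2) -lmulTB; apply: lmulT_local => u _ _.
by rewrite (exp2B exp2_F2).
Qed.

Lemma lmulT_sum i (I : Type) (r : seq I) (F : I -> seq nat -> 'F_2) w :
  lmulT i (fun u => \sum_(c <- r) F c u) w = \sum_(c <- r) lmulT i (F c) w.
Proof.
elim: r => [|c r IH].
  by rewrite big_nil; apply: lmulT0 => u _ _; rewrite big_nil.
rewrite big_cons -IH -lmulTD; apply: lmulT_local => u _ _.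
by rewrite big_cons.
Qed.

Lemma lmulTMn i n eta w : lmulT i (fun u => eta u *+ n) w = lmulT i eta w *+ n.
Proof.
elim: n => [|n IH]; first by rewrite mulr0n; apply: lmulT0.
rewrite mulrS -IH -lmulTD; apply: lmulT_local => u _ _.
by rewrite mulrS.
Qed.

(** Consistency of the rewriting into admissible words, by induction on the degree of w. If w is
    empty or its first letter l is small, the relation holds by definition of [lmulT]. Otherwise
    [overlap] trades it for relations acting on the tail of w and relations acting on words of
    smaller degree. *)
Lemma lmulT_relation w : admissible w -> forall eta p n, (0 < p)%N ->
  der_form (fun i j => lmulT j.-1 (lmulT i.-1 eta) w) p n = 0.
Proof.
have [m] := ubnP (deg w); elim: m w => // m IH [|l w] wm aw eta.
  apply: (der_form_eq0 exp2_F2 (p0 := 1)) => p j p0.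
  rewrite /adm_form lmulT_nil.
  have -> : ((2 * p + j).-1 = 2 * p.-1 + 1 + j)%N by lia.
  rewrite lmulT_inadm; apply/(exp2_eq exp2_F2); rewrite !big_nat.
  by apply: eq_bigr => t tj; congr (lmulT _ (lmulT _ _) _ *+ _); lia.
move=> p n; move: {2}(3 * p + n)%N (leqnn (3 * p + n)%N) => N.
(* Descending induction on p within one degree, since [adm_der_form_deg] uses the relations with
   larger p. *)
have [k] := ubnP (N - p)%N; elim: k p n => // k IHk p n Nm pN p0.
rewrite deg_cons in wm.
have [ad|inad] := leqP l (2 * (2 * p + n).-1)%N.
  rewrite -(adm_der_form_deg exp2_F2) => [|p' n' pp' e]; last by apply: IHk; lia.
  rewrite /adm_form lmulT_adm //.
  have -> : ((2 * p + n).-1 = 2 * p.-1 + 1 + n)%N by lia.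
  rewrite lmulT_inadm; apply/(exp2_eq exp2_F2); rewrite !big_nat.
  by apply: eq_bigr => t tj; congr (lmulT _ (lmulT _ _) _ *+ _); lia.
pose T i j l := lmulT l.-1 (lmulT j.-1 (lmulT i.-1 eta)) w.
have e : (4 * p + 2 * n + (l.+1 - (4 * p + 2 * n)) = l.+1)%N by lia.
have aw' := adm_behead aw.
have := @overlap _ exp2_F2 T p n (l.+1 - (4 * p + 2 * n))%N p0; rewrite e.
have -> : der_form (fun i j => T i j l.+1) p n =
   der_form (fun i j => lmulT j.-1 (lmulT i.-1 eta) (l :: w)) p n.
  apply: eq_bigr => c _; congr (_ *+ _); rewrite /T /=.
  case: (w) aw => [|l' w''] aw; rewrite ?lmulT_nil // lmulT_adm //; by case/andP: aw.
apply.
  by move=> i p' n' p'0; apply: IH => //; lia.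
move=> l' p' n' l'l p'0; rewrite /der_form /T.
transitivity (lmulT l'.-1 (fun u => der_form (fun i j => lmulT j.-1 (lmulT i.-1 eta) u) p' n') w).
  rewrite /der_form lmulT_sum; apply: eq_bigr => c _.
  by rewrite lmulTMn.
apply: lmulT0 => u du au; apply: IH => //; last exact: au.
by rewrite du; lia.
Qed.

End DualOperators.

Lemma Lambda2 : exp2 Lambda.
Proof.
move=> u; rewrite -[u]cl_repr -[_ + _](raddfD (cl (ideal lambda_rel))).
have -> : repr u + repr u = 0 :> free_alg; last exact: raddf0.
by apply/malgP => k; rewrite mcoeffD mcoeff0 exp2_F2.
Qed.

Lemma lam_mon_nil : lam_mon [::] = 1. Proof. by rewrite /lam_mon big_nil. Qed.
Lemma lam_mon_cons i I : lam_mon (i :: I) = lam i * lam_mon I.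
Proof. by rewrite /lam_mon big_cons. Qed.
Lemma lam_mon_cat I J : lam_mon (I ++ J) = lam_mon I * lam_mon J.
Proof. by rewrite /lam_mon big_cat. Qed.

Definition fmon (I : seq nat) : free_alg := \prod_(i <- I) fvar i.

Lemma lam_monE I : lam_mon I = rcl lambda_rel (fmon I).
Proof. by rewrite /lam_mon /fmon rmorph_prod. Qed.

Lemma fmonE (k : {fmonom nat}) : << 1 *g k >> = fmon k :> free_alg.
Proof.
case: k => s; rewrite /fmon /=; elim: s => [|i s IH].
  by rewrite big_nil; congr (<< 1 *g _ >>); apply/eqP; rewrite fmP fm1.
rewrite big_cons -IH -[RHS]/(fgmul _ _) fgmulUU mulr1; congr (<< 1 *g _ >>).
by apply/eqP; rewrite fmP fmM fmU.
Qed.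

Lemma free_ind (P : subgroup free_alg) : (forall I, P (fmon I)) -> forall x, P x.
Proof.
move=> Pm x; rewrite [x]monalgE; elim/big_rec: _ => [|k u _ Pu].
  exact: sg_mem0.
apply: sg_memD => //; case: (F2P x@_k) => ->; last by rewrite fmonE.
by rewrite monalgU0; apply: sg_mem0.
Qed.

Lemma rclLK (x : Lambda) : rcl lambda_rel (repr x) = x.
Proof. exact: (cl_repr (x : quo (ideal lambda_rel))). Qed.

Lemma lam_ind (P : subgroup Lambda) : (forall I, P (lam_mon I)) -> forall x, P x.
Proof.
move=> Pm x; rewrite -[x]rclLK; move: (repr x) => g.
have P0 : P (rcl lambda_rel 0) by rewrite raddf0; apply: sg_mem0.
have PB u v : P (rcl lambda_rel u) -> P (rcl lambda_rel v) -> P (rcl lambda_rel (u - v)).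
  by rewrite raddfB; apply: sg_memB.
apply: (@free_ind (@Subgroup free_alg (fun g => P (rcl lambda_rel g)) P0 PB)) => I /=.
by rewrite -lam_monE.
Qed.

(** The stable subset [A] allows for operators that satisfy the relations only on some elements; for
    [lmulF] these are the functionals in [adm_fnl]. *)
Lemma fact_ideal (V : zmodType) (op : nat -> V -> V) (V2 : exp2 V)
   (opB : forall i, zmod_morphism (op i)) (S : free_alg -> Prop) (A : V -> Prop) :
  (forall i v, A v -> A (op i v)) -> A 0 ->
  (forall u v, A u -> A v -> A (u - v)) ->
  (forall r v, S r -> A v -> fact op r v = 0) ->
  forall x v, ideal S x -> A v -> fact op x v = 0.
Proof.
move=> Aop A0 AB AS.
have Aw w v : A v -> A (wact op w v) by elim: w => //= i w IH Av; apply: Aop; apply: IH.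
have Afact y v : A v -> A (fact op y v).
  move=> Av; rewrite /fact; elim/big_rec: _ => // k u _ Au.
  rewrite -(exp2B V2); apply: AB => //; case: (F2P y@_k) => ->.
    by rewrite scF0.
  by rewrite scF1; apply: Aw.
move=> x v Ix; elim: Ix v => {x} [r Sr v Av|v _|x y _ IHx _ IHy v Av|a x b _ IH v Av].
- exact: AS.
- exact: fact0l.
- by rewrite factBl // IHx // IHy // subr0.
- rewrite !factM // IH; last exact: Afact.
  exact: zmorph0 (factBr opB a).
Qed.

Lemma fact_rel (V : zmodType) (op : nat -> V -> V) (V2 : exp2 V)
   (opB : forall i, zmod_morphism (op i)) v :
  (forall i j, op i (op (2 * i + 1 + j)%N v) =
     \sum_(0 <= t < j) op (i + j - t)%N (op (2 * i + 1 + t)%N v) *+ 'C(j - t - 1, t)) ->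
  forall r, lambda_rel r -> fact op r v = 0.
Proof.
move=> H _ [i j]; rewrite factBl // factM // !fact_var // H fact_suml //.
apply/eqP; rewrite subr_eq0; apply/eqP; apply: eq_bigr => t _.
by rewrite factMnl // factM // !fact_var.
Qed.

(** Composing the operators [lmulT] reverses the order of the letters; transposing once more
    restores a left action. An admissible word is represented by evaluation at it. *)
Definition fnl : zmodType := prodz (fun _ : seq nat -> 'F_2 => 'F_2).

Lemma fnl2 : exp2 fnl.
Proof. by move=> u; apply: functional_extensionality_dep => eta; apply: exp2_F2. Qed.

Definition lmulF (i : nat) (u : fnl) : fnl := fun eta => u (lmulT i eta).

Lemma lmulFB i : zmod_morphism (lmulF i). Proof. by []. Qed.

(** Additive functionals that see only admissible words, the words for which [lmulT_relation] is
    available. *)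
Definition adm_fnl (u : fnl) : Prop :=
  (forall eta eta', u (fun w => eta w - eta' w) = u eta - u eta') /\
  (forall eta, (forall w, admissible w -> eta w = 0) -> u eta = 0).

Lemma adm_fnl_op i u : adm_fnl u -> adm_fnl (lmulF i u).
Proof.
move=> [uB u0]; split=> [eta eta'|eta h].
  rewrite /lmulF -uB; congr u; apply: functional_extensionality_dep => w.
  exact: lmulTB.
by apply: u0 => w aw; apply: lmulT0 => v _ av; apply/h/av.
Qed.

Lemma adm_fnl_eq u eta eta' : adm_fnl u ->
  (forall w, admissible w -> eta w = eta' w) -> u eta = u eta'.
Proof.
move=> [uB u0] h; apply/eqP; rewrite -subr_eq0 -uB; apply/eqP/u0 => w /h ->.
exact: subrr.
Qed.

Lemma adm_fnl_sum u (I : Type) (r : seq I) (F : I -> seq nat -> 'F_2) n : adm_fnl u ->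
  u (fun w => \sum_(c <- r) F c w *+ n c) = \sum_(c <- r) u (F c) *+ n c.
Proof.
move=> au; have [uB u0] := au; have uD eta eta' : u (fun w => eta w + eta' w) = u eta + u eta'.
  rewrite -(exp2B exp2_F2) -uB; apply: adm_fnl_eq => // w _.
  by rewrite (exp2B exp2_F2).
have uM eta k : u (fun w => eta w *+ k) = u eta *+ k.
  elim: k => [|k IH]; first by rewrite mulr0n u0.
  by rewrite mulrS -IH -uD; apply: adm_fnl_eq => // w _; rewrite mulrS.
elim: r => [|c r IH]; first by rewrite big_nil u0 // => w _; rewrite big_nil.
rewrite big_cons -IH -uM -uD; apply: adm_fnl_eq => // w _.
by rewrite big_cons.
Qed.

Lemma lmulF_rel u : adm_fnl u -> forall r, lambda_rel r -> fact lmulF r u = 0.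
Proof.
move=> au; apply: (fact_rel fnl2 lmulFB) => i j.
apply: functional_extensionality_dep => eta; rewrite {1}/lmulF /lmulF.
rewrite [RHS](_ : _ = \sum_(0 <= t < j)
   u (lmulT (2 * i + 1 + t)%N (lmulT (i + j - t)%N eta)) *+ 'C(j - t - 1, t)); last first.
  elim: (index_iota 0 j) => [|t r IH]; first by rewrite !big_nil.
  rewrite !big_cons -IH -[LHS]/(_ + _); congr (_ + _).
  by elim: 'C(_, _) => // n IHn; rewrite !mulrS -IHn.
rewrite -adm_fnl_sum //; apply: adm_fnl_eq => // w aw.
have := adm_der_form exp2_F2 j (p := i.+1)
  (T := fun a b => lmulT b.-1 (lmulT a.-1 eta) w)
  (fun p' n pp' => lmulT_relation aw eta n (leq_trans (ltn0Sn i) (ltnW pp'))).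
rewrite lmulT_relation // /adm_form => /(exp2_eq exp2_F2).
have -> : ((2 * i.+1 + j).-1 = 2 * i + 1 + j)%N by lia.
move=> ->; rewrite !big_nat; apply: eq_bigr => t tj.
by congr (lmulT _ (lmulT _ _) _ *+ _); lia.
Qed.

Definition ev_nil : fnl := fun eta => eta [::].

Lemma adm_ev_nil : adm_fnl ev_nil.
Proof. by split=> // eta h; apply: h. Qed.

(** Let y act on the empty word and test the result on the indicator function of J. By [coef_mon]
    this is the coordinate at J in the admissible basis. *)
Definition coef (J : seq nat) (y : Lambda) : 'F_2 :=
  fact lmulF (repr y) ev_nil (fun w => (w == J)%:R).

Lemma coef_rcl J x : coef J (rcl lambda_rel x) =
  fact lmulF x ev_nil (fun w => (w == J)%:R).
Proof.
apply/eqP; rewrite -subr_eq0; apply/eqP.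
have := factBl fnl2 lmulF (repr (rcl lambda_rel x)) x ev_nil.
rewrite (fact_ideal fnl2 lmulFB (A := adm_fnl) (S := lambda_rel)) //.
- by move=> e; apply: (esym (congr1 (fun u : fnl => u (fun w => (w == J)%:R)) e)).
- exact: adm_fnl_op.
- by split=> [eta eta'|//]; apply: (esym (subr0 _)).
- move=> u v [uB u0] [vB v0]; split=> [eta eta'|eta h].
    rewrite -[LHS]/(u _ - v _) uB vB -[RHS]/((u _ - v _) - (u _ - v _)).
    by rewrite !opprD !opprK addrACA; congr (_ + _); rewrite addrC.
  by rewrite -[LHS]/(u _ - v _) u0 // v0 // subrr.
- by move=> r v hr av; apply: lmulF_rel.
- exact: (repr_cl (ideal lambda_rel) x).
- exact: adm_ev_nil.
Qed.

Lemma coef_zmod J : zmod_morphism (coef J).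
Proof.
move=> x y; rewrite -[x]rclLK -[y]rclLK -raddfB !coef_rcl.
by rewrite (factBl fnl2).
Qed.

HB.instance Definition _ J := GRing.isZmodMorphism.Build Lambda 'F_2 (coef J) (coef_zmod J).

(** Building an admissible word on the empty word, letter by letter, never meets an inadmissible
    pair. This gives the linear independence of the admissible monomials. *)
Lemma coef_mon J I : admissible I -> coef J (lam_mon I) = (I == J)%:R.
Proof.
move=> aI; rewrite lam_monE coef_rcl.
suff -> : fact lmulF (fmon I) ev_nil = fun eta => eta I by [].
elim: I aI => [|i I IH] aI; first by rewrite /fmon big_nil fact1.
rewrite /fmon big_cons (factM fnl2 lmulFB) fact_var -/(fmon I).
rewrite IH; last exact: adm_behead aI.
apply: functional_extensionality_dep => eta; rewrite /lmulF.
case: I aI {IH} => [|l I] aI; first by rewrite lmulT_nil.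
by rewrite lmulT_adm //; case/andP: aI.
Qed.

(** * The differential of Lambda *)

Section TwistedDerivation.
Variables (L : pzRingType) (L2 : exp2 L) (lam : nat -> L).

(** With the index shifted and k_0 = 0, relations and differential both become binomial. *)
Definition kap (i : nat) : L := if i is i'.+1 then lam i' else 0.

Lemma kapS i : kap i.+1 = lam i. Proof. by []. Qed.

Definition dkap (n : nat) : L :=
  \sum_(0 <= c < n.+1) (kap c * kap (n - c)) *+ 'C(n, c).

Local Notation x := ((('X : {poly 'F_2})%:P)%:P : R3).
Local Notation y := (('X : {poly {poly 'F_2}})%:P : R3).
Local Notation z := ('X : R3).
Local Notation kap3 := (fun i j l => kap i * kap j * kap l).
Lemma ell_dl a b : ell kap3 ((x + y) ^+ a * z ^+ b) = dkap a * kap b.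
Proof.
rewrite addrC exprDn mulr_suml (ell_sum L2) /dkap big_mkord mulr_suml.
apply: eq_bigr => c _; rewrite [in LHS]mulrnAl (ellMn L2) mulrnAl.
congr (_ *+ _).
by rewrite [y ^+ _ * _]mulrC (ellM L2).
Qed.

Lemma ell_dr a b : ell kap3 (x ^+ a * (y + z) ^+ b) = kap a * dkap b.
Proof.
rewrite (addrC y) exprDn mulr_sumr (ell_sum L2) /dkap big_mkord mulr_sumr.
apply: eq_bigr => c _; rewrite [in LHS]mulrnAr (ellMn L2) mulrnAr.
congr (_ *+ _).
by rewrite [z ^+ _ * _]mulrC [in LHS]mulrA (ellM L2) -mulrA.
Qed.


(** Each half of the Leibniz rule gives the value of (x + y + z)^a, so the halves cancel. *)
Lemma d_dkap (d : L -> L) : zmod_morphism d ->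
  (forall u v, d (u * v) = d u * v + u * d v) ->
  (forall i, d (kap i) = dkap i) -> forall a, d (dkap a) = 0.
Proof.
move=> dB dM dk a.
have e1 : ell kap3 ((x + y + z) ^+ a) =
    \sum_(0 <= c < a.+1) (dkap c * kap (a - c)) *+ 'C(a, c).
  rewrite (addrC (x + y)) exprDn (ell_sum L2) big_mkord; apply: eq_bigr => c _.
  by rewrite (ellMn L2) mulrC ell_dl.
have e2 : ell kap3 ((x + y + z) ^+ a) =
    \sum_(0 <= c < a.+1) (kap c * dkap (a - c)) *+ 'C(a, c).
  rewrite -addrA (addrC x) exprDn (ell_sum L2) big_mkord; apply: eq_bigr => c _.
  by rewrite (ellMn L2) mulrC ell_dr.
transitivity (ell kap3 ((x + y + z) ^+ a) + ell kap3 ((x + y + z) ^+ a)); last exact: L2.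
rewrite {1}e1 e2 -big_split /= -[LHS]/(app (mkHom dB) _) {1}/dkap raddf_sum.
apply: eq_bigr => c _; rewrite raddfMn -mulrnDl; congr (_ *+ _).
by rewrite -[LHS]/(d _) dM !dk.
Qed.

(** A derivation d amounts to the representation of a by the lower triangular matrix with diagonal
    a, a and corner d(a); this is the action of lambda_i on column vectors. *)
Definition dlam_op (i : nat) (u : (L * L)%type) : (L * L)%type :=
  (lam i * u.1, dkap i.+1 * u.1 + lam i * u.2).

Lemma exp2_pair : exp2 (L * L)%type.
Proof. by move=> [u v]; congr pair; apply: L2. Qed.

Lemma dlam_opB i : zmod_morphism (dlam_op i).
Proof.
move=> [u v] [u' v']; congr pair => /=; rewrite !mulrBr //.
by rewrite opprD addrACA.
Qed.

Lemma dlam_op_lin i a b u w :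
  dlam_op i (a * u, b * u + a * w) =
  ((dlam_op i (a, b)).1 * u, (dlam_op i (a, b)).2 * u + (dlam_op i (a, b)).1 * w).
Proof. by rewrite /dlam_op /= mulrDr mulrDl !mulrA addrA. Qed.

Lemma dlam_op_lin0 (u w : L) : (1 * u, 0 * u + 1 * w) = (u, w).
Proof. by rewrite !mul1r mul0r add0r. Qed.

Lemma pairBD (U V : zmodType) (a a' : U) (b b' c c' : V) :
  ((a, b + c) : (U * V)%type) - (a', b' + c') = (a - a', b - b' + (c - c')).
Proof. by rewrite -[RHS]/(a - a', _) addrACA -opprD. Qed.

Lemma pair_sum (U V : zmodType) (r : seq nat) (f : nat -> U) (g : nat -> V) m :
  \sum_(c <- r) ((f c, g c) : (U * V)%type) *+ m c =
  (\sum_(c <- r) f c *+ m c, \sum_(c <- r) g c *+ m c).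
Proof.
have pM (u : U) (v : V) n : ((u, v) : (U * V)%type) *+ n = (u *+ n, v *+ n).
  by elim: n => // n IH; rewrite !mulrS IH.
elim: r => [|c r IH]; first by rewrite !big_nil.
by rewrite !big_cons IH pM.
Qed.

Hypothesis kap_rel : forall p n, (0 < p)%N -> der_form (fun i j => kap i * kap j) p n = 0.

(** The diagonal part is a relation of Lambda; the corner is the derivation applied to that
    relation, which vanishes by [derivation_relation]. *)
Lemma dlam_relation v p n : (0 < p)%N ->
  der_form (fun i j => dlam_op i.-1 (dlam_op j.-1 v)) p n = 0.
Proof.
case: v => u v p0.
transitivity ((der_form (fun i j => kap i * kap j) p n * u,
  (\sum_(0 <= c < n.+1) (ell kap3 ((x + y) ^+ (p + c) * z ^+ (2 * p + n - c)) +
     ell kap3 (x ^+ (p + c) * (y + z) ^+ (2 * p + n - c))) *+ 'C(n, c)) * u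
   + der_form (fun i j => kap i * kap j) p n * v) : (L * L)%type); last first.
  rewrite kap_rel // (derivation_relation L2) //.
  - by rewrite !mul0r addr0.
  - move=> i p' m p'0; rewrite -[RHS](mulr0 (kap i)) -(kap_rel m p'0).
    rewrite /der_form mulr_sumr; apply: eq_bigr => c _.
    by rewrite mulrnAr mulrA.
  - move=> l p' m p'0; rewrite -[RHS](mul0r (kap l)) -(kap_rel m p'0).
    rewrite /der_form mulr_suml; apply: eq_bigr => c _.
    by rewrite mulrnAl.
rewrite /der_form.
transitivity (\sum_(0 <= c < n.+1) ((kap (p + c) * (kap (2 * p + n - c) * u),
   dkap (p + c) * (kap (2 * p + n - c) * u) + kap (p + c) *
   (dkap (2 * p + n - c) * u + kap (2 * p + n - c) * v)) : (L * L)%type)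
   *+ 'C(n, c)).
  apply: eq_big_nat => c cn; rewrite /dlam_op /=.
  have -> : lam (p + c).-1 = kap (p + c) by case: (p) p0.
  have -> : lam (2 * p + n - c).-1 = kap (2 * p + n - c).
    by case e : (2 * p + n - c)%N => //; lia.
  by rewrite !prednK; try by lia.
rewrite pair_sum; congr pair.
  by rewrite mulr_suml; apply: eq_bigr => c _; rewrite mulrnAl mulrA.
rewrite !mulr_suml -big_split /=; apply: eq_bigr => c _.
rewrite (ell_dl (p + c) (2 * p + n - c)) (ell_dr (p + c) (2 * p + n - c)).
rewrite 2!mulrnAl -mulrnDl; congr (_ *+ _).
by rewrite mulrDr mulrDl !mulrA addrA.
Qed.


End TwistedDerivation.

Notation lkap := (kap lam).
Notation ldkap := (dkap lam).
Notation ldlam_op := (dlam_op lam).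

Lemma lam_rel i j : lam i * lam (2 * i + 1 + j)%N =
  \sum_(0 <= t < j) (lam (i + j - t)%N * lam (2 * i + 1 + t)%N) *+ 'C(j - t - 1, t).
Proof.
have := (cl_eq (ideal lambda_rel) (fvar i * fvar (2 * i + 1 + j)%N) (\sum_(0 <= t < j)
   (fvar (i + j - t)%N * fvar (2 * i + 1 + t)%N) *+ 'C(j - t - 1, t))).2 
   (ideal_in (LambdaRel i j)).
rewrite -[cl _ _]/(rcl lambda_rel _) -[X in _ = X -> _]/(rcl lambda_rel _).
rewrite rmorphM /= -/(lam i) => ->; rewrite raddf_sum; apply: eq_bigr => t _.
by rewrite raddfMn /= rmorphM.
Qed.

Lemma kap_relation p n : (0 < p)%N -> der_form (fun i j => lkap i * lkap j) p n = 0.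
Proof.
move: p n; apply: (der_form_eq0 Lambda2 (p0 := 1)) => -[//|p] j _.
apply/(exp2_eq Lambda2).
have -> : (2 * p.+1 + j = (2 * p + 1 + j).+1)%N by lia.
rewrite (kapS lam p) (kapS lam (2 * p + 1 + j)) (lam_rel p j).
apply: eq_big_nat => t tj.
have -> : (p.+1 + j - t = (p + j - t).+1)%N by lia.
by have -> : (2 * p.+1 + t = (2 * p + 1 + t).+1)%N by lia.
Qed.

(** The case p = 0 of [adm_der_form], whose leading term contains k_0 = 0. *)
Lemma dkap_def i : ldkap i.+1 =
  \sum_(1 <= j < i.+1) (lam (i - j) * lam (j - 1)) *+ 'C(i - j, j).
Proof.
have := adm_der_form Lambda2 i.+1 (T := fun i j => lkap i * lkap j) (p := 0%N)
  (fun p' n p0 => kap_relation n p0).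
rewrite /der_form /adm_form mul0r add0r !muln0 !add0n => e.
transitivity (\sum_(0 <= c < i.+2) lkap (0 + c)%N * lkap (0 + i.+1 - c)%N *+ 'C(i.+1, c)).
  by [].
rewrite -e big_nat_recl // mulr0 mul0rn add0r big_add1 /=.
apply: eq_big_nat => j ij; rewrite [(j.+1 - 1)%N]subn1 /=.
have -> : (i.+1 - j.+1 = (i - j.+1).+1)%N by lia.
by rewrite kapS subn1.
Qed.

Lemma dlam_ideal r v : ideal lambda_rel r -> fact ldlam_op r v = 0.
Proof.
move=> hr; apply: (fact_ideal (exp2_pair Lambda2) (@dlam_opB Lambda lam) (A := fun=> True)) hr _ => //.
move=> {}r {}v hr _; apply: (fact_rel (exp2_pair Lambda2) (@dlam_opB Lambda lam)) hr => i j.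
have := adm_der_form (exp2_pair Lambda2) j (p := i.+1)
  (T := fun a b => ldlam_op a.-1 (ldlam_op b.-1 v))
  (fun p' n pp' => dlam_relation Lambda2 kap_relation v n (leq_trans (ltn0Sn i) (ltnW pp'))).
rewrite (dlam_relation Lambda2 kap_relation) // /adm_form => /(exp2_eq (exp2_pair Lambda2)).
have -> : ((2 * i.+1 + j).-1 = 2 * i + 1 + j)%N by lia.
move=> ->; apply: eq_big_nat => t tj.
have -> : ((i.+1 + j - t).-1 = i + j - t)%N by lia.
by have -> : ((2 * i.+1 + t).-1 = 2 * i + 1 + t)%N by lia.
Qed.

Definition dlam (a : Lambda) : Lambda := (fact ldlam_op (repr a) (1, 0)).2.

Lemma fact_dlam_lin g v : fact ldlam_op g v =
  ((fact ldlam_op g (1, 0)).1 * v.1,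
   (fact ldlam_op g (1, 0)).2 * v.1 + (fact ldlam_op g (1, 0)).1 * v.2).
Proof.
pose P h := forall v, fact ldlam_op h v =
  ((fact ldlam_op h (1, 0)).1 * v.1,
   (fact ldlam_op h (1, 0)).2 * v.1 + (fact ldlam_op h (1, 0)).1 * v.2).
have P0 : P 0 by move=> w; rewrite !(fact0l (exp2_pair Lambda2)) !mul0r addr0.
have PB h h' : P h -> P h' -> P (h - h').
  move=> e e' w; rewrite !(factBl (exp2_pair Lambda2)) (e w) (e' w).
  by rewrite [RHS]/= !mulrBl; apply: pairBD.
apply: (@free_ind (@Subgroup free_alg P P0 PB)) => I /= {v}.
rewrite /P; elim: I => [|i I IH] v.
  by rewrite /fmon big_nil !(fact1 _ _) dlam_op_lin0 -surjective_pairing.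
rewrite /fmon big_cons -/(fmon I) !(factM (exp2_pair Lambda2) (@dlam_opB Lambda lam)).
by rewrite !fact_var IH dlam_op_lin -surjective_pairing.
Qed.

Lemma fact_dlam1 g : (fact ldlam_op g (1, 0)).1 = rcl lambda_rel g.
Proof.
pose P h := (fact ldlam_op h (1, 0)).1 = rcl lambda_rel h.
have P0 : P 0 by rewrite /P (fact0l (exp2_pair Lambda2)) !raddf0.
have PB h h' : P h -> P h' -> P (h - h').
  rewrite /P => e e'; rewrite (factBl (exp2_pair Lambda2)).
  have -> : rcl lambda_rel (h - h') = rcl lambda_rel h - rcl lambda_rel h'.
    exact: raddfB.
  by rewrite -e -e'.
apply: (@free_ind (@Subgroup free_alg P P0 PB)) => I /=.
rewrite /P -lam_monE; elim: I => [|i I IH].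
  by rewrite /fmon big_nil fact1 lam_mon_nil.
rewrite /fmon big_cons -/(fmon I) (factM (exp2_pair Lambda2) (@dlam_opB Lambda lam)).
by rewrite fact_var lam_mon_cons -IH.
Qed.

Lemma dlam_rcl h : dlam (rcl lambda_rel h) = (fact ldlam_op h (1, 0)).2.
Proof.
apply/eqP; rewrite -subr_eq0 -[_ - _]/((_ - _ : (Lambda * Lambda)%type).2).
rewrite -(factBl (exp2_pair Lambda2)) dlam_ideal //.
exact: (repr_cl (ideal lambda_rel) h).
Qed.

Lemma leibniz_square (L : pzRingType) : exp2 L -> forall a b u v : L,
  (0 * a + u * v) + (u * v + b * 0) = 0.
Proof. by move=> L2 a b u v; rewrite mul0r mulr0 add0r addr0 L2. Qed.

Lemma dlamM (a b : Lambda) : dlam (a * b) = dlam a * b + a * dlam b.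
Proof.
have e : a * b = rcl lambda_rel (repr a * repr b).
  by rewrite -{1}[a]rclLK -{1}[b]rclLK; apply: (esym (rmorphM _ _ _)).
rewrite {1}e dlam_rcl (factM (exp2_pair Lambda2) (@dlam_opB Lambda lam)).
rewrite fact_dlam_lin [LHS]/=.
have ea := fact_dlam1 (repr a); have eb := fact_dlam1 (repr b).
rewrite rclLK in ea; rewrite rclLK in eb.
by rewrite ea eb.
Qed.

Lemma dlamB : zmod_morphism dlam.
Proof.
move=> a b; rewrite -[a]rclLK -[b]rclLK.
have -> : rcl lambda_rel (repr a) - rcl lambda_rel (repr b) =
  rcl lambda_rel (repr a - repr b) by apply: (esym (raddfB _ _ _)).
by rewrite !dlam_rcl (factBl (exp2_pair Lambda2)).
Qed.

Lemma dlam_lam i : dlam (lam i) = ldkap i.+1.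
Proof. by rewrite dlam_rcl fact_var /= mulr1 mulr0 addr0. Qed.

(** The existence of [dlam] keeps [xget] from falling back on its default. *)
Lemma lambda_dP : is_lambda_diff lambda_d.
Proof.
apply: (xgetPex _ (P := is_lambda_diff)); exists (mkHom dlamB); split=> [a b|i].
  exact: dlamM.
by rewrite -dkap_def -dlam_lam.
Qed.

Local Notation ld := (app lambda_d).

Lemma ldM x y : ld (x * y) = ld x * y + x * ld y.
Proof. by case: lambda_dP. Qed.

Lemma ld_lam i : ld (lam i) = ldkap i.+1.
Proof. by case: lambda_dP => _ ->; rewrite dkap_def. Qed.

Lemma ld1 : ld 1 = 0.
Proof.
have := ldM 1 1; rewrite !mulr1 mul1r => /eqP.
by rewrite -subr_eq0 opprD addrA subrr sub0r oppr_eq0 => /eqP.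
Qed.

Lemma ld_kap a : ld (lkap a) = ldkap a.
Proof.
case: a => [|i]; last exact: ld_lam.
by rewrite /= raddf0 /dkap big_nat1 mul0r mul0rn.
Qed.

Lemma ldd_lam i : ld (ld (lam i)) = 0.
Proof.
rewrite ld_lam; apply: (d_dkap Lambda2 (d := ld)); first exact: (appB lambda_d).
  exact: ldM.
exact: ld_kap.
Qed.

Lemma ldD x y : ld (x + y) = ld x + ld y. Proof. exact: raddfD. Qed.

Lemma ldd x : ld (ld x) = 0.
Proof.
have P0 : ld (ld 0) = 0 by rewrite !raddf0.
have PB a b : ld (ld a) = 0 -> ld (ld b) = 0 -> ld (ld (a - b)) = 0.
  by move=> hx hy; rewrite !appB hx hy subr0.
apply: (@lam_ind (@Subgroup Lambda (fun x => ld (ld x) = 0) P0 PB)) => I /=.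
elim: I => [|i I IH]; first by rewrite lam_mon_nil ld1 raddf0.
have e : ld (ld (lam_mon (i :: I))) =
    (ld (ld (lam i)) * lam_mon I + ld (lam i) * ld (lam_mon I)) +
    (ld (lam i) * ld (lam_mon I) + lam i * ld (ld (lam_mon I))).
  rewrite (lam_mon_cons i I) (ldM (lam i) (lam_mon I)).
  by apply: (etrans (ldD _ _)); congr (_ + _); apply: ldM.
by rewrite e ldd_lam IH; apply: leibniz_square Lambda2 _ _ _ _.
Qed.

(** * Filtrations *)

Lemma gen_preim (V W : zmodType) (S : V -> Prop) (f : V -> W) (P : subgroup W) :
  zmod_morphism f -> (forall x, S x -> P (f x)) -> forall x, gen S x -> P (f x).
Proof.
move=> fB SP x; elim=> {x} [x /SP //||x y _ Px _ Py].
  by rewrite zmorph0 //; apply: sg_mem0.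
by rewrite fB; apply: sg_memB.
Qed.

Lemma gen_mono (V : zmodType) (S S' : V -> Prop) : (forall x, S x -> S' x) ->
  forall x, gen S x -> gen S' x.
Proof. by move=> SS' x; apply: gen_min => y /SS'; apply: gen_in. Qed.

Lemma sg_sum (V : zmodType) (P : subgroup V) (I : eqType) (r : seq I) (F : I -> V) :
  (forall i, i \in r -> P (F i)) -> P (\sum_(i <- r) F i).
Proof.
elim: r => [|i r IH] h; first by rewrite big_nil; apply: sg_mem0.
rewrite big_cons; apply: sg_memD; first by apply: h; rewrite mem_head.
by apply: IH => j jr; apply: h; rewrite in_cons jr orbT.
Qed.

Lemma sg_Mn (V : zmodType) (P : subgroup V) x n : (n != 0%N -> P x) -> P (x *+ n).
Proof.
case: n => [|n] Px; first by rewrite mulr0n; apply: sg_mem0.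
have {}Px := Px isT.
by elim: n => // n IH; rewrite mulrS; apply: sg_memD.
Qed.

Lemma in_Lambda1 m i : in_Lambda m [:: i] = (i < m)%N. Proof. by []. Qed.

(** The letter i carries degree m to m + i + 1, where the rest of the word starts. *)
Lemma in_Lambda_cons2 m i l J : in_Lambda m (i :: l :: J) =
  [&& (i < m)%N, (l <= 2 * i)%N & in_Lambda (m + i).+1 (l :: J)].
Proof.
rewrite /in_Lambda adm_cons [head 0%N (i :: _)]/= [head 0%N (l :: _)]/=.
case: (admissible (l :: J)); rewrite /= ?andbF ?andbT //.
by apply/idP/idP => [/andP[]|/and3P[]]; lia.
Qed.

Lemma in_Lambda_cons m i J : in_Lambda m (i :: J) -> (i < m)%N /\ in_Lambda (m + i).+1 J.
Proof. by case: J => [|l J]; [rewrite in_Lambda1|rewrite in_Lambda_cons2 => /and3P[]]. Qed.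

Lemma in_Gamma1 m k i : in_Gamma m k [:: i] = (i + k < m)%N.
Proof. by rewrite /in_Gamma /excess /= big_geq //; apply/idP/idP; lia. Qed.

(** The inequality on the excess telescopes to a condition on the last letter alone: by [in_Gamma1],
    its lower index is at least k. *)
Lemma in_Gamma_cons2 m k i l J : in_Gamma m k (i :: l :: J) =
  [&& (i < m)%N, (l <= 2 * i)%N & in_Gamma (m + i).+1 k (l :: J)].
Proof.
rewrite /in_Gamma adm_cons /excess /= big_nat_recl //=.
set e := \sum_(_ <= _ < _) _; case: (path _ _ _); rewrite /= ?andbF ?andbT //.
by apply/idP/idP; lia.
Qed.

Lemma in_Gamma_Lambda m k J : in_Gamma m k J -> in_Lambda m J.
Proof. by case/and4P => aJ nJ mJ _; rewrite /in_Lambda aJ mJ orbT. Qed.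

Lemma in_Lambda_adm m J : in_Lambda m J -> admissible J.
Proof. by case/andP. Qed.

(* Lower indices increase. *)
Lemma in_Gamma_first m k l J : in_Lambda m (l :: J) -> (l + k < m)%N ->
  in_Gamma m k (l :: J).
Proof.
elim: J l m => [|l' J IH] l m; first by rewrite in_Gamma1.
rewrite in_Lambda_cons2 in_Gamma_cons2 => /and3P[lm ll h] lk.
by rewrite lm ll /=; apply: IH => //; lia.
Qed.

Definition HL m s n : subgroup Lambda :=
  gen (fun x => exists J, [/\ in_Lambda m J, size J = s, deg J = n & x = lam_mon J]).
Definition HG m k s n : subgroup Lambda :=
  gen (fun x => exists J, [/\ in_Gamma m k J, size J = s, deg J = n & x = lam_mon J]).

Lemma HL_in m J : in_Lambda m J -> HL m (size J) (deg J) (lam_mon J).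
Proof. by move=> h; apply: gen_in; exists J. Qed.

Lemma HG_in m k J : in_Gamma m k J -> HG m k (size J) (deg J) (lam_mon J).
Proof. by move=> h; apply: gen_in; exists J. Qed.

Lemma mull_zmod (a : Lambda) : zmod_morphism (fun x => a * x).
Proof. exact: mulrBr. Qed.
Lemma mulr_zmod (a : Lambda) : zmod_morphism (fun x => x * a).
Proof. by move=> x y; apply: mulrBl. Qed.

(** Rewriting an inadmissible pair preserves the sum of its letters, hence the degree in which the
    rest of the word starts. In both recursive products the right factor has smaller degree. *)
Lemma prodL_mon m i J : (i < m)%N -> in_Lambda (m + i).+1 J ->
  HL m (size J).+1 (i.+1 + deg J) (lam i * lam_mon J).
Proof.
have [n] := ubnP (deg J); elim: n m i J => // n IH m i [|l J] dJ im hJ.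
  by rewrite lam_mon_nil mulr1 -[lam i]mulr1 -lam_mon_nil -lam_mon_cons deg_nil addn0
     -[i.+1]addn0 -deg_nil -deg_cons; apply: (@HL_in m [:: i]).
rewrite deg_cons in dJ *.
have [li|il] := leqP l (2 * i)%N.
  rewrite -lam_mon_cons -deg_cons -deg_cons; apply: (@HL_in m [:: i, l & J]).
  by rewrite in_Lambda_cons2 im li.
have [lm hJ'] := in_Lambda_cons hJ.
rewrite lam_mon_cons mulrA.
have -> : lam l = lam (2 * i + 1 + (l - (2 * i + 1)))%N by congr lam; lia.
rewrite lam_rel mulr_suml; apply: sg_sum => t; rewrite mem_index_iota => tj.
rewrite mulrnAl -mulrA; apply: sg_Mn => _.
set c := (i + (l - (2 * i + 1)) - t)%N; set d := (2 * i + 1 + t)%N.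
have H1 : HL (m + c).+1 (size J).+1 (d.+1 + deg J) (lam d * lam_mon J).
  apply: IH; [lia|rewrite /d /c; lia|].
  by have -> : (((m + c).+1 + d).+1 = ((m + i).+1 + l).+1)%N by rewrite /c /d; lia.
apply: (gen_preim (f := fun x => lam c * x) (mull_zmod _)) H1 => _ [K [hK sK dK ->]].
have -> : (i.+1 + (l.+1 + deg J) = c.+1 + deg K)%N by rewrite dK /c /d; lia.
by rewrite /= -sK; apply: IH => //; rewrite ?dK /c /d; lia.
Qed.

Lemma prodL m s n i x : (i < m)%N -> HL (m + i).+1 s n x ->
  HL m s.+1 (i.+1 + n) (lam i * x).
Proof.
move=> im; apply: (gen_preim (mull_zmod _)) => _ [K [hK <- <- ->]].
exact: prodL_mon.
Qed.

(** The alternatives are: the last lower index of J is at least k; the lower index m - 1 - i of the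
    letter i is at least k; or it is at least k - 1 and another letter follows. The last one is the
    form that survives the rewriting of an inadmissible pair. *)
Lemma prodG_mon m k i J : (i < m)%N -> in_Lambda (m + i).+1 J ->
  in_Gamma (m + i).+1 k J || (i + k < m)%N || ((i + k <= m)%N && (J != [::])) ->
  HG m k (size J).+1 (i.+1 + deg J) (lam i * lam_mon J).
Proof.
have [n] := ubnP (deg J); elim: n m i J => // n IH m i [|l J] dJ im hJ.
  rewrite andbF orbF [in_Gamma _ _ _]/= => ik.
  rewrite -lam_mon_cons -deg_cons; apply: (@HG_in m k [:: i]).
  by rewrite in_Gamma1.
move=> alt; have {alt} : in_Gamma (m + i).+1 k (l :: J) || (i + k <= m)%N.
  by case/orP: alt => [/orP[->|/ltnW->]|/andP[->]]; rewrite ?orbT.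
rewrite deg_cons in dJ *; move=> alt.
have [li|il] := leqP l (2 * i)%N.
  rewrite -lam_mon_cons -deg_cons -deg_cons; apply: (@HG_in m k [:: i, l & J]).
  rewrite in_Gamma_cons2 im li /=; case/orP: alt => // ik.
  by apply: in_Gamma_first => //; lia.
have [lm hJ'] := in_Lambda_cons hJ.
rewrite lam_mon_cons mulrA.
have -> : lam l = lam (2 * i + 1 + (l - (2 * i + 1)))%N by congr lam; lia.
rewrite lam_rel mulr_suml; apply: sg_sum => t; rewrite mem_index_iota => tj.
rewrite mulrnAl -mulrA; apply: sg_Mn => bin0.
set c := (i + (l - (2 * i + 1)) - t)%N; set d := (2 * i + 1 + t)%N.
(* A nonzero coefficient forces this bound, and then the lower index m + c - d of the new second
   letter is at least m - i. *)
have tj2 : (2 * t < l - (2 * i + 1))%N.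
  by move: bin0; rewrite -lt0n bin_gt0; lia.
have e : (((m + c).+1 + d).+1 = ((m + i).+1 + l).+1)%N by rewrite /c /d; lia.
have H1 : HG (m + c).+1 k (size J).+1 (d.+1 + deg J) (lam d * lam_mon J).
  apply: IH; [lia|rewrite /d /c; lia|by rewrite e|rewrite e].
  case/orP: alt => [|ik]; last by apply/orP; left; apply/orP; right; rewrite /d /c; lia.
  case: (J) hJ' => [|l' J'] hJ'; last by rewrite in_Gamma_cons2 => /and3P[_ _ ->].
  by rewrite in_Gamma1 => lk; apply/orP; left; apply/orP; right; rewrite /d /c; lia.
apply: (gen_preim (f := fun x => lam c * x) (mull_zmod _)) H1 => _ [K [hK sK dK ->]].
have -> : (i.+1 + (l.+1 + deg J) = c.+1 + deg K)%N by rewrite dK /c /d; lia.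
rewrite /= -sK; apply: IH; rewrite ?dK ?hK //; try by rewrite /c /d; lia.
exact: in_Gamma_Lambda hK.
Qed.

Lemma prodG m k s n i x : (i < m)%N -> HG (m + i).+1 k s n x ->
  HG m k s.+1 (i.+1 + n) (lam i * x).
Proof.
move=> im; apply: (gen_preim (mull_zmod _)) => _ [K [hK <- <- ->]].
by apply: prodG_mon; rewrite ?hK //; apply: in_Gamma_Lambda hK.
Qed.

Lemma prodG_first m k s n i x : (i + k < m)%N -> HL (m + i).+1 s n x ->
  HG m k s.+1 (i.+1 + n) (lam i * x).
Proof.
move=> ik; apply: (gen_preim (mull_zmod _)) => _ [K [hK <- <- ->]].
by apply: prodG_mon; rewrite ?ik ?orbT //; lia.
Qed.

Lemma HL_cast m s n s' n' x : s = s' -> n = n' -> HL m s n x -> HL m s' n' x.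
Proof. by move=> -> ->. Qed.
Lemma HG_cast m k s n s' n' x : s = s' -> n = n' -> HG m k s n x -> HG m k s' n' x.
Proof. by move=> -> ->. Qed.

Lemma dlam_mul i x : ld (lam i) * x =
  \sum_(1 <= j < i.+1) (lam (i - j) * (lam (j - 1) * x)) *+ 'C(i - j, j).
Proof.
rewrite ld_lam dkap_def mulr_suml; apply: eq_bigr => j _.
by rewrite mulrnAl mulrA.
Qed.

Lemma dlamL m s n i x : (i < m)%N -> HL (m + i).+1 s n x ->
  HL m s.+2 (i.+1 + n) (ld (lam i) * x).
Proof.
move=> im hx; rewrite dlam_mul; apply: sg_sum => j; rewrite mem_index_iota => ij.
apply: sg_Mn => b0; have ji : (j <= i - j)%N by rewrite -bin_gt0 lt0n.
apply: (HL_cast (s := s.+2) (n := ((i - j).+1 + ((j - 1).+1 + n))%N)) => //; first by lia.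
apply: prodL; first by lia.
apply: prodL; first by lia.
by have -> : (((m + (i - j)).+1 + (j - 1)).+1 = (m + i).+1)%N by lia.
Qed.

Lemma dlamG m k s n i x : (i < m)%N -> HG (m + i).+1 k s n x ->
  HG m k s.+2 (i.+1 + n) (ld (lam i) * x).
Proof.
move=> im hx; rewrite dlam_mul; apply: sg_sum => j; rewrite mem_index_iota => ij.
apply: sg_Mn => b0; have ji : (j <= i - j)%N by rewrite -bin_gt0 lt0n.
apply: (HG_cast (s := s.+2) (n := ((i - j).+1 + ((j - 1).+1 + n))%N)) => //; first by lia.
apply: prodG; first by lia.
apply: prodG; first by lia.
by have -> : (((m + (i - j)).+1 + (j - 1)).+1 = (m + i).+1)%N by lia.
Qed.

(** In d(lambda_i) the first letter i - j is smaller than i, so its lower index is larger than that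
    of i; lower index k - 1 for i is therefore enough. *)
Lemma dlamG_first m k s n i x : (i < m)%N -> (i + k <= m)%N -> HL (m + i).+1 s n x ->
  HG m k s.+2 (i.+1 + n) (ld (lam i) * x).
Proof.
move=> im ik hx; rewrite dlam_mul; apply: sg_sum => j; rewrite mem_index_iota => ij.
apply: sg_Mn => b0; have ji : (j <= i - j)%N by rewrite -bin_gt0 lt0n.
apply: (HG_cast (s := s.+2) (n := ((i - j).+1 + ((j - 1).+1 + n))%N)) => //; first by lia.
apply: prodG_first; first by lia.
apply: prodL; first by lia.
by have -> : (((m + (i - j)).+1 + (j - 1)).+1 = (m + i).+1)%N by lia.
Qed.

Lemma ld_mon_cons i J : ld (lam_mon (i :: J)) =
  ld (lam i) * lam_mon J + lam i * ld (lam_mon J).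
Proof. by rewrite (lam_mon_cons i J); apply: ldM. Qed.

Lemma dL_mon m J : in_Lambda m J -> HL m (size J).+1 (deg J) (ld (lam_mon J)).
Proof.
elim: J m => [|i J IH] m hJ; first by rewrite lam_mon_nil ld1; apply: sg_mem0.
have [im hJ'] := in_Lambda_cons hJ; rewrite ld_mon_cons deg_cons.
apply: sg_memD; last exact: prodL (IH _ hJ').
exact: dlamL (HL_in hJ').
Qed.

Lemma dL m s n x : HL m s n x -> HL m s.+1 n (ld x).
Proof.
apply: (gen_preim (appB lambda_d)) => _ [J [hJ <- <- ->]]; exact: dL_mon.
Qed.

Lemma dG_mon m k J : in_Gamma m k J -> HG m k (size J).+1 (deg J) (ld (lam_mon J)).
Proof.
elim: J m => [//|i J IH] m hG; have hJ := in_Gamma_Lambda hG.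
have [im hJ'] := in_Lambda_cons hJ; rewrite ld_mon_cons deg_cons.
case: J hG hJ' IH {hJ} => [|l J] hG hJ' IH.
  rewrite in_Gamma1 in hG; apply: sg_memD; last first.
    by rewrite lam_mon_nil ld1 mulr0; apply: sg_mem0.
  by apply: dlamG_first (HL_in hJ') => //; lia.
move: hG; rewrite in_Gamma_cons2 => /and3P[_ _ hG].
apply: sg_memD; last exact: prodG (IH _ hG).
exact: dlamG (HG_in hG).
Qed.

Lemma dG m k s n x : HG m k s n x -> HG m k s.+1 n (ld x).
Proof.
apply: (gen_preim (appB lambda_d)) => _ [J [hJ <- <- ->]]; exact: dG_mon.
Qed.

(** * The basis of Lambda_k(m) *)

Definition in_basis k m J := in_Lambda m J && ~~ in_Gamma m k J.

Lemma in_basis_Lambda k m J : in_basis k m J -> in_Lambda m J.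
Proof. by case/andP. Qed.

Lemma in_basis1 k m i : in_basis k m [:: i] = (i < m <= i + k)%N.
Proof. by rewrite /in_basis in_Lambda1 in_Gamma1; lia. Qed.

Lemma in_basis_cons2 k m i l J : in_basis k m (i :: l :: J) =
  [&& (i < m)%N, (l <= 2 * i)%N & in_basis k (m + i).+1 (l :: J)].
Proof.
rewrite /in_basis in_Lambda_cons2 in_Gamma_cons2.
by case: (i < m)%N; case: (l <= 2 * i)%N.
Qed.

Lemma in_Gamma_mono m k K J : (K <= k)%N -> in_Gamma m k J -> in_Gamma m K J.
Proof.
move=> Kk; rewrite /in_Gamma => /and4P[-> -> -> h] /=.
by apply: le_lt_trans h; lia.
Qed.

Lemma in_basis0 m i J : in_basis 0 m (i :: J) = false.
Proof.
elim: J m i => [|l J IH] m i; first by rewrite in_basis1; lia.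
by rewrite in_basis_cons2 IH !andbF.
Qed.

(** The bound n + i < m says that the first lower index is at least n; each further letter raises n
    by one. *)
Lemma in_Gamma_long_aux k J : forall n m i, in_Lambda m (i :: J) ->
  (n + i < m)%N -> (k <= n + size J)%N -> in_Gamma m k (i :: J).
Proof.
elim: J => [|l J IH] n m i; first by rewrite in_Gamma1 /= => _; lia.
rewrite in_Lambda_cons2 in_Gamma_cons2 => /and3P[im li hJ] nm kn.
by rewrite im li /=; apply: (IH n.+1) => //; move: kn => /=; lia.
Qed.

(* The number of lower indices is at most the number of their possible values. *)
Lemma in_Gamma_long m k J : in_Lambda m J -> (k < size J)%N -> in_Gamma m k J.
Proof.
case: J => // i J hJ kJ; have [im _] := in_Lambda_cons hJ.
exact: (in_Gamma_long_aux (n := 0%N)).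
Qed.

Lemma deg_rcons J l : deg (rcons J l) = (deg J + l.+1)%N.
Proof. by rewrite -cats1 /deg big_cat /= big_seq1. Qed.

Lemma lam_mon_rcons J l : lam_mon (rcons J l) = lam_mon J * lam l.
Proof. by rewrite -cats1 lam_mon_cat /lam_mon big_seq1. Qed.

(** The equation says that l, started in degree m + deg J, has lower index K, which exceeds all
    lower indices of J. *)
Lemma in_basis_rcons K m J l : (l + K.+1 = m + deg J)%N -> in_basis K m J ->
  in_basis K.+1 m (rcons J l) && ~~ in_basis K m (rcons J l).
Proof.
elim: J m => [|i J IH] m; first by rewrite deg_nil !in_basis1; lia.
rewrite deg_cons => e; case: J IH e => [|i' J] IH e.
  by move: e; rewrite deg_nil /= !in_basis_cons2 !in_basis1; lia.
rewrite !rcons_cons !in_basis_cons2 => /and3P[-> -> h] /=.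
by apply: IH => //; lia.
Qed.

(** Together with [in_basis_rcons] this describes the quotient of Gamma(m, K) by Gamma(m, K+1): its
    basis consists of the words J' l with J' in the basis for K and l determined by degree. *)
Lemma in_basis_rconsP K m J : in_basis K.+1 m J -> ~~ in_basis K m J ->
  exists J' l, [/\ J = rcons J' l, (l + K.+1 = m + deg J')%N & in_basis K m J'].
Proof.
elim: J m => [|i J IH] m; first by [].
case: J IH => [|l J] IH.
  rewrite !in_basis1 => h h'; exists [::], i; rewrite deg_nil; split=> //.
  by lia.
rewrite !in_basis_cons2 => /and3P[im li h]; rewrite im li /= => /(IH _ h).
case=> [[|i' J'] [l' [e el hb]]].
  case: e el li => -> -> el li; exists [:: i], l'; split=> //.
    by rewrite deg_cons deg_nil; move: el; rewrite deg_nil; lia.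
  by rewrite in_basis1; move: el; rewrite deg_nil; lia.
case: e el hb li => -> -> el hb li; exists [:: i, i' & J'], l'; split=> //.
  by move: el; rewrite !deg_cons; lia.
by rewrite in_basis_cons2 im li.
Qed.

(* In the product of a monomial whose last lower index is at least [K] with the
   letter of lower index [K], some lower index exceeds [K]. *)
Lemma HG_rcons K m J l : (l + K.+1 = m + deg J)%N -> in_Gamma m K J ->
  HG m K.+1 (size J).+1 (deg J + l.+1)%N (lam_mon J * lam l).
Proof.
elim: J m => [//|i J IH] m; case: J IH => [|l' J] IH.
  rewrite deg_cons deg_nil lam_mon_cons lam_mon_nil mulr1 in_Gamma1 => e iK.
  have [iK1|] := ltnP (i + K.+1) m.
    apply: (HG_cast (s := 2%N) (n := (i.+1 + l.+1)%N)) => //; first by lia.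
    apply: prodG_first => //.
    have := HL_in (m := (m + i).+1) (J := [:: l]); rewrite in_Lambda1 deg_cons deg_nil.
    by rewrite lam_mon_cons lam_mon_nil mulr1 addn0; apply; lia.
  move=> iK1; have -> : l = (2 * i + 1 + 0)%N by lia.
  by rewrite lam_rel big_geq //; apply: sg_mem0.
rewrite in_Gamma_cons2 deg_cons lam_mon_cons -mulrA => e /and3P[im _ h].
apply: (HG_cast (s := (size (l' :: J)).+2) (n := (i.+1 + (deg (l' :: J) + l.+1))%N)) => //; first by lia.
by apply: prodG => //; apply: IH => //; lia.
Qed.

(** * Adem relations on sums of monomials x_1^(2^a_1) ... x_n^(2^a_n) *)

Section BinomialIdentity.
Local Notation bn a b := ('C(a, b)%:R : 'F_2).

Definition adem_coef J I T : 'F_2 := if (2 * T <= I)%N then bn (J - T - 1) (I - 2 * T) else 0.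

Lemma bnS a b : bn a.+1 b.+1 = bn a b.+1 + bn a b.
Proof. by rewrite binS natrD. Qed.

Lemma adem_coef_rec J I T : (0 < I)%N -> (I.+2 <= 2 * J)%N ->
  adem_coef J I T + adem_coef J I T.+1 = adem_coef J.-1 I T + adem_coef J I.-1 T.
Proof.
move=> I0 IJ; rewrite /adem_coef.
have [h|h] := leqP (2 * T) I; have [h'|h'] := leqP (2 * T.+1) I;
  have [h2|h2] := leqP (2 * T) I.-1; try lia.
- have -> : (I - 2 * T = (I - 2 * T.+1).+2)%N by lia.
  have -> : (I.-1 - 2 * T = (I - 2 * T.+1).+1)%N by lia.
  have -> : (J - T - 1 = (J - T.+1 - 1).+1)%N by lia.
  have -> : (J.-1 - T - 1 = J - T.+1 - 1)%N by lia.
  by rewrite !bnS addrA.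
- have -> : (I - 2 * T = 1)%N by lia.
  have -> : (I.-1 - 2 * T = 0)%N by lia.
  have -> : (J - T - 1 = (J.-1 - T - 1).+1)%N by lia.
  by rewrite bnS addr0 !bin0.
- have -> : (I - 2 * T = 0)%N by lia.
  by rewrite !bin0 !addr0.
- by rewrite !addr0.
Qed.

(** The Adem relation read on generating polynomials. Pascal's rule gives an induction on I + J; I =
    2J and I + 1 = 2J lie outside the range of [adem_coef_rec] and are treated directly. *)
Lemma adem_binomial I J : (I <= 2 * J)%N ->
  bn (I + J) J = \sum_(0 <= T < I.+1) adem_coef J I T * bn (I + J) T.
Proof.
have [n] := ubnP (I + J); elim: n I J => // n IH I J IJn IJ.
have [->|I0] := posnP I.
  by rewrite big_nat1 /adem_coef /= add0n binn !bin0 mulr1.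
(* Only T = J contributes, with coefficient 1 because J - T - 1 truncates to 0. *)
have [e|ne] := eqVneq I (2 * J)%N.
  have -> : (I.+1 = J + (I - J).+1)%N by lia.
  rewrite (big_cat_nat (n := J)) //=; last by lia.
  rewrite [X in X + _]big_nat big1 ?add0r => [|T TJ]; last first.
    rewrite /adem_coef ifT; last by lia.
    by rewrite bin_small ?mul0r //; lia.
  rewrite big_ltn; last by lia.
  rewrite /adem_coef ifT; last by lia.
  have -> : (I - 2 * J = 0)%N by lia.
  rewrite bin0 mul1r big_nat big1 ?addr0 // => T TJ.
  by rewrite ifF ?mul0r //; lia.
(* All coefficients on the right vanish, and C(3J-1, J) is twice C(3J-1, J-1). *)
have [e'|ne'] := eqVneq I.+1 (2 * J)%N.
  rewrite big_nat big1 => [|T TJ]; last first.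
    rewrite /adem_coef; case: ifP => h; last by rewrite mul0r.
    by rewrite bin_small ?mul0r //; lia.
  have J0 : (0 < J)%N by lia.
  suff -> : 'C(I + J, J) = (2 * 'C(I + J, J.-1))%N by rewrite mul2n -addnn natrD exp2_F2.
  have := mul_bin_left (I + J) J.-1; rewrite prednK //.
  have -> : (I + J - J.-1 = J * 2)%N by lia.
  by rewrite -mulnA => /eqP; rewrite eqn_pmul2l // => /eqP.
have J0 : (0 < J)%N by lia.
transitivity (\sum_(0 <= T < I.+1) (adem_coef J.-1 I T + adem_coef J I.-1 T) * bn (I + J).-1 T).
  have -> : bn (I + J) J = bn (I + J.-1) J.-1 + bn (I.-1 + J) J.
    have -> : (I + J = (I + J.-1).+1)%N by lia.
    case: J J0 {IJn IJ ne ne'} => // J _; rewrite bnS addrC; congr (_ + _).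
    by congr (_%:R); congr 'C(_, _); lia.
  rewrite (IH I J.-1); [|lia|lia]; rewrite (IH I.-1 J); [|lia|lia].
  have -> : (I + J.-1 = (I + J).-1)%N by lia.
  have -> : (I.-1 + J = (I + J).-1)%N by lia.
  rewrite prednK // [X in _ = X](eq_bigr (fun T => adem_coef J.-1 I T * bn (I + J).-1 T
     + adem_coef J I.-1 T * bn (I + J).-1 T)); last by move=> T _; rewrite mulrDl.
  rewrite big_split /=; congr (_ + _).
  rewrite [RHS]big_nat_recr //= [X in _ + X](_ : _ = 0) ?addr0 //.
  by rewrite /adem_coef ifF ?mul0r //; lia.
rewrite [LHS](eq_bigr (fun T => adem_coef J I T * bn (I + J).-1 T
  + adem_coef J I T.+1 * bn (I + J).-1 T)); last first.
  by move=> T _; rewrite -mulrDl adem_coef_rec //; lia.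
rewrite big_split /=.
have -> : \sum_(0 <= T < I.+1) adem_coef J I T * bn (I + J) T =
  \sum_(0 <= T < I.+1) adem_coef J I T * bn (I + J).-1 T +
  \sum_(0 <= T < I) adem_coef J I T.+1 * bn (I + J).-1 T.
  rewrite [LHS]big_nat_recl // [X in _ = X + _]big_nat_recl // -addrA -big_split /=.
  rewrite !bin0; congr (_ + _); apply: eq_bigr => T _; rewrite -mulrDr; congr (_ * _).
  have : (0 < I + J)%N by lia.
  by case: (I + J)%N => // N _; rewrite bnS.
congr (_ + _); rewrite [LHS]big_nat_recr //= [X in _ + X](_ : _ = 0) ?addr0 //.
by rewrite /adem_coef ifF ?mul0r //; lia.
Qed.

(* [c i j] are the coefficients of a sum of the [Sq^i Sq^j]; it acts as zero
   when it annihilates the coefficients of (s + t)^a (s^2 t)^b. *)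
Definition annihilates (c : nat -> nat -> 'F_2) := forall a b,
  \sum_(0 <= u < a.+1) c (2 * b + (a - u))%N (b + u)%N * bn a u = 0.

Lemma annihilates1 c : annihilates c -> annihilates (fun i j => c i.+1 j + c i j.+1).
Proof.
move=> H a b; rewrite -[RHS](H a.+1 b).
rewrite [RHS]big_nat_recl // bin0 [in RHS]addrC.
under [in RHS]eq_bigr => u _ do rewrite bnS mulrDr.
rewrite big_split /= [RHS]addrAC.
under eq_bigr => u _ do rewrite mulrDl.
rewrite big_split /=; congr (_ + _); last first.
  by apply: eq_big_nat => u ua; congr (c _ _ * _); lia.
rewrite addrC [LHS]big_nat_recl // [in RHS]big_nat_recr //= (@bin_small a a.+1) // mulr0 addr0.
congr (_ + _); first by rewrite bin0; congr (c _ _ * _); lia.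
by apply: eq_big_nat => u ua; congr (c _ _ * _); lia.
Qed.

(** Dual to multiplication by (s + t)^(2^e), which is s^(2^e) + t^(2^e) modulo 2. *)
Lemma annihilates_exp c e : annihilates c ->
  annihilates (fun i j => c (i + 2 ^ e)%N j + c i (j + 2 ^ e)%N).
Proof.
elim: e c => [|e IH] c H.
  by move=> a b; rewrite -[RHS](annihilates1 H a b); apply: eq_bigr => u _; rewrite !addn1.
move=> a b; rewrite -[RHS](IH _ (IH _ H) a b); apply: eq_bigr => u _; congr (_ * _).
rewrite expnS mul2n -addnn !addnA.
by rewrite !addn0 -[RHS]addrA [X in _ = _ + X]addrA exp2_F2 add0r.
Qed.

(** Dual to multiplication by (s^2 t)^e. *)
Lemma annihilates_mul c e : annihilates c -> annihilates (fun i j => c (i + 2 * e)%N (j + e)%N).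
Proof.
move=> H a b; rewrite -[RHS](H a (b + e)%N); apply: eq_big_nat => u _.
by congr (c _ _ * _); lia.
Qed.

Definition adem_c i j : nat -> nat -> 'F_2 := fun i' j' =>
  if (i' + j' == i + j)%N then (j' == j)%:R + adem_coef j i j' else 0.

(** Tested on (s + t)^a (s^2 t)^b, the relation becomes [adem_binomial] for I = i - 2b and J = j -
    b. *)
Lemma adem_annihilates i j : (i < 2 * j)%N -> annihilates (adem_c i j).
Proof.
move=> ij a b.
have [e|ne] := eqVneq (a + 3 * b)%N (i + j)%N; last first.
  rewrite big_nat big1 // => u ua; rewrite /adem_c ifF ?mul0r //.
  by apply/negbTE; move: ne; apply: contra => /eqP <-; lia.
rewrite (eq_big_nat _ _ (F2 := fun u => (b + u == j)%N%:R * bn a u + adem_coef j i (b + u)%N * bn a u));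
  last by move=> u ua; rewrite /adem_c ifT ?mulrDl //; lia.
rewrite big_split /=; apply/(exp2_eq exp2_F2).
have [ib|bi] := leqP (2 * b) i; last first.
  rewrite !big_nat !big1 // => u ua; rewrite /adem_coef.
    by rewrite ifF ?mul0r //; lia.
  case: eqP => [?|_]; last by rewrite mul0r.
  by rewrite bin_small ?mulr0 //; lia.
have bj : (b <= j)%N by lia.
have ea : a = (i - 2 * b + (j - b))%N by lia.
transitivity (bn a (j - b)).
  rewrite (big_cat_nat (n := (j - b)%N)) //=; last by lia.
  rewrite [X in X + _]big_nat big1 ?add0r => [|u ua]; last by case: eqP => [?|_]; [lia|rewrite mul0r].
  rewrite big_ltn; last by lia.
  rewrite subnKC // eqxx mul1r big_nat big1 ?addr0 // => u ua.
  by case: eqP => [?|_]; [lia|rewrite mul0r].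
rewrite ea adem_binomial; last by lia.
have -> : ((i - 2 * b + (j - b)).+1 = (i - 2 * b).+1 + (j - b))%N by lia.
rewrite [RHS](big_cat_nat (n := (i - 2 * b).+1)) //=; last by lia.
rewrite [X in _ = _ + X]big_nat [X in _ = _ + X]big1 ?addr0 => [|u ua]; last first.
  by rewrite /adem_coef ifF ?mul0r //; lia.
apply: eq_big_nat => u ua; congr (_ * _); rewrite /adem_coef.
have -> : (2 * u <= i - 2 * b)%N = (2 * (b + u) <= i)%N by lia.
by case: ifP => // h; congr ('C(_, _)%:R); lia.
Qed.

End BinomialIdentity.

Definition Wt : zmodType := prodz (fun _ : seq nat => 'F_2).

Lemma Wt2 : exp2 Wt.
Proof. by move=> u; apply: functional_extensionality_dep => w; apply: exp2_F2. Qed.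

(* A function on sequences (a_1, ..., a_n) is a sum of the monomials
   x_1^(2^a_1) ... x_n^(2^a_n), on which Sq^i acts by the Cartan formula. *)
Fixpoint sqW (i : nat) (f : Wt) (w : seq nat) {struct w} : 'F_2 :=
  if w is a :: w' then sqW i (fun v => f (a :: v)) w' +
    (if a is b.+1 then if (2 ^ b <= i)%N then sqW (i - 2 ^ b) (fun v => f (b :: v)) w' else 0
     else 0)
  else if i == 0%N then f [::] else 0.

Lemma sqWD i f g w : sqW i (fun v => f v + g v) w = sqW i f w + sqW i g w.
Proof.
elim: w i f g => [|a w IH] i f g /=; first by case: ifP; rewrite ?addr0.
rewrite IH; case: a => [|b]; first by rewrite !addr0.
case: ifP => _; last by rewrite !addr0.
by rewrite IH addrACA.
Qed.

Lemma sqW0 i w : sqW i (fun=> 0) w = 0.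
Proof.
elim: w i => [|a w IH] i /=; first by case: ifP.
by rewrite IH; case: a => [|b]; rewrite ?addr0 //; case: ifP; rewrite ?IH addr0.
Qed.

Lemma sqWB i f g w : sqW i (fun v => f v - g v) w = sqW i f w - sqW i g w.
Proof.
rewrite (exp2B exp2_F2) -sqWD; congr sqW.
by apply: functional_extensionality_dep => v; rewrite (exp2B exp2_F2).
Qed.

Lemma sqW_Sq0 f w : sqW 0 f w = f w.
Proof.
elim: w f => [|a w IH] f //=; rewrite IH; case: a => [|b]; rewrite ?addr0 //.
by rewrite leqn0 expn_eq0 /= addr0.
Qed.

Definition conv d (c : nat -> nat -> 'F_2) (F : nat -> nat -> 'F_2) : 'F_2 :=
  \sum_(0 <= j < d.+1) c (d - j)%N j * F (d - j)%N j.

Lemma convD d c F G : conv d c (fun i j => F i j + G i j) = conv d c F + conv d c G.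
Proof. by rewrite /conv -big_split /=; apply: eq_bigr => j _; rewrite mulrDr. Qed.

Lemma convDl d c c' F : conv d (fun i j => c i j + c' i j) F = conv d c F + conv d c' F.
Proof. by rewrite /conv -big_split /=; apply: eq_bigr => j _; rewrite mulrDl. Qed.

Lemma conv_ext d c F G : (forall i j, (i + j = d)%N -> F i j = G i j) -> conv d c F = conv d c G.
Proof. by move=> h; apply: eq_big_nat => j jd; rewrite h //; lia. Qed.

Lemma conv_shift d c F e1 e2 :
  conv d c (fun i j => if (e1 <= i)%N && (e2 <= j)%N then F (i - e1)%N (j - e2)%N else 0) =
  if (e1 + e2 <= d)%N then conv (d - (e1 + e2)) (fun i j => c (i + e1)%N (j + e2)%N) F else 0.
Proof.
rewrite /conv; case: ifP => h; last first.
  by rewrite big_nat big1 // => j jd; rewrite ifF ?mulr0 //; lia.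
rewrite (big_cat_nat (n := e2)) //=; last by lia.
rewrite [X in X + _]big_nat big1 ?add0r => [|j jd]; last by rewrite ifF ?mulr0 //; lia.
rewrite (big_cat_nat (n := (d - e1).+1)) //=; try by lia.
rewrite [X in _ + X]big_nat [X in _ + X]big1 ?addr0 => [|j jd]; last first.
  by rewrite ifF ?mulr0 //; lia.
rewrite -{1}[e2]add0n big_addn.
have -> : ((d - e1).+1 - e2 = (d - (e1 + e2)).+1)%N by lia.
apply: eq_big_nat => j jd; rewrite ifT; last by lia.
by congr (c _ _ * F _ _); lia.
Qed.

(** Induction on the number of variables. The exponent 2^(b+1) of the first variable comes from
    itself, from 2^b by a square in one of the two places, or from 2^(b-1) by squares in both. The
    last two cases shift c by s^(2^b) + t^(2^b) and by (s^2 t)^(2^(b-1)), which preserve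
    [annihilates]. *)
Lemma sqW_annihilates c : annihilates c ->
  forall d f w, conv d c (fun i j => sqW i (sqW j f) w) = 0.
Proof.
move=> Hc d f w; elim: w c Hc d f => [|a w IH] c Hc d f.
  have [d0|d0] := posnP d.
    by rewrite d0 /conv big_nat1 /=; have := Hc 0%N 0%N; rewrite big_nat1 /= mulr1 => ->; rewrite mul0r.
  rewrite /conv big_nat big1 // => j jd /=; case: eqP => [e|]; last by rewrite mulr0.
  by rewrite ifF ?mulr0 //; apply/eqP; lia.
pose F b v := f (b :: v).
case: a => [|b].
  rewrite -[RHS](IH c Hc d (F 0%N)); apply: conv_ext => i j _ /=; rewrite addr0.
  by congr sqW; apply: functional_extensionality_dep => v /=; rewrite addr0.
transitivity (conv d c (fun i j => sqW i (sqW j (F b.+1)) w) +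
  (conv d c (fun i j => if (0 <= i)%N && (2 ^ b <= j)%N then sqW (i - 0) (sqW (j - 2 ^ b) (F b)) w else 0) +
   conv d c (fun i j => if (2 ^ b <= i)%N && (0 <= j)%N then sqW (i - 2 ^ b) (sqW (j - 0) (F b)) w else 0)) +
  (if b is b'.+1 then conv d c (fun i j => if (2 ^ b <= i)%N && (2 ^ b' <= j)%N then
      sqW (i - 2 ^ b) (sqW (j - 2 ^ b') (F b')) w else 0) else 0)).
  transitivity (conv d c (fun i j => sqW i (sqW j (F b.+1)) w +
    ((if (0 <= i)%N && (2 ^ b <= j)%N then sqW (i - 0) (sqW (j - 2 ^ b) (F b)) w else 0) +
     (if (2 ^ b <= i)%N && (0 <= j)%N then sqW (i - 2 ^ b) (sqW (j - 0) (F b)) w else 0)) +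
    (if b is b'.+1 then if (2 ^ b <= i)%N && (2 ^ b' <= j)%N then
       sqW (i - 2 ^ b) (sqW (j - 2 ^ b') (F b')) w else 0 else 0))).
    apply: conv_ext => i j _ /=; rewrite !subn0 andbT.
    have -> : sqW i (fun v => sqW j f (b.+1 :: v)) w = sqW i (sqW j (F b.+1)) w +
       (if (2 ^ b <= j)%N then sqW i (sqW (j - 2 ^ b) (F b)) w else 0).
      by rewrite /= sqWD; congr (_ + _); case: ifP => _ //; apply: sqW0.
    rewrite -!addrA; congr (_ + (_ + _)).
    case: ifP => _; last by case: (b) => [|b']; rewrite addr0.
    rewrite /= sqWD; congr (_ + _); case: (b) => [|b']; first exact: sqW0.
    by case: ifP => _ //=; apply: sqW0.
  rewrite !convD; congr (_ + _ + _); case: (b) => [|b'] //.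
  by rewrite /conv big1 // => j _; rewrite mulr0.
rewrite IH // add0r.
have -> : conv d c (fun i j => if (0 <= i)%N && (2 ^ b <= j)%N then sqW (i - 0) (sqW (j - 2 ^ b) (F b)) w else 0) +
   conv d c (fun i j => if (2 ^ b <= i)%N && (0 <= j)%N then sqW (i - 2 ^ b) (sqW (j - 0) (F b)) w else 0) = 0.
  rewrite (conv_shift d c (fun i j => sqW i (sqW j (F b)) w) 0 (2 ^ b)).
  rewrite (conv_shift d c (fun i j => sqW i (sqW j (F b)) w) (2 ^ b) 0).
  rewrite add0n addn0; case: ifP => _; last exact: addr0.
  rewrite -convDl -[RHS](IH _ (annihilates_exp b Hc) (d - 2 ^ b)%N (F b)) /conv.
  by apply: eq_bigr => j _; rewrite !addn0 addrC.
rewrite add0r; case: b => // b'.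
rewrite (conv_shift d c (fun i j => sqW i (sqW j (F b')) w) (2 ^ b'.+1) (2 ^ b')).
case: ifP => _ //.
rewrite -[RHS](IH _ (annihilates_mul (2 ^ b') Hc) (d - (2 ^ b'.+1 + 2 ^ b'))%N (F b')).
by rewrite /conv; apply: eq_bigr => j _; rewrite expnS.
Qed.

Definition wt (w : seq nat) : nat := \sum_(a <- w) 2 ^ a.

Lemma wt_cons a w : wt (a :: w) = (2 ^ a + wt w)%N. Proof. by rewrite /wt big_cons. Qed.
Lemma wt_nil : wt [::] = 0%N. Proof. by rewrite /wt big_nil. Qed.

Definition supp (d : nat) (f : Wt) := forall w, wt w != d -> f w = 0.

Lemma supp_tail d f a : supp d f -> (2 ^ a <= d)%N -> supp (d - 2 ^ a) (fun w => f (a :: w)).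
Proof. by move=> h ad w wd; apply: h; rewrite wt_cons; apply: contra wd => /eqP <-; rewrite addKn. Qed.

Lemma supp_tail0 d f a : supp d f -> (d < 2 ^ a)%N -> forall w, f (a :: w) = 0.
Proof. by move=> h ad w; apply: h; rewrite wt_cons; lia. Qed.

Lemma sqW_eq0 i f w : (forall v, f v = 0) -> sqW i f w = 0.
Proof.
by move=> h; rewrite -[RHS](sqW0 i w); congr sqW; apply: functional_extensionality_dep.
Qed.

Lemma supp_sqW d i f : supp d f -> supp (d + i) (sqW i f).
Proof.
move=> + w; elim: w d i f => [|a w IH] d i f hf.
  rewrite wt_nil /= => h; have [i0|//] := eqVneq i 0%N.
  by apply: hf; rewrite wt_nil; lia.
rewrite wt_cons /= => h.
rewrite [X in X + _](_ : _ = 0) ?add0r.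
  case: a h => // b h; case: ifP => // bi.
  have [bd|db] := leqP (2 ^ b) d; last by apply/sqW_eq0/(supp_tail0 hf).
  apply: (IH _ _ _ (supp_tail hf bd)); apply: contra h => /eqP ->; rewrite expnS.
  by apply/eqP; lia.
have [ad|da] := leqP (2 ^ a) d; last by apply/sqW_eq0/(supp_tail0 hf).
apply: (IH _ _ _ (supp_tail hf ad)); apply: contra h => /eqP ->; apply/eqP; lia.
Qed.

Lemma sqW_unstable d i f w : supp d f -> (d < i)%N -> sqW i f w = 0.
Proof.
elim: w d i f => [|a w IH] d i f hf di; first by rewrite /= ifF //; lia.
rewrite /= [X in X + _](_ : _ = 0) ?add0r.
  case: a => // b; case: ifP => // bi.
  have [bd|db] := leqP (2 ^ b) d; last by apply/sqW_eq0/(supp_tail0 hf).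
  by apply: (IH _ _ _ (supp_tail hf bd)); lia.
have [ad|da] := leqP (2 ^ a) d; last by apply/sqW_eq0/(supp_tail0 hf).
by apply: (IH _ _ _ (supp_tail hf ad)); lia.
Qed.

(** The top square is the Frobenius, which replaces each exponent 2^a by 2^(a+1). *)
Lemma sqW_top d f w : supp d f -> sqW d f (map S w) = f w.
Proof.
elim: w d f => [|a w IH] d f hf.
  by rewrite /=; case: eqP => // d0; rewrite hf // wt_nil; lia.
rewrite /= [X in X + _](_ : _ = 0) ?add0r.
  case: ifP => ad; first by rewrite (IH _ _ (supp_tail hf ad)).
  by rewrite (supp_tail0 hf) //; lia.
have [ad|da] := leqP (2 ^ a.+1) d; last by apply/sqW_eq0/(supp_tail0 hf).
apply: (sqW_unstable _ (supp_tail hf ad)).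
by have := expn_gt0 2 a.+1; lia.
Qed.

Definition restr0W (r : nat) (f : Wt) : Wt := fun w => f (nseq r 0%N ++ w).

(** [restr0W] takes the cofactor of x_1 ... x_r. An exponent 1 arises only from an exponent 1, with
    no square spent on that variable. *)
Lemma restr0W_sq r i f w : restr0W r (sqW i f) w = sqW i (restr0W r f) w.
Proof. elim: r f => // r IH f; have := IH (fun v => f (0%N :: v)).
by rewrite /restr0W /= addr0. Qed.

Lemma supp_restr0 d r f : supp d f -> (r <= d)%N -> supp (d - r) (restr0W r f).
Proof.
move=> hf rd w wd; apply: hf; rewrite /wt big_cat /= big_nseq iter_addn addn0 mul1n.
by apply: contra wd => /eqP <-; rewrite addKn.
Qed.

Lemma restr0_lt d r f w : supp d f -> (d < r)%N -> restr0W r f w = 0.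
Proof.
by move=> hf dr; rewrite /restr0W; apply: hf; rewrite /wt big_cat /= big_nseq iter_addn addn0 mul1n; lia.
Qed.

(** * The action of the Steenrod algebra *)

Definition sqop (i : nat) (f : Wt) : Wt := sqW i f.

Lemma sqopB i : zmod_morphism (sqop i).
Proof. by move=> f g; apply: functional_extensionality_dep => w; apply: sqWB. Qed.

Lemma sqop_rel r f : steenrod_rel r -> fact sqop r f = 0.
Proof.
case=> [|i j i0 ij].
  rewrite (factBl Wt2) fact_var fact1; apply/eqP; rewrite subr_eq0; apply/eqP.
  by apply: functional_extensionality_dep => w; apply: sqW_Sq0.
rewrite (factBl Wt2) (factM Wt2 sqopB) !fact_var (fact_suml Wt2).
apply/eqP; rewrite subr_eq0; apply/eqP.
under [RHS]eq_bigr => t _ do rewrite (factMnl Wt2) (factM Wt2 sqopB) !fact_var.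
apply: functional_extensionality_dep => w.
have -> : (\sum_(0 <= t < (i %/ 2).+1)
   sqop (i + j - t)%N (sqop t f) *+ 'C(j - t - 1, i - 2 * t)) w =
   \sum_(0 <= t < (i %/ 2).+1)
   'C(j - t - 1, i - 2 * t)%:R * sqW (i + j - t)%N (sqW t f) w.
  elim: (index_iota _ _) => [|t s IH]; first by rewrite !big_nil.
  rewrite !big_cons -IH -[LHS]/(_ + _); congr (_ + _); rewrite mulr_natl.
  by elim: 'C(_, _) => // n IHn; rewrite !mulrS -IHn.
have := sqW_annihilates (adem_annihilates ij) (i + j)%N f w.
rewrite /conv (eq_big_nat _ _ (F2 := fun t => (t == j)%:R * sqW (i + j - t) (sqW t f) w +
   adem_coef j i t * sqW (i + j - t) (sqW t f) w)); last first.
  by move=> t td; rewrite /adem_c ifT ?mulrDl //; lia.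
rewrite big_split /= => /(exp2_eq exp2_F2) e.
transitivity (\sum_(0 <= t < (i + j).+1) (t == j)%:R * sqW (i + j - t) (sqW t f) w).
  rewrite (big_cat_nat (n := j)) //=; last by lia.
  rewrite [X in X + _]big_nat big1 ?add0r => [|t tj]; last by case: eqP => [?|_]; [lia|rewrite mul0r].
  rewrite big_ltn; last by lia.
  rewrite eqxx mul1r addnK big_nat big1 ?addr0 // => t tj.
  by case: eqP => [?|_]; [lia|rewrite mul0r].
rewrite e (big_cat_nat (n := (i %/ 2).+1)) //=; last by lia.
rewrite [X in _ + X]big_nat [X in _ + X]big1 ?addr0 => [|t tj]; last first.
  by rewrite /adem_coef ifF ?mul0r //; lia.
by apply: eq_big_nat => t ti; rewrite /adem_coef ifT //; lia.
Qed.

Definition stact (x : steenrod) (f : Wt) : Wt := fact sqop (repr x) f.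

Lemma fact_steenrod_ideal x f : ideal steenrod_rel x -> fact sqop x f = 0.
Proof.
move=> hx; apply: (fact_ideal Wt2 sqopB (A := fun=> True)) hx _ => //.
by move=> r v hr _; apply: sqop_rel.
Qed.

Lemma stact_cl g f : stact (rcl steenrod_rel g) f = fact sqop g f.
Proof.
apply/eqP; rewrite -subr_eq0 -(factBl Wt2) fact_steenrod_ideal //.
exact: (repr_cl (ideal steenrod_rel) g).
Qed.

Lemma stactB x y f : stact (x - y) f = stact x f - stact y f.
Proof.
rewrite -[x]rclK -[y]rclK -[_ - _](raddfB (rcl steenrod_rel)) !stact_cl.
exact: (factBl Wt2).
Qed.

Lemma stactBr x : zmod_morphism (stact x).
Proof. exact: (factBr sqopB). Qed.

Lemma stactM x y f : stact (x * y) f = stact x (stact y f).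
Proof.
rewrite -[x]rclK -[y]rclK -[_ * _](rmorphM (rcl steenrod_rel)) !stact_cl.
exact: (factM Wt2 sqopB).
Qed.

Lemma stact1 f : stact 1 f = f.
Proof. by rewrite -[1](rmorph1 (rcl steenrod_rel)) stact_cl fact1. Qed.

Lemma stact0 f : stact 0 f = 0.
Proof. by have := stactB 0 0 f; rewrite !subrr. Qed.

Lemma stact_Sq i f : stact (Sq i) f = sqop i f.
Proof. by rewrite /Sq stact_cl fact_var. Qed.

Definition suppZ (a : int) (f : Wt) := forall w, (wt w)%:Z != a -> f w = 0.

Lemma suppZE d f : suppZ d%:Z f <-> supp d f.
Proof. by split=> h w wd; apply: h. Qed.

Lemma suppZ_lt0 a f : a < 0 -> suppZ a f -> f = 0.
Proof.
move=> a0 h; apply: functional_extensionality_dep => w; apply: h.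
by apply: contraTneq a0 => <-.
Qed.

Lemma suppZ_stact n x a f : steenrod_deg n x -> suppZ a f -> suppZ (a + n) (stact x f).
Proof.
elim=> {x} [_ [v [<- ->]]||x y _ IHx _ IHy]; last 2 first.
- by move=> _ w _; rewrite stact0.
- by move=> hf w wn; rewrite stactB -[LHS]/(_ - _) IHx // IHy // subr0.
case: a => [d|d]; last first.
  move=> h; have -> : f = 0 by apply: suppZ_lt0 h.
  by move=> w _; rewrite (zmorph0 (stactBr _)).
elim: v => [|i v IH] hf.
  by rewrite big_nil stact1 addr0.
rewrite big_cons stactM stact_Sq /=.
have {}IH := IH hf; rewrite -PoszD in IH; move/suppZE: IH => /(supp_sqW (i := i)).
by rewrite -PoszD => h; apply/suppZE; rewrite addnCA addnC.
Qed.

Definition iotaW (a : int) : Wt :=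
  if a is Posz n then fun w => (w == nseq n 0%N)%:R else 0.

Lemma wt_nseq0 n : wt (nseq n 0%N) = n.
Proof. by rewrite /wt big_nseq iter_addn addn0 mul1n. Qed.

Lemma suppZ_iota a : suppZ a (iotaW a).
Proof.
case: a => [n|n] w wn //=; case: eqP => // e.
by move: wn; rewrite e wt_nseq0 eqxx.
Qed.

Lemma unstable_act a b (f : @rhom ringoidA a b) g :
  rideal unstable_rel a b f -> suppZ a g -> stact (val f) g = 0.
Proof.
move=> fI; elim: fI g => {a b f} [a b _ [i n ni] h ah|a b h _|a b f g _ hf _ hg h ah|].
- rewrite SqAE // stact_Sq; case: n ni ah => [d|d] ni ah; last first.
    have -> : h = 0 by apply: suppZ_lt0 ah.
    exact: zmorph0 (sqopB i).
  by apply: functional_extensionality_dep => w; apply: (sqW_unstable w (proj1 (suppZE _ _) ah)).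
- exact: stact0.
- by rewrite raddfB stactB hf // hg // subrr.
move=> a b c d p f q _ hf h ah; rewrite [val _]/=.
rewrite stactM stactM hf; first exact: zmorph0 (stactBr _).
have := suppZ_stact (subP q) ah; rewrite addrC subrK; exact.
Qed.

Definition actQ (a b : int) (h : @rhom ringoidQ a b) (g : Wt) : Wt :=
  stact (val (repr h)) g.

Lemma actQ_cl a b (f : @rhom ringoidA a b) g : suppZ a g ->
  actQ (clQ f) g = stact (val f) g.
Proof.
move=> ag; apply/eqP; rewrite -subr_eq0 -stactB -raddfB; apply/eqP.
by apply: unstable_act ag; apply: (repr_cl (rideal unstable_rel a b) f).
Qed.

Lemma actQB a b (h h' : @rhom ringoidQ a b) g : suppZ a g ->
  actQ (h - h') g = actQ h g - actQ h' g.
Proof.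
move=> ag; have -> : h - h' = clQ (repr h - repr h').
  by rewrite /clQ raddfB /= !cl_repr.
by rewrite actQ_cl // raddfB stactB.
Qed.

Lemma actQM a b c (h : @rhom ringoidQ b c) (f : @rhom ringoidQ a b) g : suppZ a g ->
  actQ (rcomp h f) g = actQ h (actQ f g).
Proof.
move=> ag; rewrite -[rcomp h f]/(clQ (rcomp (repr h) (repr f))) actQ_cl //.
exact: stactM.
Qed.

Lemma actQ1 a g : suppZ a g -> actQ (@rid ringoidQ a) g = g.
Proof.
move=> ag; rewrite -[@rid ringoidQ a]/(clQ (@rid ringoidA a)) actQ_cl //.
exact: stact1.
Qed.

Lemma suppZ_actQ a b (h : @rhom ringoidQ a b) g : suppZ a g -> suppZ b (actQ h g).
Proof.
by move=> ag; have := suppZ_stact (subP (repr h)) ag; rewrite addrC subrK.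
Qed.

Lemma actQ_Sq i a b g : b = a + i%:Z -> suppZ a g -> actQ (clQ (SqA i a b)) g = sqop i g.
Proof. by move=> e ag; rewrite actQ_cl // SqAE // stact_Sq. Qed.

(** * Modules over Q_k *)

Lemma clQ_unstable i (a b : int) : b = a + i%:Z -> a < i%:Z -> clQ (SqA i a b) = 0.
Proof.
move=> -> ai; rewrite /clQ -(raddf0 (cl _)); apply/cl_eq; rewrite subr0.
by apply: rideal_in; apply: UnstableRel.
Qed.

Lemma steenrod_Sq0 : Sq 0 = 1.
Proof.
exact: ((cl_eq (ideal steenrod_rel) (fvar 0) 1).2 (ideal_in steenrod_sq0)).
Qed.

Lemma steenrod2 : exp2 steenrod.
Proof.
move=> u; rewrite -[u]rclK -[_ + _](raddfD (rcl steenrod_rel)).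
have -> : repr u + repr u = 0 :> free_alg; last exact: raddf0.
by apply/malgP => i; rewrite mcoeffD mcoeff0 exp2_F2.
Qed.

Section Modules.
Variables (k : nat) (M : rmodule (Qk k)).

Lemma actD a b (f g : @rhom (Qk k) a b) (x : M a) : act M (f + g) x = act M f x + act M g x.
Proof.
have f0 : act M (0 : @rhom (Qk k) a b) x = 0 by have := actBl (0 : @rhom (Qk k) a b) 0 x; rewrite !subrr.
have fN : act M (- g) x = - act M g x by rewrite -sub0r actBl f0 sub0r.
by rewrite -[g in LHS]opprK actBl fN opprK.
Qed.

Lemma act_zero a b (x : M a) : act M (0 : @rhom (Qk k) a b) x = 0.
Proof. by have := actBl (0 : @rhom (Qk k) a b) 0 x; rewrite !subrr. Qed.

Lemma act_sum a b (I : Type) (r : seq I) (F : I -> @rhom (Qk k) a b) (x : M a) :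
  act M (\sum_(i <- r) F i) x = \sum_(i <- r) act M (F i) x.
Proof.
elim: r => [|i r IH]; first by rewrite !big_nil act_zero.
by rewrite !big_cons actD IH.
Qed.

Lemma act_Mn a b n (f : @rhom (Qk k) a b) (x : M a) : act M (f *+ n) x = act M f x *+ n.
Proof. by elim: n => [|n IH]; rewrite ?mulr0n ?act_zero // !mulrS actD IH. Qed.

Lemma act_arg0 a b (f : @rhom (Qk k) a b) : act M f 0 = 0.
Proof. by have := actBr f (0 : M a) 0; rewrite !subrr. Qed.

(** The identity is Sq^0, which is an unstable relation in negative degrees. *)
Lemma Qk_id_neg (a : int) : a < 0 -> @rid (Qk k) a = 0.
Proof.
move=> a0; apply: val_inj; rewrite [LHS]/=.
have <- : clQ (SqA 0 a a) = cl (rideal unstable_rel a a) (@rid ringoidA a).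
  by congr (cl _ _); apply: val_inj; rewrite SqAE ?addr0 // steenrod_Sq0.
exact: clQ_unstable (esym (addr0 a)) a0.
Qed.

Lemma module_neg (a : int) (x : M a) : a < 0 -> x = 0.
Proof. by move=> a0; rewrite -[x]act_id Qk_id_neg // act_zero. Qed.

Lemma module2 (a : int) (x : M a) : x + x = 0.
Proof.
rewrite -[x]act_id -actD (_ : _ + _ = 0) ?act_zero //.
apply: val_inj; rewrite [LHS]/=.
rewrite -(raddfD (cl (rideal unstable_rel a a))) (_ : _ + _ = 0) ?raddf0 //.
by apply: val_inj; apply: steenrod2.
Qed.

End Modules.

Lemma Sq_adem i j : (0 < i)%N -> (i < 2 * j)%N -> Sq i * Sq j =
  \sum_(0 <= t < (i %/ 2).+1) (Sq (i + j - t) * Sq t) *+ 'C(j - t - 1, i - 2 * t).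
Proof.
move=> i0 ij.
have e := (cl_eq (ideal steenrod_rel) (fvar i * fvar j)
  (\sum_(0 <= t < (i %/ 2).+1) (fvar (i + j - t)%N * fvar t) *+ 'C(j - t - 1, i - 2 * t))).2
  (ideal_in (steenrod_adem i0 ij)).
transitivity (rcl steenrod_rel (fvar i * fvar j)); first exact: (esym (rmorphM _ _ _)).
transitivity (rcl steenrod_rel (\sum_(0 <= t < (i %/ 2).+1)
   (fvar (i + j - t)%N * fvar t) *+ 'C(j - t - 1, i - 2 * t))); first exact: e.
apply: (etrans (raddf_sum (rcl steenrod_rel) _ _ _)); apply: eq_bigr => t _.
by rewrite raddfMn /= rmorphM.
Qed.

Lemma SqA_comp i j (a b c : int) : b = a + j%:Z -> c = b + i%:Z ->
  val (rcomp (SqA i b c) (SqA j a b)) = Sq i * Sq j.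
Proof. by move=> eb ec; rewrite /= !SqAE. Qed.

(** The term t = 0 is written as the single square Sq^(p+q), so that only squares of positive
    exponent occur in the sum. *)
Lemma adem_Q (q p : nat) (a b c : int) : b = a + p%:Z -> c = b + q%:Z ->
  (0 < q)%N -> (q < 2 * p)%N ->
  @rcomp ringoidQ _ _ _ (clQ (SqA q b c)) (clQ (SqA p a b)) =
  \sum_(0 <= t < (q %/ 2).+1)
    (if t == 0%N then clQ (SqA (p + q) a c) else
     @rcomp ringoidQ _ _ _ (clQ (SqA (p + q - t) (a + t%:Z) c)) (clQ (SqA t a (a + t%:Z))))
    *+ 'C(p - t - 1, q - 2 * t).
Proof.
move=> eb ec q0 qp.
have cc (d : int) i j : @rcomp ringoidQ _ _ _ (clQ (SqA i d c)) (clQ (SqA j a d)) =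
    clQ (rcomp (SqA i d c) (SqA j a d)) by apply: (esym (cl_comp _ _ _)).
rewrite cc.
transitivity (clQ (\sum_(0 <= t < (q %/ 2).+1)
    (if t == 0%N then SqA (p + q) a c else
     rcomp (SqA (p + q - t) (a + t%:Z) c) (SqA t a (a + t%:Z))) *+ 'C(p - t - 1, q - 2 * t))).
  congr clQ; apply: val_inj; rewrite SqA_comp // raddf_sum Sq_adem // [(q + p)%N]addnC.
  apply: eq_big_nat => t tq; rewrite raddfMn; congr (_ *+ _).
  case: eqP => [->|t0].
    rewrite subn0 steenrod_Sq0 mulr1; apply/esym; apply: SqAE.
    by rewrite ec eb PoszD -addrA.
  apply/esym; apply: SqA_comp => //; rewrite ec eb; lia.
rewrite /clQ raddf_sum; apply: eq_bigr => t _; rewrite raddfMn; congr (_ *+ _).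
by case: eqP => // _; rewrite cc.
Qed.

Section ModuleOps.
Variables (k : nat) (M : rmodule (Qk k)).

(** The target degree is an argument of its own, so that equalities of degrees become arithmetic
    side conditions instead of casts. *)
Definition msq (i m n : nat) (y : M m%:Z) : M n%:Z :=
  if [&& (0 < i)%N, (i <= m)%N, (m < i + k)%N & (m + i == n)%N]
  then act M (SqQk k i m%:Z n%:Z) y else 0.

Lemma msqB i m n : zmod_morphism (@msq i m n).
Proof. by move=> x y; rewrite /msq; case: ifP => _; rewrite ?subr0 //; apply: actBr. Qed.

Lemma msqE i m n y : (0 < i)%N -> (i <= m)%N -> (m < i + k)%N -> n = (m + i)%N ->
  @msq i m n y = act M (SqQk k i m%:Z n%:Z) y.
Proof. by move=> h1 h2 h3 ->; rewrite /msq h1 h2 h3 eqxx. Qed.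

Lemma msq_eq0 i m n y : (m < i)%N -> @msq i m n y = 0.
Proof. by move=> mi; rewrite /msq ifF //; lia. Qed.

(* Up to instability, [msq] is the action of Sq^i. *)
Lemma act_msq i m n y : (0 < i)%N -> (m < i + k)%N -> n = (m + i)%N ->
  act M (SqQk k i m%:Z n%:Z) y = @msq i m n y.
Proof.
move=> i0 mik e; have [im|mi] := leqP i m; first by rewrite msqE.
rewrite msq_eq0 // [SqQk _ _ _ _](_ : _ = 0) ?act_zero //.
by apply: val_inj; rewrite SqQkE; [apply: clQ_unstable; lia|lia|lia].
Qed.

(** If Sq^q has lower index below k after Sq^p, then so have all squares with nonzero coefficient on
    the right; the Adem relation thus lives in Q_k. *)
Lemma adem_msq n p q (y : M n%:Z) : (0 < p <= n)%N -> (0 < q < 2 * p)%N -> (n + p < q + k)%N ->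
  @msq q (n + p) (n + p + q) (@msq p n (n + p) y) =
  @msq (p + q) n (n + p + q) y *+ 'C(p - 1, q) +
  \sum_(1 <= t < (q %/ 2).+1)
    @msq (p + q - t) (n + t) (n + p + q) (@msq t n (n + t) y) *+ 'C(p - t - 1, q - 2 * t).
Proof.
move=> /andP[p0 pn] /andP[q0 qp] nk.
rewrite [LHS]msqE; [|lia|lia|lia|lia]; rewrite msqE; [|lia|lia|lia|lia].
rewrite -act_comp.
pose X t : @rhom (Qk k) n%:Z (n + p + q)%N%:Z :=
  if t == 0%N then SqQk k (p + q) n%:Z (n + p + q)%N%:Z else
  rcomp (SqQk k (p + q - t) (n + t)%N%:Z (n + p + q)%N%:Z) (SqQk k t n%:Z (n + t)%N%:Z).
have -> : rcomp (SqQk k q (n + p)%N%:Z (n + p + q)%N%:Z) (SqQk k p n%:Z (n + p)%N%:Z) =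
   \sum_(0 <= t < (q %/ 2).+1) X t *+ 'C(p - t - 1, q - 2 * t).
  apply: val_inj; rewrite raddf_sum [LHS]/=.
  rewrite SqQkE; [|lia|lia]; rewrite SqQkE; [|lia|lia].
  have := @adem_Q q p n%:Z (n + p)%N%:Z (n + p + q)%N%:Z.
  rewrite -[qcomp _ _]/(@rcomp ringoidQ _ _ _ _ _) => ->; [|lia|lia|lia|lia].
  apply: eq_big_nat => t tq; rewrite raddfMn /=.
  have [->|b0] := eqVneq 'C(p - t - 1, q - 2 * t) 0%N; first by rewrite !mulr0n.
  (* Hence q - t < p, and the inner lower index n - t is below n + p - q < k. The outer one, n + 2t
     - p - q, is at most n - p since 2t <= q. *)
  have {}b0 : (q - 2 * t <= p - t - 1)%N by rewrite -bin_gt0 lt0n.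
  congr (_ *+ _); rewrite /X; case: eqP => [t0|t0].
    by rewrite SqQkE; [congr (clQ (SqA _ _ _)); lia|lia|lia].
  have t1 : (0 < t)%N by lia.
  rewrite [RHS]/= SqQkE; [|lia|lia]; rewrite SqQkE; [|lia|lia].
  by rewrite -PoszD.
rewrite act_sum big_ltn // act_Mn subn0 muln0 subn0 /X eqxx; congr (_ *+ _ + _).
  by apply: act_msq; lia.
apply: eq_big_nat => t tq; rewrite act_Mn.
have [->|b0] := eqVneq 'C(p - t - 1, q - 2 * t) 0%N; first by rewrite !mulr0n.
have {}b0 : (q - 2 * t <= p - t - 1)%N by rewrite -bin_gt0 lt0n.
rewrite ifF; last by lia.
rewrite act_comp; congr (_ *+ _); rewrite act_msq; [|lia|lia|lia].
by rewrite act_msq; [|lia|lia|lia].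
Qed.

Definition Dec (r : nat) (n : nat) : subgroup (M n%:Z) :=
  gen (fun x => exists i m (z : M m%:Z), [/\ (0 < i <= m)%N, (m < i + r)%N,
     (m + i = n)%N & x = @msq i m n z]).

Lemma Dec_in r i m n z : (0 < i <= m)%N -> (m < i + r)%N -> (m + i = n)%N ->
  Dec r n (@msq i m n z).
Proof. by move=> h1 h2 h3; apply: gen_in; exists i, m, z. Qed.

(* Adem: Sq_a Sq_b with b < a is a sum of Sq_c Sq_d with c <= b. *)
Lemma Dec_sq r q m n x : (r <= k)%N -> (0 < q <= m)%N -> (q + r <= m)%N -> (m + q = n)%N ->
  Dec r m x -> Dec r n (@msq q m n x).
Proof.
move=> rk /andP[q0 qm] qr mqn; apply: (gen_preim (@msqB q m n)) => _ [p [l [z [pl lr lm ->]]]].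
subst m; subst n.
have [qk|kq] := ltnP (l + p) (q + k); last first.
  by rewrite /msq ifF; [apply: sg_mem0|lia].
rewrite adem_msq; [|lia|lia|lia].
apply: sg_memD.
  by apply: sg_Mn => b0; have [?|?] := leqP (p + q) l;
    [apply: Dec_in; lia|rewrite msq_eq0 //; apply: sg_mem0].
apply: sg_sum => t; rewrite mem_index_iota => tq; apply: sg_Mn => b0.
have [?|?] := leqP (p + q - t) (l + t); last by rewrite msq_eq0 //; apply: sg_mem0.
by apply: Dec_in; lia.
Qed.

End ModuleOps.

(** * Morphisms of Q_k modulo decomposables *)

Section Decomposition.
Variables (k : nat) (M : rmodule (Qk k)).

Definition DecZ (c : int) : subgroup (M c) :=
  gen (fun x => exists i m (z : M m%:Z), [/\ (0 < i <= m)%N, (m < i + k)%N,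
     (m + i)%N%:Z = c & x = act M (SqQk k i m%:Z c) z]).

Lemma DecZ_Dec n x : DecZ n%:Z x -> Dec M k n x.
Proof.
apply: gen_mono => y [i [m [z [h1 h2 [h3] ->]]]]; exists i, m, z; split=> //.
by rewrite msqE //; lia.
Qed.

Definition tr (b c : int) (y : M b) : M c :=
  if pselect (b = c) is left e then eq_rect b (fun a : int => M a : Type) y c e else 0.

Lemma tr_id b y : tr b y = y.
Proof. by rewrite /tr; case: pselect => // e; rewrite (Prop_irrelevance e erefl). Qed.

Lemma trB b c : zmod_morphism (@tr b c).
Proof. by move=> x y; rewrite /tr; case: pselect => [e|_]; [case: _ / e|rewrite subr0]. Qed.

Lemma tr_DecZ b c y : DecZ b y -> DecZ c (tr c y).
Proof.
by rewrite /tr; case: pselect => [e|_ _]; [case: _ / e|exact: sg_mem0].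
Qed.

(* Modulo decomposables, a morphism of Q_k acts by its augmentation. *)
Definition acts_by_aug b c (f : @rhom ringoidQ b c) := forall g : @rhom (Qk k) b c,
  val g = f -> forall y : M b, DecZ c (act M g y - scF (augQ f) (tr c y)).

Lemma acts_neg b c (f : @rhom ringoidQ b c) : (b : int) < 0 -> acts_by_aug f.
Proof.
move=> b0 g _ y; rewrite (module_neg y b0) act_arg0 (zmorph0 (@trB b c)) scFr0 subr0.
exact: sg_mem0.
Qed.

Lemma acts_gen i (n c : int) : c = n + i%:Z -> n - i%:Z < k%:Z ->
  acts_by_aug (clQ (SqA i n c)).
Proof.
move=> ec nik; case: n ec nik => [m|m] ec nik; last exact: acts_neg.
move=> g gE y.
have [i0|i0] := posnP i.
  subst i; have ec' : c = m%:Z by rewrite ec addr0.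
  clear ec; subst c; rewrite tr_id.
  have -> : g = rid _.
    apply: val_inj; rewrite gE [RHS]/=; congr clQ.
    apply: val_inj; transitivity (Sq 0); last exact: steenrod_Sq0.
    by apply: SqAE; rewrite addr0.
  have -> : augQ (clQ (SqA 0 m%:Z m%:Z)) = 1.
    by rewrite augQ_cl // SqAE ?addr0 // steenrod_Sq0 aug1.
  by rewrite act_id scF1 subrr; apply: sg_mem0.
have gS : g = SqQk k i m%:Z c by apply: val_inj; rewrite gE SqQkE.
rewrite augQ_deg; last by rewrite ec; lia.
rewrite scF0 subr0.
have [im|mi] := leqP i m.
  by rewrite gS; apply: gen_in; exists i, m, y; split=> //; lia.
have -> : g = 0 by apply: val_inj; rewrite gE; apply: clQ_unstable.
by rewrite act_zero; apply: sg_mem0.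
Qed.

Lemma subrACA (V : zmodType) (a b s t : V) : (a - b) - (s - t) = (a - s) - (b - t).
Proof. by rewrite !opprB [t - s]addrC [t - b]addrC !addrA -!addrA [- b + _]addrCA. Qed.

(** Generators of positive exponent land in decomposables, and Sq^0 is the identity. Composites
    inherit the property because the augmentation is multiplicative and vanishes between different
    degrees. *)
Lemma acts_all b c (f : @rhom ringoidQ b c) : subringoid_mem (@Qk_gen k) f -> acts_by_aug f.
Proof.
elim=> {b c f} [b c _ [i n nik]|a|b c|b c f f' mf IHf mf' IHf'|a b c f g mf IHf mg IHg].
- exact: acts_gen.
- have [a0|a0] := ltP (a : int) 0; first exact: acts_neg.
  move=> g gE y; have -> : g = rid _ by apply: val_inj.
  by rewrite augQ1 // act_id tr_id scF1 subrr; apply: sg_mem0.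
- have [b0|b0] := ltP (b : int) 0; first exact: acts_neg.
  move=> g gE y; have -> : g = 0 by apply: val_inj.
  have -> : augQ (0 : @rhom ringoidQ b c) = 0.
    by have := augQB (0 : @rhom ringoidQ b c) 0 b0; rewrite !subrr.
  by rewrite act_zero scF0 subr0; apply: sg_mem0.
- have [b0|b0] := ltP (b : int) 0; first exact: acts_neg.
  move=> g gE y; have -> : g = (mksub (P := subringoid_sg (@Qk_gen k) b c) mf : @rhom (Qk k) b c) -
      mksub (P := subringoid_sg (@Qk_gen k) b c) mf' by apply: val_inj; rewrite gE.
  rewrite actBl augQB //; set y' := tr _ _.
  have M2 : exp2 (M c) by exact: module2.
  rewrite (exp2B exp2_F2) (scFDl M2) -(exp2B M2 (scF _ _)) subrACA.
  apply: sg_memB; [apply: IHf|apply: IHf']; by [].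
have [a0|a0] := ltP (a : int) 0; first exact: acts_neg.
move=> h hE y.
have -> : h = @rcomp (Qk k) a b c (mksub (P := subringoid_sg (@Qk_gen k) b c) mf)
     (mksub (P := subringoid_sg (@Qk_gen k) a b) mg) by apply: val_inj; rewrite hE.
rewrite act_comp augQM // -scFA.
set f' := mksub _; set g' := mksub _.
have h1 := IHg g' erefl y; have h2 := IHf f' erefl (act M g' y).
have -> : act M f' (act M g' y) - scF (augQ f) (scF (augQ g) (tr c y)) =
  (act M f' (act M g' y) - scF (augQ f) (tr c (act M g' y))) +
  scF (augQ f) (tr c (act M g' y - scF (augQ g) (tr b y))).
  rewrite trB scFB addrA subrK; congr (_ - _).
  rewrite (scFf _ _ (@trB b c)).
  have [ab|ab] := eqVneq b a; last by rewrite (augQ_deg _ ab) !scF0.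
  by subst b; rewrite tr_id.
apply: sg_memD => //; rewrite /scF; apply: sg_Mn => _.
exact: tr_DecZ.
Qed.

End Decomposition.

(** * Regularity of free and projective modules *)

Section FreeRegularity.
Variables (k : nat) (N : rmodule (Qk k)).
Local Notation F := (free_module N).

Lemma free_module_ind b (P : F b -> Prop) : P 0 -> (forall x y, P x -> P y -> P (x - y)) ->
  (forall a (x : N a) h, P (fsym x h)) -> forall u, P u.
Proof.
move=> P0 PB Pf; apply: (pres_ind (P := @Subgroup (F b) P P0 PB)) => -[a [x h]].
exact: Pf.
Qed.

Definition gen_of (a : int) (x : N a) := existT (fun a : int => N a : Type) a x.

Definition evf (g : {a : int & N a}) b (a : int) (x : N a) (h : @rhom (Qk k) a b) : Wt :=
  if `[< gen_of x = g >] then actQ (val h) (iotaW a) else 0.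

Lemma evfB g b a x : zmod_morphism (@evf g b a x).
Proof.
move=> h h'; rewrite /evf; case: asboolP => _; last by rewrite subrr.
by rewrite raddfB actQB //; apply: suppZ_iota.
Qed.

(* The component at a generator of degree a, in the a-th tensor power of F_2[t]
   with its standard Steenrod action. *)
Definition ev g b : Hom (F b) Wt := projT1 (cid (@free_module_lift (Qk k) N b Wt (fun a x h => evf g x h) (@evfB g b))).

Lemma ev_fsym g b a (x : N a) h : app (ev g b) (fsym x h) = evf g x h.
Proof. exact: (projT2 (cid (@free_module_lift (Qk k) N b Wt (fun a x h => evf g x h) (@evfB g b)))). Qed.

Lemma ev_supp g b u : suppZ b (app (ev g b) u).
Proof.
move: u; apply: free_module_ind => [w _|x y hx hy w wb|a x h]; first by rewrite raddf0.
  by rewrite raddfB -[LHS]/(app (ev g b) x w - app (ev g b) y w) hx // hy // subr0.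
rewrite ev_fsym /evf; case: asboolP => // _.
exact/suppZ_actQ/suppZ_iota.
Qed.

Lemma ev_act g b c (h : @rhom (Qk k) b c) u :
  app (ev g c) (act F h u) = actQ (val h) (app (ev g b) u).
Proof.
move: u; apply: free_module_ind => [|x y hx hy|a x h'].
- by rewrite act_arg0 !raddf0; apply/esym; apply: zmorph0 (stactBr _).
- rewrite actBr; transitivity (app (ev g c) (act F h x) - app (ev g c) (act F h y)).
    exact: raddfB.
  rewrite hx hy; transitivity (actQ (val h) (app (ev g b) x - app (ev g b) y)).
    by apply/esym; apply: stactBr.
  by congr actQ; apply/esym; exact: raddfB.
rewrite [act F h _]free_actE !ev_fsym /evf; case: asboolP => _; last first.
  by apply/esym; apply: zmorph0 (stactBr _).
by apply: actQM; apply: suppZ_iota.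
Qed.

Lemma ev_msq g i m n y : (0 < i <= m)%N -> (m < i + k)%N -> (m + i = n)%N ->
  app (ev g n%:Z) (@msq k F i m n y) = sqW i (app (ev g m%:Z) y).
Proof.
move=> /andP[i0 im] mik e; rewrite msqE // ev_act SqQkE; [|lia|lia].
by apply: actQ_Sq; [lia|apply: ev_supp].
Qed.

(** A generator of degree a <= r offers only a variables, so there the condition is that x_1 ... x_a
    itself, the image of the generator, does not occur. *)
Definition Kr r n (u : F n%:Z) : Prop := forall (a : nat) (x : N a%:Z),
  if (a <= r)%N then app (ev (gen_of x) n%:Z) u (nseq a 0%N) = 0
  else forall w, restr0W r (app (ev (gen_of x) n%:Z) u) w = 0.

Lemma Kr0 r n : @Kr r n 0.
Proof. by move=> a x; case: ifP => _; [|move=> w]; rewrite raddf0. Qed.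

Lemma KrB r n u v : @Kr r n u -> @Kr r n v -> @Kr r n (u - v).
Proof.
move=> hu hv a x; have := hu a x; have := hv a x; case: ifP => _ h1 h2; [|move=> w].
  by rewrite raddfB -[LHS]/(app (ev _ _) u _ - app (ev _ _) v _) h1 h2 subr0.
rewrite /restr0W raddfB -[LHS]/(app (ev _ _) u _ - app (ev _ _) v _).
by have := h1 w; have := h2 w; rewrite /restr0W => -> ->; rewrite subr0.
Qed.

Definition Kr_sg r n := Subgroup (Kr0 r n) (@KrB r n).

Lemma restr0W_nil r (f : Wt) : f (nseq r 0%N) = restr0W r f [::].
Proof. by rewrite /restr0W cats0. Qed.

(** On the cofactor of x_1 ... x_r, of degree m - r, the square Sq^i with m - r < i vanishes by
    instability. *)
Lemma Dec_Kr r n u : (r <= k)%N -> Dec F r n u -> Kr r u.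
Proof.
move=> rk; apply: (gen_min (P := Kr_sg r n)) => _ [i [m [z [im mr e ->]]]] a x.
rewrite ev_msq //; last by lia.
case: ifP => ar.
  by rewrite restr0W_nil restr0W_sq /= ifF //; lia.
move=> w; rewrite restr0W_sq.
have hs : supp m (app (ev (gen_of x) m%:Z) z) by exact: (proj1 (suppZE _ _) (ev_supp _ _)).
have [rm|mr'] := leqP r m.
  by apply: (sqW_unstable _ (supp_restr0 hs rm)); lia.
by apply: sqW_eq0 => v; apply: (restr0_lt _ hs mr').
Qed.

Lemma Kr_msq r i m n y : (0 < i)%N -> (r < k)%N -> m = (i + r)%N -> n = (m + i)%N ->
  Kr r (@msq k F i m n y) -> Kr r y.
Proof.
move=> i0 rk em en h a x.
have hs : supp m (app (ev (gen_of x) m%:Z) y) by exact: (proj1 (suppZE _ _) (ev_supp _ _)).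
have := h a x; case: ifP => ar.
  by move=> _; apply: hs; rewrite wt_nseq0; lia.
(* As the cofactor has degree m - r = i, the coefficient of its square at the shifted word is the
   coefficient of the cofactor at w. *)
move=> hw w; have := hw (map S w); rewrite ev_msq; [|lia|lia|lia].
rewrite restr0W_sq => <-; apply/esym.
have rm : (r <= m)%N by lia.
have -> : i = (m - r)%N by lia.
exact: sqW_top (supp_restr0 hs rm).
Qed.

Lemma Kr_succ r n u : @Kr r n u -> Kr r.+1 u.
Proof.
move=> h a x; have := h a x.
have [ar|ra] := leqP a r; first by rewrite ifT //; lia.
move=> hw; have [ar|ar] := leqP a r.+1.
  have e : nseq r 0%N ++ [:: 0%N] = nseq a 0%N.
    by have -> : a = (r + 1)%N by [lia]; rewrite nseqD.
  by rewrite -e; apply: hw.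
by move=> w; rewrite -(hw (0%N :: w)) /restr0W -[in LHS]addn1 nseqD -catA.
Qed.

Lemma fsym_gen (a : int) b (x : N a) (h : @rhom (Qk k) a b) :
  fsym x h = act F h (fsym x (@rid (Qk k) a)).
Proof. by rewrite [RHS]free_actE rcompf1. Qed.

(** By [acts_all], generators of other degrees produce only decomposables in degree n. *)
Lemma Dec_k_basis n (u : F n%:Z) : exists L : seq (N n%:Z),
  Dec F k n (u - \sum_(x <- L) (fsym x (@rid (Qk k) n%:Z) : F n%:Z)).
Proof.
have F2 : exp2 (F n%:Z) by exact: module2.
have N0 x : (fsym (x : N n%:Z) (0 : @rhom (Qk k) n%:Z n%:Z) : F n%:Z) = 0.
  by have := fsymB x (0 : @rhom (Qk k) n%:Z n%:Z) 0; rewrite !subrr.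
move: u; apply: free_module_ind => [|u v [L hL] [L' hL']|a x h].
- by exists [::]; rewrite big_nil subrr; apply: sg_mem0.
- exists (L ++ L'); move: hL hL'; set A := bigop _ _ _; set B := bigop _ _ _ => hL hL'.
  have -> : \sum_(x <- L ++ L') (fsym x (@rid (Qk k) n%:Z) : F n%:Z) = A + B by rewrite big_cat.
  by rewrite -(exp2B F2 A) subrACA; apply: sg_memB.
rewrite fsym_gen.
have := acts_all (M := F) (subP h) erefl (fsym x (@rid (Qk k) a)).
have [e|ne] := eqVneq a n%:Z; last first.
  rewrite augQ_deg; last by rewrite eq_sym.
  by rewrite scF0 => hD; exists [::]; rewrite big_nil; apply: DecZ_Dec.
subst a; rewrite tr_id; have [->|->] := F2P (augQ (val h)).
  by rewrite scF0 => hD; exists [::]; rewrite big_nil; apply: DecZ_Dec.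
by rewrite scF1 => hD; exists [:: x]; rewrite big_seq1; apply: DecZ_Dec.
Qed.

Lemma sum_even (V : zmodType) (X : eqType) (L : seq X) (f : X -> V) : exp2 V ->
  (forall x, ~~ odd (count_mem x L)) -> \sum_(x <- L) f x = 0.
Proof.
move=> V2 h; rewrite -big_undup_iterop_count big1 // => x _.
have -> : iterop (count_mem x L) +%R (f x) 0 = f x *+ count_mem x L by [].
by rewrite (exp2_odd V2) (negbTE (h x)).
Qed.

Lemma ev_id n (x y : N n%:Z) : app (ev (gen_of x) n%:Z) (fsym y (@rid (Qk k) n%:Z)) (nseq n 0%N)
  = `[< y = x >]%:R.
Proof.
rewrite ev_fsym /evf.
have [->|yx] := EM (y = x).
  rewrite !asboolT // -[val _]/(@rid ringoidQ n%:Z) actQ1; last exact: suppZ_iota.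
  by rewrite /iotaW eqxx.
rewrite !asboolF // => e; apply: yx; move: e.
by move=> /(eq_from_Tagged (T_ := fun a : int => N a)).
Qed.

(** Modulo decomposables u is the sum of a list of generators of degree n. The coefficient of x_1
    ... x_n in the component of a generator is the parity of its multiplicity in the list, and [Kr]
    makes it vanish. *)
Lemma Kr_Dec_k n (u : F n%:Z) : Kr k u -> Dec F k n u.
Proof.
move=> hu; have F2 : exp2 (F n%:Z) by exact: module2.
have [L hL] := Dec_k_basis u; move: hL.
set S := bigop _ _ _ => hL.
have hS : Kr k S.
  have -> : S = u - (u - S) by rewrite opprB addrC subrK.
  by apply: KrB => //; apply: Dec_Kr.
suff S0 : S = 0 by move: hL; rewrite S0 subr0.
pose L' : seq {classic (N n%:Z)} := L.
have hc (x : {classic (N n%:Z)}) : ~~ odd (count_mem x L').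
  have : app (ev (gen_of (x : N n%:Z)) n%:Z) S (nseq n 0%N) = 0.
    have := hS n x; case: leqP => // kn /(_ (nseq (n - k) 0%N)).
    by rewrite /restr0W -nseqD subnKC //; lia.
  have -> : app (ev (gen_of (x : N n%:Z)) n%:Z) S (nseq n 0%N) = (count_mem x L')%:R.
    rewrite /S /L'; elim: L {hL S hS L'} => [|y L IH]; first by rewrite big_nil raddf0.
    pose E : F n%:Z -> Wt := app (ev (gen_of (x : N n%:Z)) n%:Z).
    rewrite big_cons raddfD.
    transitivity (E (fsym y (@rid (Qk k) n%:Z)) (nseq n 0%N) +
      E (\sum_(x <- L) (fsym x (@rid (Qk k) n%:Z) : F n%:Z)) (nseq n 0%N)); first by [].
    rewrite {2}/E IH /E ev_id /= natrD.
    have -> // : `[< y = x >] = ((y : {classic (N n%:Z)}) == x) by apply/asboolP/eqP.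
  by rewrite (exp2_odd exp2_F2); case: odd => // /eqP; rewrite oner_eq0.
exact: (@sum_even _ {classic (N n%:Z)} L' _ F2 hc).
Qed.

(** In degree n only one square has lower index r: m - i = r and m + i = n determine i and m. *)
Lemma Dec_split r n (u : F n%:Z) : Dec F r.+1 n u ->
  exists u' y, Dec F r n u' /\ u = u' + @msq k F (n - r)./2 (n + r)./2 n y.
Proof.
pose P (u : F n%:Z) := exists u' y, Dec F r n u' /\ u = u' + @msq k F (n - r)./2 (n + r)./2 n y.
have P0 : P 0.
  by exists 0, 0; split; [apply: sg_mem0|rewrite (zmorph0 (@msqB k F _ _ _)) addr0].
have PB x y : P x -> P y -> P (x - y).
  move=> [u1 [y1 [h1 ->]]] [u2 [y2 [h2 ->]]]; exists (u1 - u2), (y1 - y2); split.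
    exact: sg_memB.
  by rewrite msqB opprD addrACA.
move: u; apply: (gen_min (P := Subgroup P0 PB)).
move=> _ [i [m [z [im mr e ->]]]].
have [mr'|mr'] := ltnP m (i + r).
  exists (msq i n z), 0; split; first by apply: gen_in; exists i, m, z.
  by rewrite (zmorph0 (@msqB k F _ _ _)) addr0.
have em : m = (n + r)./2 by lia.
have ei : i = (n - r)./2 by lia.
by subst i m; exists 0, z; split; [apply: sg_mem0|rewrite add0r].
Qed.

(** Descending induction on r from k, then induction on the degree. Membership for r + 1 gives u =
    u' + Sq_r y with u' already decomposed; [Kr_msq] puts y in [Kr r], in smaller degree, and
    [Dec_sq] carries the decomposition of y over to Sq_r y. *)
Lemma Kr_Dec r n (u : F n%:Z) : (r <= k)%N -> Kr r u -> Dec F r n u.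
Proof.
move=> rk; have [d] : exists d, (r + d)%N = k by exists (k - r)%N; rewrite subnKC.
elim: d r rk n u => [|d IH] r rk n u.
  by rewrite addn0 => e; subst r; apply: Kr_Dec_k.
rewrite addnS -addSn => e; move: n u; apply: (@ltn_ind (fun n => forall u, Kr r u -> Dec F r n u)).
move=> n IHn u hu.
have rk' : (r < k)%N by lia.
have [u' [y [hu' eu]]] := Dec_split (IH _ rk' _ _ e (Kr_succ hu)).
have hy : Kr r (@msq k F (n - r)./2 (n + r)./2 n y).
  have -> : @msq k F (n - r)./2 (n + r)./2 n y = u - u' by rewrite eu addrC addKr.
  by apply: KrB => //; apply: Dec_Kr.
rewrite eu; apply: sg_memD => //.
have [ok|no] := boolP [&& (0 < (n - r)./2)%N & ((n + r)./2 + (n - r)./2 == n)%N]; last first.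
  by rewrite /msq ifF; [apply: sg_mem0|lia].
apply: Dec_sq; [lia|lia|lia|lia|].
by apply: IHn; [lia|apply: (Kr_msq _ rk' _ _ hy); lia].
Qed.

Lemma free_regular r i m (x : F m%:Z) : (r < k)%N -> (0 < i)%N -> m = (i + r)%N ->
  Dec F r (m + i) (@msq k F i m (m + i) x) -> Dec F r m x.
Proof.
move=> rk i0 em h; apply: Kr_Dec; first by lia.
by apply: (Kr_msq i0 rk em (erefl (m + i)%N)); apply: Dec_Kr h; lia.
Qed.

End FreeRegularity.

Section NatDec.
Variables (k : nat) (M N : rmodule (Qk k)) (f : Nat M N).

Lemma napp_msq i m n y : napp f n%:Z (@msq k M i m n y) = @msq k N i m n (napp f m%:Z y).
Proof. by rewrite /msq; case: ifP => _; [apply: nappP|rewrite raddf0]. Qed.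

Lemma napp_Dec r n x : Dec M r n x -> Dec N r n (napp f n%:Z x).
Proof.
apply: (gen_preim (f := napp f n%:Z)); first exact: raddfB.
move=> _ [i [m [z [h1 h2 h3 ->]]]]; rewrite napp_msq; apply: gen_in.
by exists i, m, (napp f m%:Z z).
Qed.

End NatDec.

Definition regular k (M : rmodule (Qk k)) := forall r i m (x : M m%:Z),
  (r < k)%N -> (0 < i)%N -> m = (i + r)%N ->
  Dec M r (m + i) (@msq k M i m (m + i) x) -> Dec M r m x.

(** A projective module is a retract of a free one, and module maps preserve [Dec]. *)
Lemma projective_regular k (P : rmodule (Qk k)) : projective P -> regular P.
Proof.
move=> hP r i m x rk i0 em hD.
have [p psurj] := free_cover_ex P.
have id_B a : zmod_morphism (fun x : P a => x) by [].
pose idP : Nat P P := mkNat id_B (fun a b g x => erefl).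
have [g gE] := hP _ _ p idP psurj.
have gK a y : napp p a (napp g a y) = y by rewrite -[LHS]/(napp (ncomp p g) a y) gE.
rewrite -[x]gK; apply: napp_Dec; apply: (free_regular rk i0 em).
by rewrite -napp_msq; apply: napp_Dec.
Qed.

(** * Homogeneous elements of Lambda *)

Fixpoint words (s n : nat) : seq (seq nat) :=
  if s is s'.+1 then [seq i :: J | i <- iota 0 n, J <- words s' n] else [:: [::]].

Lemma mem_words s n J : (J \in words s n) = (size J == s) && all (fun i => i < n)%N J.
Proof.
elim: s J => [|s IH] [|i J] //=.
  by apply/allpairsP => -[[? ?] [_ _]].
rewrite eqSS; apply/allpairsP/idP => [[[i' J'] /= [hi hJ [-> ->]]]|].
  by move: hi hJ; rewrite mem_iota IH add0n /= => -> /andP[-> ->].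
move=> /andP[sJ /andP[hi hJ]]; exists (i, J); split=> //=; first by rewrite mem_iota.
by rewrite IH sJ.
Qed.

Lemma words_uniq s n : uniq (words s n).
Proof.
elim: s => //= s IH; apply: allpairs_uniq => //; first exact: iota_uniq.
by move=> [i J] [i' J'] _ _ /= [-> ->].
Qed.

(** A finite list that contains every admissible word of length s and degree n, since the letters of
    such a word are below n; words of other degrees occur in it as well. *)
Definition bwords s n := [seq J <- words s n | admissible J].

Lemma mem_bwords J : admissible J -> J \in bwords (size J) (deg J).
Proof.
move=> aJ; rewrite mem_filter aJ mem_words eqxx /= {aJ}.
apply/allP => i; elim: J => // l J IH; rewrite in_cons deg_cons => /orP[/eqP->|/IH]; lia.
Qed.

Definition lsum s n (f : seq nat -> 'F_2) : Lambda :=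
  \sum_(J <- bwords s n) scF (f J) (lam_mon J).

Lemma lsumB s n f g : lsum s n f - lsum s n g = lsum s n (fun J => f J - g J).
Proof.
rewrite /lsum -sumrB; apply: eq_bigr => J _.
by rewrite (exp2B exp2_F2) (scFDl Lambda2) (exp2B Lambda2).
Qed.

Lemma lsum_ext s n f g : (forall J, J \in bwords s n -> f J = g J) -> lsum s n f = lsum s n g.
Proof. by move=> h; apply: eq_big_seq => J hJ; rewrite h. Qed.

Lemma scF_F2 (c d : 'F_2) : scF c d = c * d.
Proof. by have [->|->] := F2P c; rewrite ?mul0r ?mul1r. Qed.

Lemma coef_lsum s n f I : coef I (lsum s n f) = (if I \in bwords s n then f I else 0).
Proof.
rewrite /lsum; have hu : uniq (bwords s n) by apply/filter_uniq/words_uniq.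
have e : coef I (\sum_(J <- bwords s n) scF (f J) (lam_mon J)) =
    \sum_(J <- bwords s n) f J * (J == I)%:R.
  rewrite raddf_sum; apply: eq_big_seq => J; rewrite mem_filter => /andP[aJ _].
  transitivity (scF (f J) (coef I (lam_mon J))); first exact: (scFf _ _ (coef_zmod I)).
  by rewrite scF_F2 coef_mon.
rewrite e; case: ifP => hI; last first.
  rewrite big_seq big1 // => J hJ; case: eqP => [eJ|_]; last by rewrite mulr0.
  by rewrite eJ hI in hJ.
rewrite (bigD1_seq I) //= eqxx mulr1 big1 ?addr0 // => J /negbTE->.
by rewrite mulr0.
Qed.

(** Graded by the absolute degree m + deg, which left multiplication by a letter leaves fixed while
    m changes. *)
Definition HLa m s a : subgroup Lambda :=
  gen (fun x => exists J, [/\ in_Lambda m J, size J = s, (m + deg J = a)%N & x = lam_mon J]).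
Definition HGa m k s a : subgroup Lambda :=
  gen (fun x => exists J, [/\ in_Gamma m k J, size J = s, (m + deg J = a)%N & x = lam_mon J]).

Lemma HLaP m s a x : HLa m s a x <-> if (m <= a)%N then HL m s (a - m) x else x = 0.
Proof.
case: leqP => ma; split.
- by apply: gen_mono => y [J [h1 h2 h3 ->]]; exists J; split=> //; lia.
- by apply: gen_mono => y [J [h1 h2 h3 ->]]; exists J; split=> //; lia.
- by elim=> {x} [x [J [h1 h2 h3 ->]]||x y _ -> _ ->]; [lia|by []|rewrite subr0].
- by move=> ->; apply: sg_mem0.
Qed.

Lemma HGaP m k s a x : HGa m k s a x <-> if (m <= a)%N then HG m k s (a - m) x else x = 0.
Proof.
case: leqP => ma; split.
- by apply: gen_mono => y [J [h1 h2 h3 ->]]; exists J; split=> //; lia.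
- by apply: gen_mono => y [J [h1 h2 h3 ->]]; exists J; split=> //; lia.
- by elim=> {x} [x [J [h1 h2 h3 ->]]||x y _ -> _ ->]; [lia|by []|rewrite subr0].
- by move=> ->; apply: sg_mem0.
Qed.

Lemma HGa_HLa m k s a x : HGa m k s a x -> HLa m s a x.
Proof.
by apply: gen_mono => y [J [h1 h2 h3 ->]]; exists J; split=> //; apply: in_Gamma_Lambda h1.
Qed.

Lemma HGa_mono m k r s a x : (r <= k)%N -> HGa m k s a x -> HGa m r s a x.
Proof.
move=> rk; apply: gen_mono => y [J [h1 h2 h3 ->]]; exists J; split=> //.
exact: in_Gamma_mono h1.
Qed.

Lemma prodLa m s i a x : (i < m)%N -> HLa (m + i).+1 s a x -> HLa m s.+1 a (lam i * x).
Proof.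
move=> im /HLaP; case: leqP => h hx; apply/HLaP.
  by rewrite hx mulr0; case: ifP => _ //; apply: sg_mem0.
by rewrite ifT; [apply: HL_cast (prodL im hx)|]; lia.
Qed.

Lemma prodGa m k s i a x : (i < m)%N -> HGa (m + i).+1 k s a x -> HGa m k s.+1 a (lam i * x).
Proof.
move=> im /HGaP; case: leqP => h hx; apply/HGaP.
  by rewrite hx mulr0; case: ifP => _ //; apply: sg_mem0.
by rewrite ifT; [apply: HG_cast (prodG im hx)|]; lia.
Qed.

Lemma prodGa_first m k s i a x : (i + k < m)%N -> HLa (m + i).+1 s a x ->
  HGa m k s.+1 a (lam i * x).
Proof.
move=> im /HLaP; case: leqP => h hx; apply/HGaP.
  by rewrite hx mulr0; case: ifP => _ //; apply: sg_mem0.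
by rewrite ifT; [apply: HG_cast (prodG_first im hx)|]; lia.
Qed.

Lemma dLa m s a x : HLa m s a x -> HLa m s.+1 a (ld x).
Proof.
move=> /HLaP; case: leqP => h hx; apply/HLaP; [|by rewrite hx raddf0; case: ifP => _ //; apply: sg_mem0].
by rewrite ifT //; apply: dL.
Qed.

Lemma dGa m k s a x : HGa m k s a x -> HGa m k s.+1 a (ld x).
Proof.
move=> /HGaP; case: leqP => h hx; apply/HGaP; [|by rewrite hx raddf0; case: ifP => _ //; apply: sg_mem0].
by rewrite ifT //; apply: dG.
Qed.

Lemma HLa_expand m s a x : HLa m s a x -> x = lsum s (a - m) (fun J => coef J x).
Proof.
elim=> {x} [x [J [h1 h2 h3 ->]]||x y _ hx _ hy].
- have aJ := in_Lambda_adm h1; rewrite /lsum.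
  have hu : uniq (bwords s (a - m)) by apply/filter_uniq/words_uniq.
  have hJ : J \in bwords s (a - m).
    by have := mem_bwords aJ; rewrite h2; have -> : (a - m)%N = deg J by lia.
  rewrite (bigD1_seq J) //= coef_mon // eqxx big1 ?addr0 // => I /negbTE IJ.
  by rewrite coef_mon // eq_sym IJ.
- by rewrite /lsum big1 // => J _; rewrite raddf0.
by rewrite [in LHS]hx [in LHS]hy lsumB; apply: lsum_ext => J _; rewrite raddfB.
Qed.

Lemma HLa_coef m s a x J : HLa m s a x -> coef J x != 0 ->
  [/\ in_Lambda m J, size J = s & (m + deg J = a)%N].
Proof.
elim=> {x} [x [I [h1 h2 h3 ->]]||x y _ hx _ hy].
- rewrite coef_mon; last exact: in_Lambda_adm h1.
  by case: (I =P J) => [<-|_]; rewrite ?eqxx.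
- by rewrite raddf0 eqxx.
rewrite coef_zmod; have [->|/hx //] := eqVneq (coef J x) 0.
by rewrite sub0r oppr_eq0; apply: hy.
Qed.

Lemma HGa_coef m k s a x J : HGa m k s a x -> in_basis k m J -> coef J x = 0.
Proof.
move=> + /andP[_ nG]; elim=> {x} [x [I [h1 h2 h3 ->]]||x y _ hx _ hy].
- rewrite coef_mon; last exact/in_Lambda_adm/in_Gamma_Lambda/h1.
  by case: eqP => // eIJ; rewrite -eIJ h1 in nG.
- by rewrite raddf0.
by rewrite coef_zmod hx hy subr0.
Qed.

Lemma coef_HGa m k s a x : HLa m s a x -> (forall J, in_basis k m J -> coef J x = 0) ->
  HGa m k s a x.
Proof.
move=> hx h; rewrite (HLa_expand hx); apply: sg_sum => J _; apply: sg_Mn => c0.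
have {}c0 : coef J x != 0 by case: (coef J x != 0) c0.
have [h1 h2 h3] := HLa_coef hx c0; apply: gen_in; exists J; split=> //.
by apply: contraNT c0 => nG; rewrite h // /in_basis h1.
Qed.

Lemma lsum_HLa m s a f : (forall J, f J != 0 -> [/\ in_Lambda m J, size J = s & (m + deg J = a)%N]) ->
  HLa m s a (lsum s (a - m) f).
Proof.
move=> h; apply: sg_sum => J _; apply: sg_Mn => c0.
have {}c0 : f J != 0 by case: (f J != 0) c0.
have [h1 h2 h3] := h _ c0.
by apply: gen_in; exists J.
Qed.

Lemma HLa_mul m s s' n a x y : HL m s n y -> HLa (m + n) s' a x -> HLa m (s + s') a (y * x).
Proof.
move=> hy hx; move: y hy.
apply: (gen_preim (mulr_zmod x)) => _ [J [hJ <- eJ ->]]; subst n.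
elim: J m hJ hx => [|i J IH] m hJ hx.
  by rewrite lam_mon_nil mul1r; move: hx; rewrite deg_nil addn0.
have [im hJ'] := in_Lambda_cons hJ.
rewrite lam_mon_cons -mulrA; apply: prodLa => //; apply: IH => //.
by move: hx; rewrite deg_cons !addnA addnS.
Qed.

Lemma HGa_mul m k s s' n a x y : HL m s n y -> HGa (m + n) k s' a x ->
  HGa m k (s + s') a (y * x).
Proof.
move=> hy hx; move: y hy.
apply: (gen_preim (mulr_zmod x)) => _ [J [hJ <- eJ ->]]; subst n.
elim: J m hJ hx => [|i J IH] m hJ hx.
  by rewrite lam_mon_nil mul1r; move: hx; rewrite deg_nil addn0.
have [im hJ'] := in_Lambda_cons hJ.
rewrite lam_mon_cons -mulrA; apply: prodGa => //; apply: IH => //.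
by move: hx; rewrite deg_cons !addnA addnS.
Qed.

(** * The square of the differential on cochains *)

Lemma sum_shift (V : zmodType) (G : nat -> V) q C :
  \sum_(q <= N < C) G N = \sum_(0 <= i < C - q) G (i + q)%N.
Proof. by rewrite -{1}[q]add0n big_addn. Qed.

Lemma sum_diag (V : zmodType) (F : nat -> nat -> V) C :
  (forall p q, (C <= p + q)%N -> F p q = 0) ->
  \sum_(0 <= p < C) \sum_(0 <= q < C) F p q =
  \sum_(0 <= N < C) \sum_(0 <= q < N.+1) F (N - q)%N q.
Proof.
move=> F0; rewrite exchange_big /=.
transitivity (\sum_(0 <= N < C) \sum_(0 <= q < C | (q <= N)%N) F (N - q)%N q); last first.
  by apply: eq_big_nat => N NC; rewrite [RHS](big_nat_widen _ _ C) //; lia.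
rewrite [RHS](exchange_big_dep_nat xpredT) //=; apply: eq_big_nat => q qC.
transitivity (\sum_(q <= N < C) F (N - q)%N q); last first.
  by rewrite (big_nat_widenl q 0).
rewrite sum_shift.
rewrite (@big_cat_nat _ _ _ (C - q)) /=; [|lia|lia].
rewrite [X in _ + X](_ : _ = 0) ?addr0; first by apply/esym; apply: eq_big_nat => p _; rewrite addnK.
by rewrite big_nat big1 // => p pC; apply: F0; lia.
Qed.

Lemma lam_mul2 t u x : (0 < t)%N -> (2 * t <= u)%N -> lam (t - 1) * (lam (u - 1) * x) =
  \sum_(2 * t <= q < u) (lam (t + u - q - 1) * (lam (q - 1) * x)) *+ 'C(u - q - 1, q - 2 * t).
Proof.
move=> t0 tu; rewrite mulrA; have -> : (u - 1 = 2 * (t - 1) + 1 + (u - 2 * t))%N by lia.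
rewrite lam_rel mulr_suml [RHS]sum_shift; apply: eq_big_nat => j ju.
have -> : (t + u - (j + 2 * t) - 1 = t - 1 + (u - 2 * t) - j)%N by lia.
have -> : (j + 2 * t - 1 = 2 * (t - 1) + 1 + j)%N by lia.
have -> : (u - (j + 2 * t) - 1 = u - 2 * t - j - 1)%N by lia.
by rewrite addnK mulrnAl mulrA.
Qed.

Lemma sum_range (V : zmodType) (F : nat -> V) (P : pred nat) a b N : (b <= N)%N ->
  \sum_(a <= i < b | P i) F i = \sum_(0 <= i < N) (if (a <= i < b)%N && P i then F i else 0).
Proof.
move=> bN; rewrite -big_mkcond /= (big_nat_widenl a 0) // (big_nat_widen 0 b N) //.
by apply: eq_bigl => i; case: (a <= i)%N; case: (i < b)%N; case: (P i).
Qed.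

Section KoszulCore.
Variables (V : zmodType) (A : nat -> V -> V) (N : nat) (X : V) (Y : nat -> V).
Hypothesis AB : forall q, zmod_morphism (A q).

HB.instance Definition _ q := GRing.isZmodMorphism.Build V V (A q) (AB q).

(** Collects terms by the admissible pairs lambda_(N-q-1) lambda_(q-1), those with 3q < 2N. The
    double sum comes from rewriting the inadmissible pairs, the sum with X from d(lambda_(N-1)). The
    cofactor of each pair on the right has the shape of an Adem relation. *)
Lemma koszul_core :
  \sum_(1 <= q < N) (A q X) *+ 'C(N - q - 1, q) +
  (\sum_(1 <= q < N | (3 * q < 2 * N)%N) A q (Y (N - q)%N) +
   \sum_(1 <= t < N | (3 * t <= N)%N)
     \sum_(2 * t <= q < N - t) (A q (Y t)) *+ 'C(N - t - q - 1, q - 2 * t)) =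
  \sum_(1 <= q < N | (3 * q < 2 * N)%N) A q (Y (N - q)%N + (X *+ 'C(N - q - 1, q) +
    \sum_(1 <= t < (q %/ 2).+1) (Y t) *+ 'C(N - q - t - 1, q - 2 * t))).
Proof.
transitivity (\sum_(1 <= q < N | (3 * q < 2 * N)%N) (A q (Y (N - q)%N) + (A q X *+ 'C(N - q - 1, q) +
    \sum_(1 <= t < (q %/ 2).+1) (A q (Y t)) *+ 'C(N - q - t - 1, q - 2 * t)))); last first.
  apply: eq_bigr => q _; rewrite !raddfD raddfMn raddf_sum; congr (_ + (_ + _)).
  by apply: eq_bigr => t _; rewrite raddfMn.
rewrite [RHS]big_split [X in _ = _ + X]big_split /= addrCA; congr (_ + (_ + _)).
  rewrite [RHS]big_mkcond /=; apply: eq_big_nat => q qN; case: ifP => // qN'.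
  by rewrite bin_small //; lia.
rewrite (sum_range _ _ _ (leqnn N)) [RHS](sum_range _ _ _ (leqnn N)).
pose f q t := if [&& 0 < t, 2 * t <= q & q + t < N]%N
   then A q (Y t) *+ 'C(N - t - q - 1, q - 2 * t) else 0.
transitivity (\sum_(0 <= t < N) \sum_(0 <= q < N) f q t).
  apply: eq_big_nat => t tN; case: ifP => ct; last first.
    by rewrite big_nat big1 // => q qN; rewrite /f ifF //; lia.
  rewrite (sum_range _ _ _ (leq_subr t N)); apply: eq_big_nat => q qN.
  by rewrite /f andbT; congr (if _ then _ else _); lia.
rewrite exchange_big /=; apply: eq_big_nat => q qN; case: ifP => cq; last first.
  rewrite big_nat big1 // => t tN; rewrite /f; case: ifP => // ct.
  by rewrite bin_small //; lia.
rewrite [RHS](@sum_range _ _ _ _ _ N); last by lia.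
apply: eq_big_nat => t tN; rewrite /f andbT.
have -> : (N - q - t - 1 = N - t - q - 1)%N by lia.
case: ifP => c1; case: ifP => c2 //; first by lia.
by rewrite bin_small //; lia.
Qed.

End KoszulCore.

Section MaskedSquares.
Variables (K : nat) (M : rmodule (Qk K)).

(** Masking the squares of lower index at least r imitates restriction to Q_r while the type of the
    module stays fixed. *)
Definition msqr r i m n (z : M m%:Z) : M n%:Z := if (m < i + r)%N then @msq K M i m n z else 0.

Lemma msqrB r i m n : zmod_morphism (@msqr r i m n).
Proof. by move=> x y; rewrite /msqr; case: ifP => _; [apply: msqB|rewrite subrr]. Qed.

Lemma msqr_eq0 r i m n z : ~~ [&& 0 < i, i <= m, m < i + r & m + i == n]%N -> @msqr r i m n z = 0.
Proof.
move=> h; rewrite /msqr /msq; case: ifP => // mr; case: ifP => // /and4P[i0 im _ e].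
by move: h; rewrite i0 im mr e.
Qed.

Lemma adem_msqr r n p q N (y : M n%:Z) : (r <= K)%N -> (0 < p <= n)%N -> (0 < q < 2 * p)%N ->
  (n + p < q + r)%N -> N = (n + (p + q))%N ->
  @msqr r q (n + p) N (@msqr r p n (n + p) y) =
  @msqr r (p + q) n N y *+ 'C(p - 1, q) +
  \sum_(1 <= t < (q %/ 2).+1)
    @msqr r (p + q - t) (n + t) N (@msqr r t n (n + t) y) *+ 'C(p - t - 1, q - 2 * t).
Proof.
move=> rK pn qp nr eN; have := @adem_msq K M n p q y pn qp.
have -> : N = (n + p + q)%N by lia.
rewrite /msqr !ifT; [|lia|lia|lia] => ->; last by lia.
congr (_ + _); apply: eq_big_nat => t tq.
have [->|b0] := eqVneq 'C(p - t - 1, q - 2 * t) 0%N; first by rewrite !mulr0n.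
have {}b0 : (q - 2 * t <= p - t - 1)%N by rewrite -bin_gt0 lt0n.
by rewrite !ifT //; lia.
Qed.

End MaskedSquares.

Section Differential.
Variables (K : nat) (M : rmodule (Qk K)).

Definition cfam := forall m : nat, M m%:Z -> Lambda.

(** The differential of Lambda_k(M) as an operator on functions of z, with squares masked at r; the
    term i = 0 is 0 by the side condition in [msq]. *)
Definition Dc r (c : cfam) : cfam := fun m z => ld (c m z) +
  \sum_(0 <= i < m.+1) lam (i - 1) * c (m + i)%N (@msqr K M r i m (m + i) z).

Section Fixed.
Variables (r : nat) (c : cfam).
Arguments c : clear implicits.
Hypothesis cB : forall m, zmod_morphism (c m).

Lemma c0 m : c m 0 = 0. Proof. exact: (zmorph0 (@cB m)). Qed.

Lemma Dc_wide C m z : (m < C)%N -> @Dc r c m z = ld (c m z) +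
  \sum_(0 <= i < C) lam (i - 1) * c (m + i)%N (@msqr K M r i m (m + i) z).
Proof.
move=> mC; rewrite /Dc (@big_cat_nat _ _ _ m.+1 0 C) //=; congr (_ + _).
rewrite [X in _ = _ + X](_ : _ = 0) ?addr0 // big_nat big1 // => i iC.
by rewrite msqr_eq0 ?c0 ?mulr0 //; lia.
Qed.

Lemma Dc_zmod m : zmod_morphism (@Dc r c m).
Proof.
move=> x y; rewrite /Dc cB raddfB opprD addrACA; congr (_ + _).
rewrite -sumrB; apply: eq_bigr => i _; rewrite -mulrBr; congr (_ * _).
by rewrite msqrB cB.
Qed.

Lemma Dc_HL s a : (forall m z, HLa m s a (c m z)) -> forall m z, HLa m s.+1 a (@Dc r c m z).
Proof.
move=> hc m z; apply: sg_memD; first exact: dLa.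
apply: sg_sum => i; rewrite mem_index_iota => im.
have [->|i0] := posnP i; first by rewrite msqr_eq0 // c0 mulr0; apply: sg_mem0.
apply: prodLa; first by lia.
by have -> : ((m + (i - 1)).+1 = m + i)%N by lia.
Qed.

Lemma Dc_HG k s a : (forall m z, HGa m k s a (c m z)) -> forall m z, HGa m k s.+1 a (@Dc r c m z).
Proof.
move=> hc m z; apply: sg_memD; first exact: dGa.
apply: sg_sum => i; rewrite mem_index_iota => im.
have [->|i0] := posnP i; first by rewrite msqr_eq0 // c0 mulr0; apply: sg_mem0.
apply: prodGa; first by lia.
by have -> : ((m + (i - 1)).+1 = m + i)%N by lia.
Qed.

Lemma c_cast n n' q m (z : M m%:Z) : n = n' ->
  c n (@msqr K M r q m n z) = c n' (@msqr K M r q m n' z).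
Proof. by move=> ->. Qed.

Section AtN.
Variables (s a m : nat) (z : M m%:Z) (N : nat).
Hypothesis rK : (r <= K)%N.
Hypothesis hc : forall m z, HLa m s a (c m z).
Let W := (m + N)%N.
Let S p := @msqr K M r p m (m + p) z.
Let A q x := lam (N - q - 1) * (lam (q - 1) * x).
Let X := c W (@msqr K M r N m W z).
Let Y p := c W (@msqr K M r (N - p) (m + p) W (S p)).
(** The value of c on the Adem relation for Sq^q Sq^(N-q) applied to z; the term with X is the one
    for Sq^N. *)
Let R q := Y (N - q)%N + (X *+ 'C(N - q - 1, q) +
    \sum_(1 <= t < (q %/ 2).+1) (Y t) *+ 'C(N - q - t - 1, q - 2 * t)).

Lemma R_eq0 q : (0 < q < N)%N -> (3 * q < 2 * N)%N -> (N - q <= m)%N ->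
  (m + (N - q) < q + r)%N -> R q = 0.
Proof.
move=> q0 qN pm mr; pose p := (N - q)%N.
have := @adem_msqr K M r m p q W z rK.
move=> /(_ ltac:(lia) ltac:(lia) ltac:(lia) ltac:(lia)) e.
have cS : c W (@msqr K M r q (m + p) W (@msqr K M r p m (m + p) z)) = X *+ 'C(N - q - 1, q) +
    \sum_(1 <= t < (q %/ 2).+1) (Y t) *+ 'C(N - q - t - 1, q - 2 * t).
  pose cH := mkHom (@cB W).
  rewrite e -[LHS]/(app cH _) raddfD raddfMn raddf_sum /X /p.
  have -> : (N - q + q)%N = N by lia.
  congr (_ + _); apply: eq_big_nat => t tq; rewrite raddfMn /Y /S.
  by [].
rewrite /R -cS /Y -/p; have -> : (N - p)%N = q by lia.
exact: Lambda2.
Qed.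

Lemma R_eq0' q : (0 < q < N)%N -> (m < N - q)%N -> R q = 0.
Proof.
move=> q0 pm; have Y0 t : (2 * t <= q)%N || (t == N - q)%N -> Y t = 0.
  move=> ht; rewrite /Y /S; have [tm|mt] := leqP t m.
    by rewrite msqr_eq0 ?c0 //; lia.
  by rewrite [msqr r t _ z]msqr_eq0 ?(zmorph0 (@msqrB K M _ _ _ _)) ?c0 //; lia.
rewrite /R Y0 ?eqxx ?orbT // /X msqr_eq0 ?c0 ?mul0rn ?add0r; last by lia.
by rewrite big_nat big1 // => t tq; rewrite Y0 ?mul0rn //; lia.
Qed.

Lemma R_HL q : HLa W s a (R q).
Proof.
apply: sg_memD; first exact: hc.
apply: sg_memD; first by apply: sg_Mn => _; exact: hc.
by apply: sg_sum => t _; apply: sg_Mn => _; exact: hc.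
Qed.

(** Either the outer square Sq^q has lower index below r and the Adem relation gives R q = 0, or the
    letter q - 1 has lower index at least r and the product lies in Gamma. *)
Lemma AR q : (0 < q < N)%N -> (3 * q < 2 * N)%N -> HGa m r s.+2 a (A q (R q)).
Proof.
move=> q0 qN; have [pm|mp] := leqP (N - q) m; last first.
  by rewrite R_eq0' // /A !mulr0; apply: sg_mem0.
have [mr|rm] := ltnP (m + (N - q)) (q + r).
  by rewrite R_eq0 // /A !mulr0; apply: sg_mem0.
apply: prodGa; first by lia.
apply: prodGa_first; first by lia.
have -> : (((m + (N - q - 1)).+1 + (q - 1)).+1 = W)%N by rewrite /W; lia.
exact: R_HL.
Qed.

Lemma DD_at : (0 < N)%N -> HGa m r s.+2 a (ld (lam (N - 1)) * X + \sum_(1 <= q < N) A q (Y (N - q)%N)).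
Proof.
move=> N0; have AB q : zmod_morphism (A q) by move=> x y; rewrite /A !mulrBr.
have -> : ld (lam (N - 1)) * X = \sum_(1 <= q < N) (A q X) *+ 'C(N - q - 1, q).
  rewrite dlam_mul; have -> : (N - 1).+1 = N by lia.
  by apply: eq_big_nat => j jN; rewrite /A; have -> : (N - 1 - j = N - j - 1)%N by lia.
have -> : \sum_(1 <= q < N) A q (Y (N - q)%N) =
  \sum_(1 <= q < N | (3 * q < 2 * N)%N) A q (Y (N - q)%N) +
   \sum_(1 <= t < N | (3 * t <= N)%N)
     \sum_(2 * t <= q < N - t) (A q (Y t)) *+ 'C(N - t - q - 1, q - 2 * t).
  rewrite (bigID (fun q => 3 * q < 2 * N)%N) /=; congr (_ + _).
  rewrite big_nat_rev /= big_nat_cond [RHS]big_nat_cond.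
  apply: eq_big => [t|t /andP[tN t3]]; first by lia.
  have -> : (1 + N - t.+1 = N - t)%N by lia.
  have -> : (N - (N - t) = t)%N by lia.
  rewrite /A; have -> : (N - (N - t) = t)%N by lia.
  rewrite lam_mul2; [|lia|lia].
  by have -> : (t + (N - t) = N)%N by lia.
rewrite (@koszul_core Lambda A N X Y AB) big_mkcond; apply: sg_sum => q.
rewrite mem_index_iota => qN; case: ifP => q3; last exact: sg_mem0.
exact: AR.
Qed.
End AtN.

End Fixed.

Lemma exp2_cancel (V : zmodType) : exp2 V -> forall x b y : V, x + b + (b + y) = x + y.
Proof. by move=> V2 x b y; rewrite addrA -[x + b + b]addrA V2 addr0. Qed.

Lemma sum_ends (V : zmodType) (G : nat -> V) N : (0 < N)%N -> G 0%N = 0 -> G N = 0 ->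
  \sum_(0 <= q < N.+1) G q = \sum_(1 <= q < N) G q.
Proof.
move=> N0 G0 GN; rewrite big_ltn // G0 add0r (@big_cat_nat _ _ _ N) //=.
by rewrite big_nat1 GN addr0.
Qed.

Lemma mulr_add_sum (R : pzRingType) (x y : R) (s : seq nat) (G H : nat -> R) :
  (forall q, x * G q = H q) -> x * (y + \sum_(q <- s) G q) = x * y + \sum_(q <- s) H q.
Proof. by move=> h; rewrite mulrDr mulr_sumr; congr (_ + _); apply: eq_bigr => q _. Qed.

Lemma DD r (c : cfam) s a m z : (r <= K)%N -> (forall m, zmod_morphism (@c m)) ->
  (forall m z, HLa m s a (@c m z)) -> HGa m r s.+2 a (@Dc r (Dc r c) m z).
Proof.
(* A common bound for all sums: nonzero terms have p <= m and q <= m + p, hence p + q <= 3m. *)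
move=> rK cB hc; pose C := (4 * m).+2.
have mC : (m < C)%N by rewrite /C; lia.
have S0 := fun r i m n => zmorph0 (@msqrB K M r i m n).
have cc0 := c0 cB.
pose F p q := lam (p - 1) * (lam (q - 1) *
   @c (m + (p + q))%N (@msqr K M r q (m + p) (m + (p + q)) (@msqr K M r p m (m + p) z))).
pose X p := @c (m + p)%N (@msqr K M r p m (m + p) z).
have F0 p q : ~~ ((0 < p <= m) && (0 < q <= m + p))%N -> F p q = 0.
  move=> h; rewrite /F; have [ok|no] := boolP (0 < p <= m)%N.
    by rewrite [msqr r q _ _]msqr_eq0 ?cc0 ?mulr0 //; lia.
  by rewrite [msqr r p _ _]msqr_eq0 ?S0 ?cc0 ?mulr0 //; lia.
have -> : @Dc r (Dc r c) m z =
   \sum_(0 <= N < C) (ld (lam (N - 1)) * X N) + \sum_(0 <= p < C) \sum_(0 <= q < C) F p q.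
  rewrite (@Dc_wide r (Dc r c) (Dc_zmod r cB) C m z mC) (@Dc_wide r c cB C m z mC).
  rewrite ldD ldd add0r raddf_sum.
  transitivity (\sum_(0 <= i < C) (ld (lam (i - 1)) * X i + lam (i - 1) * ld (X i)) +
      \sum_(0 <= i < C) (lam (i - 1) * ld (X i) + \sum_(0 <= q < C) F i q)).
    congr (_ + _); first by apply: eq_bigr => i _; apply: ldM.
    apply: eq_big_nat => i iC; have [im|mi] := leqP i m; last first.
      rewrite /X msqr_eq0 ?cc0 ?raddf0 ?mulr0 ?add0r; last by lia.
      rewrite (zmorph0 (@Dc_zmod r c cB _)) mulr0 big_nat big1 // => q _.
      by apply: F0; lia.
    rewrite (@Dc_wide r c cB C); last by rewrite /C; lia.
    apply: mulr_add_sum => q; rewrite /F.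
    by rewrite (@c_cast r c (m + i + q)%N (m + (i + q))%N q _ _ (esym (addnA m i q))).
  by rewrite !big_split /=; apply: exp2_cancel; exact: Lambda2.
rewrite sum_diag; last by move=> p q; rewrite /C => pq; apply: F0; lia.
rewrite -big_split; apply: sg_sum => N _.
change (HGa m r s.+2 a (ld (lam (N - 1)) * X N + \sum_(0 <= q < N.+1) F (N - q)%N q)).
have [->|N0] := posnP N.
  rewrite big_nat1 F0 // /X msqr_eq0 // cc0 mulr0 addr0; exact: sg_mem0.
rewrite sum_ends //; [|by apply: F0; lia|by rewrite subnn F0].
have -> : \sum_(1 <= q < N) F (N - q)%N q = \sum_(1 <= q < N) lam (N - q - 1) * (lam (q - 1) *
   @c (m + N)%N (@msqr K M r (N - (N - q)) (m + (N - q)) (m + N) (@msqr K M r (N - q) m (m + (N - q)) z))).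
  apply: eq_big_nat => q qN; rewrite /F.
  have -> : (N - q + q = N)%N by lia.
  by have -> : (N - (N - q) = q)%N by lia.
exact: (@DD_at r c cB s a m z N rK hc N0).
Qed.

End Differential.

(** * Splitting off the last letter *)

Section Rho.
Variables (r l : nat).
(** A letter l started in degree a' has lower index r. As a = 2l + r + 2, at most one letter can
    come last with lower index r in absolute degree a. *)
Let a' := (l + r.+1)%N.
Let a := (a' + l.+1)%N.

Lemma HLa_rho m s x : HLa m s a' x -> HLa m s.+1 a (x * lam l).
Proof.
move=> /HLaP; case: leqP => ma hx; last by rewrite hx mul0r; apply: sg_mem0.
have hl : HLa (m + (a' - m)) 1 a (lam l).
  apply: gen_in; exists [:: l]; split=> //.
  - by rewrite /in_Lambda /= /a'; lia.
  - by rewrite deg_cons deg_nil /a; lia.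
  - by rewrite lam_mon_cons lam_mon_nil mulr1.
by have := HLa_mul hx hl; rewrite addn1.
Qed.

Lemma HGa_rho m s x : HGa m r s a' x -> HGa m r.+1 s.+1 a (x * lam l).
Proof.
apply: (gen_preim (mulr_zmod (lam l))) => _ [J [h1 h2 h3 ->]].
apply/HGaP; rewrite ifT; last by rewrite /a; lia.
by apply: HG_cast (HG_rcons _ h1); rewrite ?h2 //; move: h3; rewrite /a /a'; lia.
Qed.

Lemma HGa_mul_dlam m s x : HLa m s a' x -> HGa m r.+1 s.+2 a (x * ld (lam l)).
Proof.
move=> /HLaP; case: leqP => ma hx; last by rewrite hx mul0r; apply: sg_mem0.
have hl : HGa (m + (a' - m)) r.+1 2 a (ld (lam l)).
  apply/HGaP; rewrite ifT; last by rewrite /a; lia.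
  have := @dlamG_first a' r.+1 0 0 l 1; rewrite mulr1 => h.
  have -> : (m + (a' - m) = a')%N by lia.
  apply: HG_cast (h _ _ _) => //; [rewrite /a; lia|rewrite /a'; lia|].
  by apply: gen_in; exists [::]; rewrite deg_nil lam_mon_nil.
by have := HGa_mul hx hl; rewrite addn2.
Qed.

(** Keeps the basis monomials for r only: a representative modulo Gamma(m, r) that is additive in
    the coefficients. *)
Definition bpart m s f : Lambda := lsum s (a' - m) (fun J =>
  if [&& in_basis r m J, m + deg J == a' & size J == s]%N then f J else 0).

Lemma bpart_HLa m s f : HLa m s a' (bpart m s f).
Proof.
apply: lsum_HLa => J; case: ifP; last by rewrite eqxx.
by move=> /and3P[h1 /eqP h2 /eqP h3] _; split=> //; apply: in_basis_Lambda h1.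
Qed.

Lemma bpart_coef m s f J : in_basis r m J -> (m + deg J)%N = a' -> size J = s ->
  coef J (bpart m s f) = f J.
Proof.
move=> h1 h2 h3; rewrite coef_lsum h1 h2 h3 !eqxx /= ifT //.
have := mem_bwords (in_Lambda_adm (in_basis_Lambda h1)).
by rewrite h3; have -> : deg J = (a' - m)%N by lia.
Qed.

Lemma bpart_eq m s x : HLa m s a' x -> HGa m r s a' (x - bpart m s (fun J => coef J x)).
Proof.
move=> hx; apply: coef_HGa => [|J hJ].
  exact: sg_memB hx (bpart_HLa _ _ _).
rewrite coef_zmod; have [c0|c0] := eqVneq (coef J x) 0; last first.
  by have [h1 h2 h3] := HLa_coef hx c0; rewrite bpart_coef // subrr.
rewrite c0 sub0r; apply/eqP; rewrite oppr_eq0; apply/eqP.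
by rewrite coef_lsum c0; case: ifP => // _; case: ifP.
Qed.

Lemma bpart_rho_sum m s f J : coef J (bpart m s f * lam l) =
  \sum_(I <- bwords s (a' - m)) (if [&& in_basis r m I, m + deg I == a' & size I == s]%N
   then f I else 0) * (rcons I l == J)%:R.
Proof.
rewrite /bpart /lsum mulr_suml raddf_sum; apply: eq_bigr => I _; case: ifP => h; last first.
  by rewrite scF0 mul0r raddf0 mul0r.
move: h => /and3P[h1 /eqP h2 _].
have -> : scF (f I) (lam_mon I) * lam l = scF (f I) (lam_mon (rcons I l)).
  by rewrite lam_mon_rcons; apply: (scFf (f := fun x => x * lam l)) (mulr_zmod _).
have /andP[hb _] : in_basis r.+1 m (rcons I l) && ~~ in_basis r m (rcons I l).
  by apply: in_basis_rcons => //; exact: esym h2.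
transitivity (scF (f I) (coef J (lam_mon (rcons I l)))).
  exact: (scFf _ _ (coef_zmod _)).
by rewrite coef_mon ?scF_F2 //; exact/in_Lambda_adm/in_basis_Lambda/hb.
Qed.

Lemma bpart_rho_coef m s f J : coef (rcons J l) (bpart m s f * lam l) =
  if [&& in_basis r m J, m + deg J == a' & size J == s]%N then f J else 0.
Proof.
rewrite bpart_rho_sum.
have hu : uniq (bwords s (a' - m)) by apply/filter_uniq/words_uniq.
case: ifP => h; last first.
  rewrite big1 // => I _; rewrite eqseq_rcons eqxx andbT.
  by case: (I =P J) => [->|_]; rewrite ?h ?mul0r ?mulr0.
move: (h) => /and3P[h1 /eqP h2 /eqP h3].
have hJ : J \in bwords s (a' - m).
  have := mem_bwords (in_Lambda_adm (in_basis_Lambda h1)).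
  by rewrite h3; have -> : deg J = (a' - m)%N by lia.
rewrite (bigD1_seq J) //= h eqxx mulr1 big1 ?addr0 // => I /negbTE IJ.
by rewrite eqseq_rcons IJ mulr0.
Qed.

Lemma bpart_rho_basis m s f J : in_basis r m J -> coef J (bpart m s f * lam l) = 0.
Proof.
move=> hJ; rewrite bpart_rho_sum big1 // => I _.
case: ifP => [/and3P[h1 /eqP h2 _]|_]; last by rewrite mul0r.
have /andP[_ hb] : in_basis r.+1 m (rcons I l) && ~~ in_basis r m (rcons I l).
  by apply: in_basis_rcons => //; exact: esym h2.
by case: eqP => [e|_]; rewrite ?mulr0 //; rewrite e hJ in hb.
Qed.

(** Appending l sends the basis words for r injectively to basis words for r + 1. *)
Lemma rho_inj m s x : HLa m s a' x -> HGa m r.+1 s.+1 a (x * lam l) -> HGa m r s a' x.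
Proof.
move=> hx hxl; have hb := bpart_eq hx; set b := bpart _ _ _ in hb.
have hbl : HGa m r.+1 s.+1 a (b * lam l).
  have -> : b * lam l = x * lam l - (x - b) * lam l by rewrite mulrBl opprB addrC subrK.
  exact: sg_memB hxl (HGa_rho hb).
apply: coef_HGa => // J hJ; have [//|c0] := eqVneq (coef J x) 0.
have [h1 h2 h3] := HLa_coef hx c0.
have /andP[hbs _] : in_basis r.+1 m (rcons J l) && ~~ in_basis r m (rcons J l).
  by apply: in_basis_rcons => //; exact: esym h2.
have := HGa_coef hbl hbs; rewrite bpart_rho_coef hJ h2 h3 !eqxx /=.
by move=> e; rewrite e eqxx in c0.
Qed.

(** By [in_basis_rconsP], the words J l account for all of Gamma(m, r) modulo Gamma(m, r+1) in this
    degree. *)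
Lemma rho_decomp m s x : HGa m r s.+1 a x ->
  HGa m r.+1 s.+1 a (x - bpart m s (fun J => coef (rcons J l) x) * lam l).
Proof.
move=> hx; set b := bpart _ _ _.
have hbL : HLa m s.+1 a (b * lam l) by apply/HLa_rho/bpart_HLa.
have hd : HLa m s.+1 a (x - b * lam l) by exact: sg_memB (HGa_HLa hx) hbL.
apply: coef_HGa => // J hJ; have [//|c0] := eqVneq (coef J (x - b * lam l)) 0.
have [h1 h3 h2] := HLa_coef hd c0.
have [hJr|hJr] := boolP (in_basis r m J); last first.
  have [J' [l' [eJ el hJ']]] := in_basis_rconsP hJ hJr; subst J.
  have ell : l' = l by move: h2 el; rewrite deg_rcons /a /a'; lia.
  subst l'; rewrite coef_zmod bpart_rho_coef hJ' ifT ?subrr //.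
  by move: h3; rewrite size_rcons -el !eqxx /= => -[->].
by rewrite coef_zmod (HGa_coef hx hJr) bpart_rho_basis // subrr.
Qed.

Lemma bpartB m s f g : bpart m s (fun J => f J - g J) = bpart m s f - bpart m s g.
Proof. by rewrite lsumB; apply: lsum_ext => J _; case: ifP; rewrite ?subrr. Qed.

End Rho.

Lemma sub_add_mul (R : pzRingType) (u v w x : R) : u * x + w - v * x = w + (u - v) * x.
Proof. by rewrite mulrBl [u * x + w]addrC addrA. Qed.

Lemma scFBl (V : zmodType) : exp2 V -> forall c d (v : V), scF (c - d) v = scF c v - scF d v.
Proof. by move=> V2 c d v; rewrite (exp2B exp2_F2) (scFDl V2) (exp2B V2). Qed.

Lemma rho_algebra (R : pzRingType) (u v x y S T : R) : T = S * v ->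
  u * v + x * y + T = (u + S) * v + x * y.
Proof. by move=> ->; rewrite mulrDl addrAC. Qed.

Lemma telescope3 (V : zmodType) (a b c d : V) : a - d = (a - b) + ((b - c) - (d - c)).
Proof. by rewrite [- (d - c)]opprB [b - c + _]addrA subrK addrA subrK. Qed.

(** * Acyclicity of the cochains on a regular module *)

Section AcyclicLemmas.
Variables (K : nat) (M : rmodule (Qk K)).

Lemma DcB r (c c' : cfam M) m z :
  @Dc K M r (fun m z => @c m z - @c' m z) m z = @Dc K M r c m z - @Dc K M r c' m z.
Proof.
rewrite /Dc (appB lambda_d) opprD addrACA; congr (_ + _).
by rewrite -sumrB; apply: eq_bigr => i _; rewrite mulrBr.
Qed.

(** The new term is lambda_(i-1) c(Sq^i z) with m - i = r; its first letter has lower index r, so it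
    lies in Gamma(m, r). *)
Lemma Dc_step r (c : cfam M) s a m z : (forall m, zmod_morphism (@c m)) ->
  (forall m z, HLa m s a (@c m z)) -> HGa m r s.+1 a (@Dc K M r.+1 c m z - @Dc K M r c m z).
Proof.
move=> cB hc; rewrite /Dc opprD addrACA subrr add0r -sumrB.
apply: sg_sum => i; rewrite mem_index_iota => im.
rewrite -mulrBr -cB.
have [i0|i0] := posnP i.
  by subst i; rewrite !msqr_eq0 // subrr (c0 cB) mulr0; apply: sg_mem0.
have [e|ne] := eqVneq m (i + r)%N.
  apply: prodGa_first; first by lia.
  have -> : ((m + (i - 1)).+1 = m + i)%N by lia.
  exact: hc.
rewrite /msqr; have -> : (m < i + r.+1)%N = (m < i + r)%N by lia.
by rewrite subrr (c0 cB) mulr0; apply: sg_mem0.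
Qed.

Definition rhoF l (c : cfam M) : cfam M := fun m z => @c m z * lam l.

Lemma Dc_rhoE r l (c : cfam M) m z :
  @Dc K M r (rhoF l c) m z = @Dc K M r c m z * lam l + @c m z * ld (lam l).
Proof.
rewrite /Dc /rhoF ldM; apply: rho_algebra.
by rewrite mulr_suml; apply: eq_bigr => i _; rewrite mulrA.
Qed.

(** Appending l commutes with the differentials modulo Gamma(m, r+1). Of the two errors, c
    d(lambda_l) has larger lower indices, and the one from [Dc_step] moves from Gamma(m, r) to
    Gamma(m, r+1) when l is appended. *)
Lemma Dc_rho r l (c : cfam M) s m z : (forall m, zmod_morphism (@c m)) ->
  (forall m z, HLa m s (l + r.+1) (@c m z)) ->
  HGa m r.+1 s.+2 (l + r.+1 + l.+1) (@Dc K M r.+1 (rhoF l c) m z - @Dc K M r c m z * lam l).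
Proof.
move=> cB hc; rewrite Dc_rhoE sub_add_mul.
have h1 := HGa_mul_dlam (hc m z); have h2 := HGa_rho (Dc_step r z cB hc).
exact: sg_memD h1 h2.
Qed.

Lemma HLa0_nil m a x : HLa m 0 a x -> x = scF (coef [::] x) 1 /\ (m != a -> x = 0).
Proof.
elim=> {x} [x [J [h1 h2 h3 ->]]||x y _ [hx hx'] _ [hy hy']].
- case: J h1 h2 h3 => // _ _; rewrite deg_nil addn0 lam_mon_nil => ->; rewrite eqxx.
  by rewrite -lam_mon_nil coef_mon.
- by rewrite raddf0.
split; last by move=> ma; rewrite hx' // hy' // subrr.
by rewrite coef_zmod (scFBl Lambda2) -hx -hy.
Qed.

Lemma in_basis_bot : forall m s a x, HLa m s.+1 a x -> HGa m 0 s.+1 a x.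
Proof.
move=> m s a x hx; apply: coef_HGa => // J; case: J => [|i J]; last by rewrite in_basis0.
move=> _; have [//|c0] := eqVneq (coef [::] x) 0.
by have [] := HLa_coef hx c0.
Qed.

End AcyclicLemmas.

Section KernelSubgroup.
Variables (V W : zmodType) (f : Hom V W).
Lemma kersg0 : app f 0 = 0. Proof. exact: raddf0. Qed.
Lemma kersgB x y : app f x = 0 -> app f y = 0 -> app f (x - y) = 0.
Proof. by move=> fx fy; rewrite appB fx fy subrr. Qed.
Definition kersg := @Subgroup V (fun x => app f x = 0) kersg0 kersgB.
End KernelSubgroup.

Lemma sum_single (V : zmodType) (F : nat -> V) n i : (i < n)%N ->
  (forall j, (j < n)%N -> j != i -> F j = 0) -> \sum_(0 <= j < n) F j = F i.
Proof.
move=> i_n h; rewrite big_mkord (bigD1 (Ordinal i_n)) //= big1 ?addr0 // => j ji.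
exact: h.
Qed.

Lemma scF1_comm (c : 'F_2) (x : Lambda) : scF c 1 * x = x * scF c 1.
Proof. by have [->|->] := F2P c; rewrite ?scF0 ?scF1 ?mul0r ?mulr0 ?mul1r ?mulr1. Qed.

Lemma ld_scF1 c : ld (scF c 1) = 0.
Proof. by have [->|->] := F2P c; rewrite ?scF0 ?scF1 ?raddf0 ?ld1. Qed.

Section Transport.
Variables (K : nat) (M : rmodule (Qk K)).

Lemma tr_neq (b c : int) (y : M b) : b <> c -> tr c y = 0.
Proof. by rewrite /tr; case: pselect. Qed.

Lemma tr_msqr r i m n a z : n = a -> tr a%:Z (@msqr K M r i m n z) = @msqr K M r i m a z.
Proof. by move=> ->; apply: tr_id. Qed.

End Transport.

Section Acyclic.
Variables (K : nat) (M : rmodule (Qk K)).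
Hypothesis regM : regular M.

Definition acyclic_at r s := forall a (c : cfam M), (forall m, zmod_morphism (@c m)) ->
  (forall m z, HLa m s.+1 a (@c m z)) ->
  (forall m z, HGa m r s.+2 a (@Dc K M r c m z)) ->
  exists y : cfam M, [/\ forall m, zmod_morphism (@y m), forall m z, HLa m s a (@y m z) &
    forall m z, HGa m r s.+1 a (@c m z - @Dc K M r y m z)].

(* A cocycle of length 0 is a functional vanishing on decomposables; regularity
   lets it be transported along Sq^{l+1}. *)
Lemma tail0 r l (c' : cfam M) : (r < K)%N -> (forall m, zmod_morphism (@c' m)) ->
  (forall m z, HLa m 0 (l + r.+1) (@c' m z)) ->
  (forall m z, HGa m r 1 (l + r.+1) (@Dc K M r c' m z)) ->
  exists y : cfam M, [/\ forall m, zmod_morphism (@y m),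
    forall m z, HLa m 0 (l + r.+1 + l.+1) (@y m z) &
    forall m z, @c' m z * lam l = @Dc K M r.+1 y m z].
Proof.
move=> rK cB hc hd; set a' := (l + r.+1)%N in hc hd *; set a := (a' + l.+1)%N.
have ea : a = (a' + l.+1)%N by [].
clearbody a; have ea' : a' = (l + r.+1)%N by [].
clearbody a'.
have fB : zmod_morphism (fun z : M a'%:Z => coef [::] (@c' a' z)).
  by move=> x y; rewrite cB coef_zmod.
pose f := mkHom fB.
have gB : zmod_morphism (@msq K M l.+1 a' a) by apply: msqB.
pose g := mkHom gB.
(* For z of degree a' - i, the only term of [Dc r c'] is lambda_(i-1) times f(Sq^i z), and
   lambda_(i-1) is a basis element for r. *)
have fDec u : Dec M r a' u -> app f u = 0.
  apply: (gen_min (P := kersg f)) => _ [i [m [z [im mr e ->]]]]; rewrite /kersg /=.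
  have := HGa_coef (hd m z) (J := [:: (i - 1)%N]); rewrite in_basis1.
  move=> /(_ ltac:(lia)); rewrite /Dc.
  have [_ c0'] := HLa0_nil (hc m z); rewrite c0' ?raddf0 ?add0r; [|by lia].
  rewrite (@sum_single _ _ _ i); [|by lia|]; last first.
    move=> j jm ji; have [_ cj] := HLa0_nil (hc (m + j)%N (@msqr K M r j m (m + j) z)).
    by rewrite cj ?mulr0 //; lia.
  rewrite (@c_cast _ _ r c' (m + i)%N a' i m z e).
  have [-> _] := HLa0_nil (hc a' (@msqr K M r i m a' z)).
  rewrite -scF1_comm.
  have -> : @msqr K M r i m a' z = @msq K M i m a' z by rewrite /msqr mr.
  rewrite -[coef [::] _]/(app f (@msq K M i m a' z)).
  have [->|->] := F2P (app f (@msq K M i m a' z)) => //.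
  rewrite scF1 mul1r -[lam _]mulr1 -lam_mon_nil -lam_mon_cons coef_mon // eqxx.
  by move/eqP; rewrite oner_eq0.
(* Since a' - (l + 1) = r, the map g is Sq_r, and regularity takes u back to [Dec]. *)
have gD u : Dec M r a (app g u) -> app f u = 0.
  move=> hu; apply: fDec; apply: (regM rK (ltn0Sn l)); first by lia.
  by rewrite -ea.
have [h [hD hg]] := functional_extension (@module2 K M a%:Z) gD.
exists (fun m z => scF (app h (tr a%:Z z)) 1); split.
- by move=> m x y; rewrite trB appB (scFBl Lambda2).
- move=> m z; have [e|ne] := eqVneq m a; last first.
    rewrite tr_neq; last by move=> [e]; rewrite e eqxx in ne.
    by rewrite raddf0 scF0; apply: sg_mem0.
  apply: sg_Mn => _; apply: gen_in; exists [::]; split=> //; last by rewrite lam_mon_nil.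
  by rewrite deg_nil addn0.
move=> m z; rewrite /Dc ld_scF1 add0r.
have [e|ne] := eqVneq m a'; last first.
  have [_ ->] := HLa0_nil (hc m z); last by [].
  rewrite mul0r big_nat big1 // => i im.
  have [e|ne'] := eqVneq (m + i)%N a; last first.
    rewrite tr_neq; last by move=> [e]; rewrite e eqxx in ne'.
    by rewrite raddf0 scF0 mulr0.
  rewrite tr_msqr // /msqr; case: ifP => mr; last by rewrite raddf0 scF0 mulr0.
  have [i0|i0] := posnP i; first by subst i; rewrite /msq /= raddf0 scF0 mulr0.
  rewrite hD; first by rewrite scF0 mulr0.
  by apply: Dec_in => //; lia.
subst m; rewrite (@sum_single _ _ _ l.+1); [|by lia|]; last first.
  move=> i im il; rewrite tr_neq; last by move=> [e]; lia.
  by rewrite raddf0 scF0 mulr0.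
rewrite tr_msqr; last exact: esym ea.
rewrite /msqr ifT; last by lia.
rewrite -[@msq K M l.+1 a' a z]/(app g z) hg subn1 /= -scF1_comm.
by have [-> _] := HLa0_nil (hc a' z).
Qed.

(** By [rho_inj], splitting off l turns c1 into a cocycle c' modulo Gamma(m, r), one letter shorter.
    Appending l to a primitive of c' gives one of c1; in length 0, [tail0] supplies it directly. *)
Lemma tail r l s (c1 : cfam M) : (r < K)%N -> (forall s', s = s'.+1 -> acyclic_at r s') ->
  (forall m, zmod_morphism (@c1 m)) ->
  (forall m z, HGa m r s.+1 (l + r.+1 + l.+1) (@c1 m z)) ->
  (forall m z, HGa m r.+1 s.+2 (l + r.+1 + l.+1) (@Dc K M r.+1 c1 m z)) ->
  exists y : cfam M, [/\ forall m, zmod_morphism (@y m),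
    forall m z, HLa m s (l + r.+1 + l.+1) (@y m z) &
    forall m z, HGa m r.+1 s.+1 (l + r.+1 + l.+1) (@c1 m z - @Dc K M r.+1 y m z)].
Proof.
move=> rK IH cB hc hd.
pose c' : cfam M := fun m z => bpart r l m s (fun J => coef (rcons J l) (@c1 m z)).
have c'B m : zmod_morphism (@c' m).
  move=> x y; rewrite /c' -bpartB; congr bpart.
  by apply: functional_extensionality_dep => J; rewrite cB coef_zmod.
have hc' m z : HLa m s (l + r.+1) (@c' m z) by apply: bpart_HLa.
have hr m z : HGa m r.+1 s.+1 (l + r.+1 + l.+1) (@c1 m z - @rhoF K M l c' m z).
  exact: rho_decomp (hc m z).
have rB m : zmod_morphism (@rhoF K M l c' m).
  by move=> x y; rewrite /rhoF c'B mulrBl.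
have crB m : zmod_morphism (fun z => @c1 m z - @rhoF K M l c' m z).
  by move=> x y; rewrite cB rB subrACA.
have hd1 m z : HGa m r.+1 s.+2 (l + r.+1 + l.+1) (@Dc K M r.+1 (rhoF l c') m z).
  have h1 := @Dc_HG K M r.+1 _ crB r.+1 s.+1 _ hr m z; rewrite DcB in h1.
  have := sg_memB (hd m z) h1; rewrite opprB addrC subrK; exact.
have hd2 m z : HGa m r s.+1 (l + r.+1) (@Dc K M r c' m z).
  apply: rho_inj; first exact: Dc_HL.
  have := sg_memB (hd1 m z) (Dc_rho z c'B hc'); rewrite opprB addrC subrK; exact.
case: s IH hc hd c' c'B hc' hr rB crB hd1 hd2 => [|s] IH hc hd c' c'B hc' hr rB crB hd1 hd2.
  have [y [yB hy ye]] := tail0 rK c'B hc' hd2.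
  by exists y; split; [exact: yB|exact: hy|by move=> m z; rewrite -ye; apply: hr].
have [y' [yB hy ye]] := IH _ erefl _ c' c'B hc' hd2.
exists (rhoF l y'); split=> [m|m z|m z].
- by move=> u v; rewrite /rhoF yB mulrBl.
- exact: HLa_rho.
have h1 := HGa_rho (ye m z); have h2 := Dc_rho z yB hy.
have -> : @c1 m z - @Dc K M r.+1 (rhoF l y') m z = (@c1 m z - @rhoF K M l c' m z) +
   ((@c' m z - @Dc K M r y' m z) * lam l -
    (@Dc K M r.+1 (rhoF l y') m z - @Dc K M r y' m z * lam l)).
  by rewrite mulrBl -telescope3.
exact: sg_memD (hr m z) (sg_memB h1 h2).
Qed.

Lemma acyclic r s : (r <= K)%N -> acyclic_at r s.
Proof.
elim: r s => [|r IH] s rK a c cB hc hd.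
  exists (fun m z => 0); split=> [m x y|m z|m z]; first by rewrite subr0.
    exact: sg_mem0.
  apply: in_basis_bot; apply: sg_memB => //.
  rewrite /Dc raddf0 big1 ?addr0 => [|i _]; last by rewrite mulr0.
  exact: sg_mem0.
(* By [Dc_step], c is also a cocycle for the smaller index r, modulo Gamma(m, r). *)
have hd0 m z : HGa m r s.+2 a (@Dc K M r c m z).
  have h1 := HGa_mono (leqnSn r) (hd m z).
  have := sg_memB h1 (Dc_step r z cB hc); rewrite opprB addrC subrK; exact.
have [y0 [y0B hy0 ye0]] := IH s (ltnW rK) a c cB hc hd0.
pose c1 : cfam M := fun m z => @c m z - @Dc K M r.+1 y0 m z.
have c1B m : zmod_morphism (@c1 m).
  by move=> x y; rewrite /c1 cB (Dc_zmod _ y0B) subrACA.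
have hc1 m z : HGa m r s.+1 a (@c1 m z).
  have := sg_memB (ye0 m z) (Dc_step r z y0B hy0).
  by rewrite opprB addrA subrK.
have hd1 m z : HGa m r.+1 s.+2 a (@Dc K M r.+1 c1 m z).
  by rewrite /c1 DcB; apply: sg_memB (hd m z) (DD z rK y0B hy0).
(* Without such an l, no word of absolute degree a has last lower index exactly r, so Gamma(m, r)
   and Gamma(m, r+1) agree in this degree. *)
have [[l el]|nl] := pselect (exists l, a = l + r.+1 + l.+1)%N; last first.
  exists y0; split; [exact: y0B|exact: hy0|move=> m z].
  change (HGa m r.+1 s.+1 a (@c1 m z)); apply: coef_HGa => [|J hJ].
    exact: HGa_HLa (hc1 m z).
  have [//|c0] := eqVneq (coef J (@c1 m z)) 0; exfalso.
  have [h1 h2 h3] := HLa_coef (HGa_HLa (hc1 m z)) c0.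
  have hJr : ~~ in_basis r m J by apply: contraNN c0 => hJr; apply/eqP/(HGa_coef (hc1 m z)).
  have [J' [l' [eJ el hJ']]] := in_basis_rconsP hJ hJr.
  by apply: nl; exists l'; move: h3; rewrite eJ deg_rcons; lia.
subst a.
have [||y [yB hy ye]] := @tail r l s c1 _ _ c1B hc1 hd1; first by [].
  by move=> s' _; apply: IH; lia.
exists (fun m z => @y0 m z - @y m z); split=> [m u v|m z|m z].
- by rewrite y0B yB subrACA.
- exact: sg_memB (hy0 m z) (hy m z).
have h1 := ye m z; rewrite (exp2B Lambda2) in h1.
rewrite DcB opprB addrA addrAC.
exact: h1.
Qed.

End Acyclic.

(** * Cochains modulo Gamma, in coordinates *)

Section Cochains.
Variables (K : nat) (M : rmodule (Qk K)) (s a : nat).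

Definition Cf : zmodType := prodz (fun _ : seq nat => prodz (fun m : nat => dual M m)).

Definition ok J m := [&& in_basis K m J, size J == s & m + deg J == a]%N.

Definition Ch_mem (c : Cf) : Prop := forall J m, ~~ ok J m -> c J m = 0.

Lemma Ch0 : Ch_mem 0. Proof. by []. Qed.
Lemma ChB c c' : Ch_mem c -> Ch_mem c' -> Ch_mem (c - c').
Proof. by move=> hc hc' J m h; rewrite -[LHS]/(c J m - c' J m) hc // hc' // subrr. Qed.

(** Coordinates at the basis words model the quotient by Gamma, so exactness in the module variable
    can be checked one functional at a time. *)
Definition Ch : zmodType := sub (Subgroup Ch0 ChB).

Definition cv (c : Ch) J m (z : M m%:Z) : 'F_2 := app (val c J m) z.

Lemma cv_ok (c : Ch) J m z : ~~ ok J m -> @cv c J m z = 0.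
Proof. by move=> h; rewrite /cv (subP c J m h). Qed.

Lemma cvBl (c c' : Ch) J m z : @cv (c - c') J m z = @cv c J m z - @cv c' J m z.
Proof. by []. Qed.

Lemma cvB (c : Ch) J m : zmod_morphism (@cv c J m).
Proof. exact: appB. Qed.

Lemma Ch_ext (c c' : Ch) : (forall J m z, ok J m -> @cv c J m z = @cv c' J m z) -> c = c'.
Proof.
move=> h; apply: val_inj; apply: functional_extensionality_dep => J.
apply: functional_extensionality_dep => m; apply: val_inj.
apply: functional_extensionality_dep => z.
have [o|o] := boolP (ok J m); first exact: h.
by transitivity (0 : 'F_2); [exact: cv_ok|apply/esym; exact: cv_ok].
Qed.

Lemma mkCh_subproof (f : forall J m, M m%:Z -> 'F_2) (fB : forall J m, zmod_morphism (f J m)) :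
  Ch_mem (fun J m => if ok J m then mkHom (fB J m) else 0).
Proof. by move=> J m /negbTE ->. Qed.

Definition mkCh f fB : Ch := @mksub Cf (Subgroup Ch0 ChB) _ (@mkCh_subproof f fB).

Lemma cv_mk f fB J m z : @cv (@mkCh f fB) J m z = if ok J m then f J m z else 0.
Proof. by rewrite /cv /mkCh /mksub /=; case: ifP. Qed.

Definition toL (c : Ch) : cfam M := fun m z => lsum s (a - m) (fun J => @cv c J m z).

Lemma toLB c m : zmod_morphism (@toL c m).
Proof. by move=> x y; rewrite /toL lsumB; apply: lsum_ext => J _; apply: cvB. Qed.

Lemma toLBl c c' m z : @toL (c - c') m z = @toL c m z - @toL c' m z.
Proof. by rewrite /toL lsumB. Qed.

Lemma toL_HLa c m z : HLa m s a (@toL c m z).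
Proof.
apply: lsum_HLa => J cJ.
have /and3P[h1 /eqP h2 /eqP h3] : ok J m by apply: contraNT cJ => o; rewrite cv_ok.
by split=> //; apply: in_basis_Lambda h1.
Qed.

Lemma ok_bwords J m : ok J m -> J \in bwords s (a - m).
Proof.
case/and3P=> h1 /eqP h2 /eqP h3.
have := mem_bwords (in_Lambda_adm (in_basis_Lambda h1)).
by rewrite h2; have -> : deg J = (a - m)%N by lia.
Qed.

Lemma coef_toL c J m z : ok J m -> coef J (@toL c m z) = @cv c J m z.
Proof. by move=> o; rewrite coef_lsum ok_bwords. Qed.

Definition ofL (y : cfam M) (yB : forall m, zmod_morphism (@y m)) : Ch :=
  @mkCh (fun J m z => coef J (@y m z))
    (fun J m u v => etrans (congr1 (coef J) (yB m u v)) (coef_zmod J _ _)).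

Lemma cv_ofL y yB J m z : ok J m -> @cv (@ofL y yB) J m z = coef J (@y m z).
Proof. by move=> o; rewrite cv_mk o. Qed.

Lemma ofL_eq y yB y' y'B : (forall m z, HGa m K s a (@y m z - @y' m z)) ->
  @ofL y yB = @ofL y' y'B.
Proof.
move=> h; apply: Ch_ext => J m z o; rewrite !cv_ofL //; apply/eqP.
rewrite -subr_eq0 -coef_zmod; apply/eqP; apply: HGa_coef (h m z) _.
by case/and3P: o.
Qed.

Lemma toL_ofL y yB : (forall m z, HLa m s a (@y m z)) ->
  forall m z, HGa m K s a (@toL (@ofL y yB) m z - @y m z).
Proof.
move=> hy m z; apply: coef_HGa => [|J hJ]; first exact: sg_memB (toL_HLa _ _) (hy m z).
rewrite coef_zmod; have [o|o] := boolP (ok J m).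
  by rewrite coef_toL // cv_ofL // subrr.
have -> : coef J (@toL (@ofL y yB) m z) = 0.
  apply/eqP; apply: contraNT o => c0; have [h1 h2 h3] := HLa_coef (toL_HLa _ _) c0.
  by rewrite /ok hJ h2 h3 !eqxx.
have -> : coef J (@y m z) = 0; last exact: subrr.
apply/eqP; apply: contraNT o => c0; have [h1 h2 h3] := HLa_coef (hy m z) c0.
by rewrite /ok hJ h2 h3 !eqxx.
Qed.

Lemma ofL_HGa y yB : (forall m z, HLa m s a (@y m z)) -> @ofL y yB = 0 ->
  forall m z, HGa m K s a (@y m z).
Proof.
move=> hy h0 m z; have := toL_ofL yB hy z; rewrite h0.
have -> : @toL 0 m z = 0 by rewrite /toL /lsum big1 // => J _; rewrite scF0.
by rewrite sub0r => /sg_memN; rewrite opprK.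
Qed.

Lemma ofL_toL c (cB : forall m, zmod_morphism (@toL c m)) : ofL cB = c.
Proof. by apply: Ch_ext => J m z o; rewrite cv_ofL // coef_toL. Qed.

End Cochains.

Section CochainDifferential.
Variables (K : nat) (M : rmodule (Qk K)) (a : nat).

Definition dChf s (c : Ch M s a) : Ch M s.+1 a := ofL s.+1 a (@Dc_zmod K M K _ (@toLB K M s a c)).

Lemma cv_dChf s (c : Ch M s a) J m z : ok K s.+1 a J m ->
  @cv K M s.+1 a (dChf c) J m z = coef J (@Dc K M K (toL c) m z).
Proof. exact: cv_ofL. Qed.

Lemma Dc_toLB s (c c' : Ch M s a) m z :
  @Dc K M K (toL (c - c')) m z = @Dc K M K (toL c) m z - @Dc K M K (toL c') m z.
Proof.
rewrite -DcB; congr (@Dc K M K _ m z).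
by apply: functional_extensionality_dep => m'; apply: functional_extensionality_dep => z';
  apply: toLBl.
Qed.

Lemma dChB s : zmod_morphism (@dChf s).
Proof.
move=> c c'; apply: Ch_ext => J m z o.
have e := congr2 (fun x y : 'F_2 => x - y) (cv_dChf c z o) (cv_dChf c' z o).
apply: (etrans (cv_dChf (c - c') z o)); apply: etrans (esym e).
by rewrite Dc_toLB coef_zmod.
Qed.

Definition dCh s : Hom (Ch M s a) (Ch M s.+1 a) := mkHom (@dChB s).

(** Since [Dc] preserves Gamma, the differential may be computed on any lift, not only on [toL]. *)
Lemma dCh_ofL s (y : cfam M) (yB : forall m, zmod_morphism (@y m)) :
  (forall m z, HLa m s a (@y m z)) ->
  app (dCh s) (ofL s a yB) = ofL s.+1 a (@Dc_zmod K M K y yB).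
Proof.
move=> hy; apply: ofL_eq => m z; rewrite -DcB; apply: Dc_HG => [m' u v|m' z'].
  by rewrite toLB yB subrACA.
exact: toL_ofL.
Qed.

Lemma dCh_dCh s c : app (dCh s.+1) (app (dCh s) c) = 0.
Proof.
rewrite [app (dCh s) c]/(ofL _ _ _) dCh_ofL; last exact: (@Dc_HL K M K _ (@toLB K M _ _ c) _ _ (@toL_HLa K M _ _ c)).
apply: Ch_ext => J m z o; transitivity (0 : 'F_2); last by [].
apply: (etrans (cv_ofL _ z o)).
by apply: HGa_coef (DD z (leqnn K) (@toLB K M s a c) (@toL_HLa K M s a c)) _; case/and3P: o.
Qed.

Lemma dCh_exact s (c : Ch M s.+1 a) : regular M -> app (dCh s.+1) c = 0 ->
  exists y, app (dCh s) y = c.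
Proof.
move=> regM dc.
have hd : forall m z, HGa m K s.+2 a (@Dc K M K (toL c) m z).
  apply: (ofL_HGa _ dc); exact: (@Dc_HL K M K _ (@toLB K M _ _ c) _ _ (@toL_HLa K M _ _ c)).
have [y [yB hy ye]] := acyclic regM (leqnn K) (@toLB K M _ _ c) (@toL_HLa K M _ _ c) hd.
exists (ofL s a yB); rewrite dCh_ofL // -[RHS](ofL_toL (@toLB K M _ _ c)).
by apply: ofL_eq => m z; rewrite -opprB; apply: sg_memN.
Qed.

End CochainDifferential.

(** * Functoriality and exactness in the module *)

Section Pullback.
Variables (K a : nat).

Section OneMap.
Variables (M N : rmodule (Qk K)) (f : Nat M N).

Definition pullf s (c : Ch N s a) : Ch M s a :=
  @mkCh K M s a (fun J m z => @cv K N s a c J m (napp f m%:Z z))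
    (fun J m u v => etrans (congr1 (@cv K N s a c J m) (raddfB (napp f m%:Z) u v)) (cvB c J _ _)).

Lemma cv_pull s (c : Ch N s a) J m z :
  @cv K M s a (pullf c) J m z = @cv K N s a c J m (napp f m%:Z z).
Proof.
rewrite /pullf cv_mk; case: ifP => // o.
by apply/esym; apply: cv_ok; rewrite o.
Qed.

Lemma pullB s : zmod_morphism (@pullf s).
Proof.
move=> c c'; apply: Ch_ext => J m z o; apply: (etrans (@cv_pull s (c - c') J m z)).
exact: esym (congr2 (fun x y : 'F_2 => x - y) (@cv_pull s c J m z) (@cv_pull s c' J m z)).
Qed.

Definition pull s : Hom (Ch N s a) (Ch M s a) := mkHom (@pullB s).

Lemma toL_pull s (c : Ch N s a) m z : @toL K M s a (pullf c) m z = @toL K N s a c m (napp f m%:Z z).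
Proof. by apply: lsum_ext => J _; apply: cv_pull. Qed.

Lemma napp_msqr r i m n z : napp f n%:Z (@msqr K M r i m n z) = @msqr K N r i m n (napp f m%:Z z).
Proof. by rewrite /msqr; case: ifP => _; [apply: napp_msq|rewrite raddf0]. Qed.

Lemma Dc_pull s (c : Ch N s a) m z :
  @Dc K M K (toL (pullf c)) m z = @Dc K N K (toL c) m (napp f m%:Z z).
Proof.
have e : \sum_(0 <= i < m.+1) lam (i - 1) * @toL K M s a (pullf c) (m + i)%N (@msqr K M K i m (m + i) z) =
  \sum_(0 <= i < m.+1) lam (i - 1) * @toL K N s a c (m + i)%N (@msqr K N K i m (m + i) (napp f m%:Z z)).
  by apply: eq_bigr => i _; rewrite toL_pull napp_msqr.
exact: (congr2 (fun x y : Lambda => ld x + y) (toL_pull c z) e).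
Qed.

Lemma pull_dCh s (c : Ch N s a) : app (pull s.+1) (app (dCh N a s) c) = app (dCh M a s) (app (pull s) c).
Proof.
apply: Ch_ext => J m z o; apply: (etrans (@cv_pull s.+1 (dChf c) J m z)).
apply: (etrans (@cv_dChf K N a s c J m _ o)); apply: etrans (esym (@cv_dChf K M a s (pullf c) J m z o)).
by rewrite Dc_pull.
Qed.

Lemma pull_inj s (c : Ch N s a) : (forall b (y : N b), exists x, napp f b x = y) ->
  app (pull s) c = 0 -> c = 0.
Proof.
move=> surj c0; apply: Ch_ext => J m y o; have [x <-] := surj _ y.
by apply: (etrans (esym (@cv_pull s c J m x))); rewrite -[pullf c]/(app (pull s) c) c0.
Qed.

End OneMap.

(** Each coordinate vanishes on the kernel of g, hence descends to the image of g and extends to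
    N. *)
Lemma pull_factor L M N (f : Nat L M) (g : Nat M N) s (c : Ch M s a) :
  (forall b (x : M b), napp g b x = 0 -> exists y, napp f b y = x) ->
  app (pull f s) c = 0 -> exists c', app (pull g s) c' = c.
Proof.
move=> ex fc.
have h J m : exists h : Hom (N m%:Z) 'F_2, forall u, app h (napp g m%:Z u) = @cv K M s a c J m u.
  pose gH := mkHom (raddfB (napp g m%:Z) : zmod_morphism (napp g m%:Z)).
  (* The subgroup to be annihilated is 0, written as the kernel of the identity. *)
  have D0 : forall u, kersg (mkHom (fun x y : N m%:Z => erefl (x - y))) (app gH u) -> app (val c J m) u = 0.
    move=> u /= /ex [y <-]; have := @cv_pull L M f s c J m y.
    by rewrite -[pullf f c]/(app (pull f s) c) fc.
  have [h [_ hE]] := functional_extension (@module2 K N m%:Z) D0.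
  by exists h.
pose hh J m := projT1 (cid (h J m)).
have hhE J m u : app (hh J m) (napp g m%:Z u) = @cv K M s a c J m u.
  exact: (projT2 (cid (h J m))).
exists (@mkCh K N s a (fun J m z => app (hh J m) z) (fun J m => appB (hh J m))).
apply: Ch_ext => J m z o; apply: (etrans (@cv_pull M N g s _ J m z)).
by rewrite cv_mk o hhE.
Qed.

Lemma pull_comp0 L M N (f : Nat L M) (g : Nat M N) s (c : Ch N s a) :
  (forall b (x : L b), napp g b (napp f b x) = 0) -> app (pull f s) (app (pull g s) c) = 0.
Proof.
move=> gf; apply: Ch_ext => J m z o; apply: (etrans (@cv_pull L M f s (pullf g c) J m z)).
apply: (etrans (@cv_pull M N g s c J m _)); rewrite gf; exact: (zmorph0 (@cvB K N s a c J m)).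
Qed.

End Pullback.

(** * The double complex of a projective resolution *)

Section ModelCohomology.
Variables (K : nat) (M : rmodule (Qk K)) (a : nat).

Definition Hcob_mem s : Ch M s a -> Prop :=
  if s is s'.+1 then fun c => exists y, c = app (dCh M a s') y else fun c => c = 0.

Lemma Hcob0 s : @Hcob_mem s 0.
Proof. by case: s => [|s] //; exists 0; rewrite raddf0. Qed.
Lemma HcobB s c c' : @Hcob_mem s c -> @Hcob_mem s c' -> @Hcob_mem s (c - c').
Proof.
case: s c c' => [|s] c c'; first by move=> -> ->; apply: subr0.
by move=> [y ->] [y' ->]; exists (y - y'); rewrite appB.
Qed.

Definition Hmod s : zmodType := subquo (kersg (dCh M a s)) (Subgroup (Hcob0 s) (@HcobB s)).

End ModelCohomology.

Section Resolution.
Variables (K : nat) (M : rmodule (Qk K)) (P : projective_resolution M) (a : nat).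

Let A p q : zmodType := Ch (P p) q a.
Let d p q : Hom (A p q) (A p q.+1) := dCh (P p) a q.
Let h p q : Hom (A p q) (A p.+1 q) := pull a (res_d P p) q.

Lemma dc_dd p q x : app (d p q.+1) (app (d p q) x) = 0. Proof. exact: dCh_dCh. Qed.
Lemma res_dd p b (x : P p.+2 b) : napp (res_d P p) b (napp (res_d P p.+1) b x) = 0.
Proof. by apply/res_exact; exists x. Qed.
Lemma dc_hh p q x : app (h p.+1 q) (app (h p q) x) = 0.
Proof. by apply: pull_comp0 => b y; apply: res_dd. Qed.
Lemma dc_hd p q x : app (h p q.+1) (app (d p q) x) = app (d p.+1 q) (app (h p q) x).
Proof. exact: pull_dCh. Qed.
Lemma dc_d_exact p q x : app (d p q.+1) x = 0 -> exists y, app (d p q) y = x.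
Proof. by move=> dx; apply: dCh_exact => //; apply/projective_regular/res_proj. Qed.
Lemma dc_h_exact p q x : app (h p.+1 q) x = 0 -> exists y, app (h p q) y = x.
Proof. by apply: pull_factor => b y /res_exact. Qed.

(** Pulling back along the augmentation identifies the cochains on M with the kernels of h on
    P_0. *)
Lemma Hmod_T0s s : isomorphic (Hmod M a s) (subquo (dc_cycle d h 0 s) (left_bound d h 0 s)).
Proof.
pose e q : Hom (Ch M q a) (A 0 q) := pull a (res_aug P) q.
have ed q x : app (e q.+1) (app (dCh M a q) x) = app (d 0 q) (app (e q) x) by exact: pull_dCh.
have e_inj q x : app (e q) x = 0 -> x = 0 by apply: pull_inj; apply: res_surj.
have he q x : app (h 0 q) (app (e q) x) = 0.
  by apply: pull_comp0 => b y; apply/res_exact0; exists y.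
have e_ex q x : app (h 0 q) x = 0 -> exists y, app (e q) y = x.
  by apply: pull_factor => b y /res_exact0.
apply: (subquo_iso (R := fun u v => v = app (e s) u)) => [u v u' v' -> ->|u du|v [dv hv]|u v du [dv hv] ->].
- by rewrite appB.
- by exists (app (e s) u) => //; split; [rewrite -ed [app _ u]du raddf0|apply: he].
- have [u ue] := e_ex _ _ hv; exists u => //.
  by apply: e_inj; rewrite ed ue.
case: s u v du dv hv => [|s] u v du dv hv.
  by split=> [->|/e_inj //]; rewrite /= raddf0.
split=> [[y ->]|[y hy ey]]; first by exists (app (e s) y); [apply: he|rewrite ed].
have [z ez] := e_ex _ _ hy; exists z; apply/eqP; rewrite -subr_eq0; apply/eqP/e_inj.
by rewrite appB ey ed ez subrr.
Qed.

End Resolution.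

Lemma nappBl (R : ringoid) (L N : rmodule R) (f f' : Nat L N) b z :
  napp (f - f') b z = napp f b z - napp f' b z.
Proof. by []. Qed.

(** * Cochains of length 0 and maps to spheres *)

Section SphereCochains.
Variables (K : nat) (N : rmodule (Qk K)) (a : nat).

Lemma ok_nil m : ok K 0 a [::] m = (m == a).
Proof. by rewrite /ok /in_basis /in_Lambda /in_Gamma /= deg_nil addn0. Qed.

Lemma toL0 (u : Ch N 0 a) m z : m != a -> @toL K N 0 a u m z = 0.
Proof. by move=> ma; have [_ ->] := HLa0_nil (@toL_HLa K N 0 a u m z). Qed.

Lemma toLa (u : Ch N 0 a) z : @toL K N 0 a u a z = scF (@cv K N 0 a u [::] a z) 1.
Proof.
have [-> _] := HLa0_nil (@toL_HLa K N 0 a u a z).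
by rewrite coef_toL // ok_nil.
Qed.

(** At z of degree a - i, the differential of u is u(Sq^i z) times lambda_(i-1). *)
Lemma dCh0P (u : Ch N 0 a) : app (dCh N a 0) u = 0 <->
  forall x, Dec N K a x -> @cv K N 0 a u [::] a x = 0.
Proof.
split=> [du|h].
  apply: (gen_min (P := kersg (mkHom (@cvB K N 0 a u [::] a)))) => _ [i [m [z [im mr e ->]]]].
  rewrite /kersg /=.
  have o : ok K 1 a [:: (i - 1)%N] m.
    by rewrite /ok in_basis1 /= deg_cons deg_nil; lia.
  have h : coef [:: (i - 1)%N] (@Dc K N K (toL u) m z) = 0.
    by apply: (etrans (esym (@cv_dChf K N a 0 u _ m z o))); rewrite -[dChf u]/(app (dCh N a 0) u) du.
  move: h; rewrite /Dc toL0 ?raddf0 ?add0r; last by lia.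
  rewrite (@sum_single _ _ _ i); [|by lia|]; last first.
    by move=> j jm ji; rewrite toL0 ?mulr0 //; lia.
  rewrite (@c_cast _ _ K (toL u) (m + i)%N a i m z e) toLa -scF1_comm.
  have -> : @msqr K N K i m a z = @msq K N i m a z by rewrite /msqr mr.
  rewrite -[app _ _]/(@cv K N 0 a u [::] a (@msq K N i m a z)).
  have [->|->] := F2P (@cv K N 0 a u [::] a (@msq K N i m a z)) => //.
  rewrite scF1 mul1r -[lam _]mulr1 -lam_mon_nil -lam_mon_cons coef_mon // eqxx.
  by move/eqP; rewrite oner_eq0.
have D0 m z : @Dc K N K (toL u) m z = 0.
  have e0 : ld (@toL K N 0 a u m z) = 0.
    have [e|ne] := eqVneq m a; last by rewrite toL0 // raddf0.
    by subst m; rewrite toLa ld_scF1.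
  rewrite /Dc e0 add0r big_nat big1 // => i im.
  have [e|ne] := eqVneq (m + i)%N a; last by rewrite toL0 // mulr0.
  rewrite (@c_cast _ _ K (toL u) (m + i)%N a i m z e) toLa h ?scF0 ?mulr0 //.
  rewrite /msqr; case: ifP => mr; last exact: (sg_mem0 (Dec N K a)).
  have [i0|i0] := posnP i; first by subst i; exact: (sg_mem0 (Dec N K a)).
  by apply: Dec_in => //; lia.
by apply: Ch_ext => J m z o; apply: (etrans (cv_dChf u z o)); rewrite D0 raddf0.
Qed.

Definition sphere_rel (u : Ch N 0 a) (f : Nat N (sphere K a)) : Prop :=
  forall z, @cv K N 0 a u [::] a z = val (napp f a%:Z z).

Lemma sphere_relB u f u' f' : sphere_rel u f -> sphere_rel u' f' ->
  sphere_rel (u - u') (f - f').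
Proof.
move=> h h' z; apply: (etrans (@cvBl K N 0 a u u' [::] a z)).
have e : val (napp f a%:Z z - napp f' a%:Z z) = val (napp f a%:Z z) - val (napp f' a%:Z z) by exact: raddfB.
rewrite (nappBl f f' z) e; exact: (congr2 (fun x y : 'F_2 => x - y) (h z) (h' z)).
Qed.

Lemma sphere_off b (x : sphere K a b) : b <> a%:Z -> x = 0.
Proof. by move=> ba; apply: val_inj; case: (subP x) => [/ba|]. Qed.

Lemma sphere_rel0 u f : sphere_rel u f -> (u = 0 <-> f = 0).
Proof.
move=> h; split=> [u0|f0].
  apply: nat_ext => b x; have [e|ne] := pselect (b = a%:Z); last first.
    by rewrite (sphere_off (napp f b x) ne).
  subst b; apply: val_inj; rewrite -h u0; exact: val_inj.
apply: Ch_ext => J m z o.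
have /and3P[_ /nilP J0 /eqP ma] := o; subst J.
move: ma; rewrite deg_nil addn0 => ma; subst m.
by rewrite h f0.
Qed.

(** A functional that vanishes on decomposables is compatible with all morphisms of Q_k, because by
    [acts_all] each acts through its augmentation up to decomposables. *)
Lemma sphere_rel_ex1 u : app (dCh N a 0) u = 0 -> exists f, sphere_rel u f.
Proof.
move=> /dCh0P hu.
pose F b (x : N b) : 'F_2 := @cv K N 0 a u [::] a (tr a%:Z x).
have FS b (x : N b) : sphere_mem a b (F b x).
  have [e|ne] := pselect (b = a%:Z); [by left|right].
  by rewrite /F tr_neq // (zmorph0 (@cvB K N 0 a u [::] a)).
pose G b (x : N b) : sphere K a b := mksub (P := sphere_sg a b) (FS b x).
have GB b : zmod_morphism (G b).
  by move=> x y; apply: val_inj; rewrite [LHS]/(F b (x - y)) /F trB cvB.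
have GN b c (g : @rhom (Qk K) b c) (x : N b) : G c (act N g x) = act (sphere K a) g (G b x).
  apply: val_inj; rewrite [LHS]/(F c (act N g x)) [RHS]/(augQ (val g) * F b x).
  have hD := acts_all (M := N) (subP g) erefl x.
  have [e|ne] := pselect (c = a%:Z); last first.
    rewrite /F tr_neq // (zmorph0 (@cvB K N 0 a u [::] a)).
    have [e|ne'] := pselect (b = a%:Z).
      have -> : augQ (val g) = 0 by apply: augQ_deg; apply/eqP => ecb; apply: ne; rewrite ecb.
      exact: esym (mul0r _).
    rewrite tr_neq // (zmorph0 (@cvB K N 0 a u [::] a)); exact: esym (mulr0 _).
  subst c; rewrite /F tr_id.
  have := hu _ (DecZ_Dec hD); rewrite cvB (scFf _ _ (@cvB K N 0 a u [::] a)) scF_F2.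
  by move/eqP; rewrite subr_eq0 => /eqP.
exists (@mkNat (Qk K) N (sphere K a) G GB GN) => z.
by rewrite [RHS]/(F a%:Z z) /F tr_id.
Qed.

Lemma sphere_rel_ex2 f : exists2 u, app (dCh N a 0) u = 0 & sphere_rel u f.
Proof.
pose F (J : seq nat) m (z : N m%:Z) : 'F_2 := val (napp f a%:Z (tr a%:Z z)).
have FB J m : zmod_morphism (F J m).
  by move=> x y; rewrite /F trB raddfB.
exists (@mkCh K N 0 a F FB); last first.
  by move=> z; rewrite cv_mk ok_nil eqxx /F tr_id.
apply/dCh0P; apply: (gen_min (P := kersg (mkHom (@cvB K N 0 a (mkCh 0 a FB) [::] a)))).
move=> _ [i [m [z [im mr e ->]]]]; rewrite /kersg /=.
rewrite -[app _ _]/(cv _ _ _) cv_mk ok_nil eqxx /F tr_id msqE; [|lia|lia|lia|lia].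
rewrite nappP /= augQ_deg ?mul0r //.
by apply/eqP => -[]; lia.
Qed.

End SphereCochains.

Lemma sphere_rel_pull K L N a (g : Nat L N) u f : @sphere_rel K N a u f ->
  @sphere_rel K L a (app (pull a g 0) u) (ncomp f g).
Proof. by move=> h z; apply: (etrans (@cv_pull K a L N g 0 u [::] a z)); rewrite h. Qed.

Section ExtSide.
Variables (K : nat) (M : rmodule (Qk K)) (P : projective_resolution M) (a : nat).

Lemma Ts0_Ext s : isomorphic
  (subquo (dc_cycle (fun p q => dCh (P p) a q) (fun p q => pull a (res_d P p) q) s 0)
          (bot_bound (fun p q => dCh (P p) a q) (fun p q => pull a (res_d P p) q) s 0))
  (Ext P (sphere K a) s).
Proof.
apply: (subquo_iso (R := @sphere_rel K (P s) a)).
- by move=> u f u' f'; apply: sphere_relB.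
- move=> u [du hu]; have [f uf] := sphere_rel_ex1 du; exists f => //.
  exact: (sphere_rel0 (sphere_rel_pull (res_d P s) uf)).1.
- move=> f hf; have [u du uf] := sphere_rel_ex2 f; exists u => //; split=> //.
  exact: (sphere_rel0 (sphere_rel_pull (res_d P s) uf)).2.
case: s => [|s] u f _ _ uf; first exact: sphere_rel0 uf.
split=> [[y dy ey]|[g eg]].
  have [g yg] := sphere_rel_ex1 dy; exists g.
  have := sphere_relB uf (sphere_rel_pull (res_d P s) yg); rewrite -ey subrr.
  by move=> /sphere_rel0 [/(_ erefl) e _]; apply/eqP; rewrite -subr_eq0 e.
have [y dy yg] := sphere_rel_ex2 g; exists y => //.
have := sphere_relB uf (sphere_rel_pull (res_d P s) yg); rewrite -eg subrr.
by move=> /sphere_rel0 [_ /(_ erefl) e]; apply/eqP; rewrite -subr_eq0 e.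
Qed.
End ExtSide.

(** * Maps out of Lambda_k(M) and its differential *)

Lemma zmorphD (U V : zmodType) (f : U -> V) : zmod_morphism f -> forall x y, f (x + y) = f x + f y.
Proof.
move=> fB x y; have fN : f (- y) = - f y by rewrite -sub0r fB (zmorph0 fB) sub0r.
by rewrite -{1}[y]opprK fB fN opprK.
Qed.

Lemma tensor_lift (U V W : zmodType) (B : U -> V -> W) :
  (forall v, zmod_morphism (fun u => B u v)) -> (forall u, zmod_morphism (B u)) ->
  exists h : Hom (tensor U V) W, forall u v, app h (tens u v) = B u v.
Proof.
move=> Bl Br.
have [|h hE] := @pres_lift _ (@tensor_rel U V) W (fun p => B p.1 p.2).
  move=> _ [u u' v|u v v']; rewrite !raddfB /= !free_lift_sym /=.
    by rewrite (zmorphD (Bl v)) -addrA -opprD subrr.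
  by rewrite (zmorphD (Br u)) -addrA -opprD subrr.
by exists h => u v; apply: hE.
Qed.

Section DirectSum.
Variables (I : Type) (V : I -> zmodType) (W : zmodType) (f : forall i, Hom (V i) W).

Lemma dinjE i (x : V i) : val (dinj V i x) i = x.
Proof. by rewrite /=; case: pselect => // e; rewrite (Prop_irrelevance e erefl). Qed.

Lemma dinj_neq i j (x : V i) : i <> j -> val (dinj V i x) j = 0.
Proof. by rewrite /=; case: pselect. Qed.

Lemma dinjB i : zmod_morphism (dinj V i).
Proof.
move=> x y; apply: val_inj; apply: functional_extensionality_dep => j.
rewrite [RHS]/(val (dinj V i x) j - val (dinj V i y) j) /=.
by case: pselect => [e|_]; [case: _ / e|apply: esym; apply: subrr].
Qed.

Let csum (t : seq {classic I}) (u : dsum V) : W := \sum_(i <- t) app (f i) (val u i).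
Let covers (t : seq {classic I}) (u : dsum V) := forall i, val u i != 0 -> (i : {classic I}) \in t.

(** Lets additivity be checked on one list covering all supports involved. *)
Lemma csum_indep t t' u : uniq t -> uniq t' -> covers t u -> covers t' u -> csum t u = csum t' u.
Proof.
have red r : csum r u = \sum_(i <- filter (fun i : {classic I} => val u i != 0) r) app (f i) (val u i).
  rewrite big_filter [RHS]big_mkcond; apply: eq_bigr => i _.
  by case: eqP => [->|//]; rewrite raddf0.
move=> ut ut' ct ct'; rewrite !red.
have hp : perm_eq (filter (fun i : {classic I} => val u i != 0) t) (filter (fun i : {classic I} => val u i != 0) t').
  apply: uniq_perm; rewrite ?filter_uniq //.
  move=> i; rewrite !mem_filter; case: (boolP (val u i != 0)) => //= h.
  by rewrite ct // ct'.
exact: (perm_big _ hp).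
Qed.

Lemma dsum_lift : exists h : Hom (dsum V) W, forall i x, app h (dinj V i x) = app (f i) x.
Proof.
have ex (u : dsum V) : exists t, uniq t /\ covers t u.
  by have [t tP] := subP u; exists (undup t); split=> [|i /tP]; rewrite ?undup_uniq ?mem_undup.
pose t u := projT1 (cid (ex u)).
have tU u : uniq (t u) by have [] := projT2 (cid (ex u)).
have tC u : covers (t u) u by have [] := projT2 (cid (ex u)).
have hB : zmod_morphism (fun u => csum (t u) u).
  move=> u v; pose r := undup (t u ++ t v ++ t (u - v)).
  have rU : uniq r by apply: undup_uniq.
  have rC w : w \in [:: u; v; u - v] -> covers r w.
    by rewrite !inE => /or3P[] /eqP -> i /tC; rewrite mem_undup !mem_cat => ->; rewrite ?orbT.
  rewrite !(@csum_indep (t _) r) //; try by apply: rC; rewrite !inE eqxx ?orbT.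
  rewrite /csum -sumrB; apply: eq_bigr => i _.
  exact: (appB (f i)).
exists (mkHom hB) => i x; rewrite [LHS](@csum_indep (t _) [:: (i : {classic I})]) //.
  by rewrite /csum big_seq1 dinjE.
move=> j hj; rewrite mem_seq1; apply: contraNT hj => ij.
by rewrite dinj_neq ?eqxx // => e; rewrite e eqxx in ij.
Qed.

End DirectSum.

Section TensLemmas.
Variables (U V : zmodType).
Lemma pres_rel0 (X : Type) (S : {malg int[{classic X}]} -> Prop) g : S g -> cl (gen S) g = 0.
Proof. by move=> Sg; rewrite -(raddf0 (cl (gen S))); apply/cl_eq; rewrite subr0; apply: gen_in. Qed.

Lemma tensDl (u u' : U) (v : V) : tens (u + u') v = tens u v + tens u' v.
Proof.
have := pres_rel0 (tensor_rel_l u u' v); rewrite !raddfB /= -!/(sym _ _) => /eqP.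
by rewrite subr_eq0 subr_eq => /eqP e; apply: etrans e _; apply: addrC.
Qed.
Lemma tensDr (u : U) (v v' : V) : tens u (v + v') = tens u v + tens u v'.
Proof.
have := pres_rel0 (tensor_rel_r u v v'); rewrite !raddfB /= -!/(sym _ _) => /eqP.
by rewrite subr_eq0 subr_eq => /eqP e; apply: etrans e _; apply: addrC.
Qed.
Lemma tensBl (v : V) : zmod_morphism (fun u : U => tens u v).
Proof. by move=> u u'; apply/eqP; rewrite eq_sym subr_eq -tensDl subrK. Qed.
Lemma tensBr (u : U) : zmod_morphism (tens u : V -> _).
Proof. by move=> v v'; apply/eqP; rewrite eq_sym subr_eq -tensDr subrK. Qed.
End TensLemmas.

Section LambdaSub.
Variables (k m : nat).

Lemma Lambda_k_clE y (hy : Lambda_sub m y) :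
  Lambda_k_cl k m y = cl (restr_sg (Lambda_sub m) (Gamma m k)) (mksub hy).
Proof.
rewrite /Lambda_k_cl; congr cl; apply: val_inj.
by rewrite insubdK //; apply: asboolT.
Qed.

Lemma Lambda_k_clB y y' : Lambda_sub m y -> Lambda_sub m y' ->
  Lambda_k_cl k m (y - y') = Lambda_k_cl k m y - Lambda_k_cl k m y'.
Proof.
move=> hy hy'; rewrite (Lambda_k_clE hy) (Lambda_k_clE hy') (Lambda_k_clE (sg_memB hy hy')) -raddfB.
by congr (cl _ _); apply: val_inj.
Qed.

Lemma Lambda_k_cl_Gamma y : Lambda_sub m y -> Gamma m k y -> Lambda_k_cl k m y = 0.
Proof.
move=> hy gy; rewrite (Lambda_k_clE hy) -(raddf0 (cl _)); apply/cl_eq.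
by rewrite subr0.
Qed.

Lemma Lambda_k_lift (W : zmodType) (f : Lambda -> W) :
  (forall y y', Lambda_sub m y -> Lambda_sub m y' -> f (y - y') = f y - f y') ->
  (forall y, Lambda_sub m y -> Gamma m k y -> f y = 0) ->
  exists h : Hom (Lambda_k k m) W, forall y, Lambda_sub m y -> app h (Lambda_k_cl k m y) = f y.
Proof.
move=> fB f0; have gB : zmod_morphism (fun y : sub (Lambda_sub m) => f (val y)).
  by move=> y y'; rewrite raddfB; apply: fB; apply: subP.
have [|hB hE] := @qlift_zmod_morphism _ _ (restr_sg (Lambda_sub m) (Gamma m k)) (app (mkHom gB)).
  by move=> y hy; apply: f0 => //; apply: subP.
by exists (mkHom hB) => y hy; rewrite (Lambda_k_clE hy); apply: hE.
Qed.

End LambdaSub.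

Section Elements.
Variables (k : nat) (M : rmodule (Qk k)).

Lemma elt_Bl m y y' (x : dual M m) : Lambda_sub m y -> Lambda_sub m y' ->
  elt (y - y') x = elt y x - elt y' x.
Proof. by move=> hy hy'; rewrite /elt Lambda_k_clB // tensBl dinjB. Qed.

Lemma elt_Br m y : zmod_morphism (@elt k M m y).
Proof. by move=> x x'; rewrite /elt tensBr dinjB. Qed.

Lemma elt_Gamma m y (x : dual M m) : Lambda_sub m y -> Gamma m k y -> elt y x = 0.
Proof.
move=> hy gy; rewrite /elt Lambda_k_cl_Gamma // (zmorph0 (@tensBl _ _ x)).
exact: (zmorph0 (@dinjB _ _ m)).
Qed.

(** Formulas on representatives suffice to define additive maps out of Lambda_k(M); both its
    differential and the comparison map [Phi] arise in this way. *)
Lemma elt_lift (W : zmodType) (B : forall m, Lambda -> dual M m -> W) :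
  (forall m x y y', Lambda_sub m y -> Lambda_sub m y' -> B m (y - y') x = B m y x - B m y' x) ->
  (forall m y, Lambda_sub m y -> zmod_morphism (B m y)) ->
  (forall m y x, Lambda_sub m y -> Gamma m k y -> B m y x = 0) ->
  exists h : Hom (Lambda_kM M) W, forall m y x, Lambda_sub m y -> app h (elt y x) = B m y x.
Proof.
move=> Bl Br B0.
have lift1 m (x : dual M m) : exists h : Hom (Lambda_k k m) W,
    forall y, Lambda_sub m y -> app h (Lambda_k_cl k m y) = B m y x.
  by apply: Lambda_k_lift => [y y' hy hy'|y hy gy]; [apply: Bl|apply: B0].
pose b m x := projT1 (cid (lift1 m x)).
have bE m x y : Lambda_sub m y -> app (b m x) (Lambda_k_cl k m y) = B m y x.
  exact: (projT2 (cid (lift1 m x))).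
have clP m (u : Lambda_k k m) : exists2 y, Lambda_sub m y & u = Lambda_k_cl k m y.
  exists (val (repr u)); first exact: subP.
  by rewrite (Lambda_k_clE k (subP (repr u))) -[LHS]cl_repr; congr (cl _ _); apply: val_inj.
have lift2 m : exists h : Hom (Lambda_kM_fam M m) W, forall u x, app h (tens u x) = app (b m x) u.
  apply: (@tensor_lift (Lambda_k k m) (dual M m) W (fun u x => app (b m x) u)) => [x|u].
    exact: appB.
  by move=> x x'; have [y hy ->] := clP m u; rewrite !bE // Br.
pose g m := projT1 (cid (lift2 m)).
have gE m u x : app (g m) (tens u x) = app (b m x) u by exact: (projT2 (cid (lift2 m))).
have [h hE] := @dsum_lift nat (Lambda_kM_fam M) W g.
by exists h => m y x hy; rewrite /elt hE gE bE.
Qed.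

Lemma in_Lambda_sub m J : in_Lambda m J -> Lambda_sub m (lam_mon J).
Proof. by move=> hJ; apply: gen_in; exists J. Qed.

Lemma HL_sub m s n y : HL m s n y -> Lambda_sub m y.
Proof. by apply: gen_mono => x [J [hJ _ _ ->]]; exists J. Qed.

Lemma HG_Gamma m s n y : HG m k s n y -> Gamma m k y.
Proof. by apply: gen_mono => x [J [hJ _ _ ->]]; exists J. Qed.

Lemma ld_sub m y : Lambda_sub m y -> Lambda_sub m (ld y).
Proof.
apply: (gen_preim (appB lambda_d)) => _ [J [hJ ->]].
exact: HL_sub (dL_mon hJ).
Qed.

Lemma ld_Gamma m y : Gamma m k y -> Gamma m k (ld y).
Proof.
apply: (gen_preim (appB lambda_d)) => _ [J [hJ ->]].
exact: HG_Gamma (dG_mon hJ).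
Qed.

Lemma lam_sub m i y : (0 < i)%N -> (2 * i <= m)%N -> Lambda_sub m y ->
  Lambda_sub (m - i) (lam (i - 1) * y).
Proof.
move=> i0 im; apply: (gen_preim (mull_zmod (lam (i - 1)))) => _ [J [hJ ->]].
apply: HL_sub; apply: prodL_mon; first by lia.
by have -> : ((m - i + (i - 1)).+1 = m)%N by lia.
Qed.

Lemma lam_Gamma m i y : (0 < i)%N -> (2 * i <= m)%N -> Gamma m k y ->
  Gamma (m - i) k (lam (i - 1) * y).
Proof.
move=> i0 im; apply: (gen_preim (mull_zmod (lam (i - 1)))) => _ [J [hJ ->]].
have e : ((m - i + (i - 1)).+1 = m)%N by lia.
apply: HG_Gamma; apply: prodG_mon; rewrite ?e; first by lia.
  exact: in_Gamma_Lambda hJ.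
by rewrite hJ.
Qed.

Lemma dual_SqB m i : zmod_morphism (@dual_Sq k M m i).
Proof. by move=> x y; apply: val_inj. Qed.

(** The formula is well defined because d and left multiplication by lambda_(i-1) preserve the
    subspaces Lambda(m) and Gamma(m, k), up to the change of m; so [xget] finds a differential. *)
Lemma Lambda_kM_dP : is_Lambda_kM_diff (Lambda_kM_d M).
Proof.
apply: (xgetPex _ (P := @is_Lambda_kM_diff k M)).
pose B m (y : Lambda) (x : dual M m) : Lambda_kM M := elt (ld y) x +
    \sum_(1 <= i < m.+1 | (2 * i <= m)%N && (m - 2 * i < k)%N)
      elt (lam (i - 1) * y) (dual_Sq i x).
have [|||h hE] := @elt_lift (Lambda_kM M) B.
- move=> m x y y' hy hy'; rewrite /B (appB lambda_d) elt_Bl; [|exact: ld_sub|exact: ld_sub].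
  rewrite opprD addrACA; congr (_ + _); rewrite -sumrB big_nat_cond [RHS]big_nat_cond.
  apply: eq_bigr => i /andP[im /andP[i2 _]]; rewrite mulrBr elt_Bl //; apply: lam_sub => //; lia.
- move=> m y hy x x'; rewrite /B elt_Br opprD addrACA; congr (_ + _).
  by rewrite -sumrB; apply: eq_bigr => i _; rewrite dual_SqB elt_Br.
- move=> m y x hy gy; rewrite /B elt_Gamma; [|exact: ld_sub|exact: ld_Gamma].
  rewrite add0r big_nat_cond big1 // => i /andP[im /andP[i2 _]].
  by apply: elt_Gamma; [apply: lam_sub|apply: lam_Gamma] => //; lia.
by exists h => m I x hI; rewrite hE //; apply: in_Lambda_sub.
Qed.

End Elements.

(** * Comparison of Lambda_k(M) with the cochains *)

Section Comparison.
Variables (k : nat) (M : rmodule (Qk k)).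

Lemma PhiB_subproof m (y : Lambda) (x : dual M m) (J : seq nat) m' :
  zmod_morphism (fun z : M m'%:Z => coef J y * app x (tr m%:Z z)).
Proof. by move=> z z'; rewrite trB appB mulrBr. Qed.

Definition PhiB m (y : Lambda) (x : dual M m) : Cf M :=
  fun J m' => if in_basis k m' J then mkHom (@PhiB_subproof m y x J m') else 0.

Lemma Cf_ext (c c' : Cf M) : (forall J m z, app (c J m) z = app (c' J m) z) -> c = c'.
Proof.
move=> h; apply: functional_extensionality_dep => J; apply: functional_extensionality_dep => m.
by apply: val_inj; apply: functional_extensionality_dep => z; apply: h.
Qed.

Lemma app_PhiB m y x J m' z : app (@PhiB m y x J m') z =
  if in_basis k m' J then coef J y * app x (tr m%:Z z) else 0.
Proof. by rewrite /PhiB; case: ifP. Qed.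

Lemma Gamma_coef m y J : Gamma m k y -> in_basis k m J -> coef J y = 0.
Proof.
move=> + /andP[_ nG]; apply: (gen_min (P := kersg (mkHom (coef_zmod J)))) => _ [I [hI ->]].
change (coef J (lam_mon I) = 0); rewrite coef_mon; last exact/in_Lambda_adm/in_Gamma_Lambda/hI.
by case: eqP => // e; rewrite -e hI in nG.
Qed.

Lemma Phi_ex : exists h : Hom (Lambda_kM M) (Cf M), forall m y x, Lambda_sub m y ->
  app h (@elt k M m y x) = PhiB y x.
Proof.
apply: elt_lift => [m x y y' _ _|m y _ x x'|m y x hy gy].
- apply: Cf_ext => J m' z; rewrite -[RHS]/(app (PhiB y x J m') z - app (PhiB y' x J m') z).
  by rewrite !app_PhiB coef_zmod; case: ifP => _; rewrite ?subr0 // mulrBl.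
- apply: Cf_ext => J m' z; rewrite -[RHS]/(app (PhiB y x J m') z - app (PhiB y x' J m') z).
  by rewrite !app_PhiB; case: ifP => _; rewrite ?subr0 // -mulrBr.
apply: Cf_ext => J m' z; rewrite app_PhiB; case: ifP => // hJ.
have [e|ne] := eqVneq m' m; first by subst m'; rewrite (Gamma_coef gy) ?mul0r.
by rewrite tr_neq ?raddf0 ?mulr0 // => -[e]; rewrite e eqxx in ne.
Qed.

Definition Phi : Hom (Lambda_kM M) (Cf M) := projT1 (cid Phi_ex).

Lemma PhiE m y x : Lambda_sub m y -> app Phi (@elt k M m y x) = PhiB y x.
Proof. exact: (projT2 (cid Phi_ex)). Qed.

Lemma Phi_mon m I x J m' z : in_Lambda m I -> app (app Phi (@elt k M m (lam_mon I) x) J m') z =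
  if in_basis k m' J && (I == J) then app x (tr m%:Z z) else 0.
Proof.
move=> hI; rewrite PhiE ?app_PhiB; last exact: in_Lambda_sub.
rewrite coef_mon; last exact: in_Lambda_adm hI.
by case: (in_basis k m' J); case: (I == J); rewrite ?mul0r ?mul1r.
Qed.

Lemma Phi_Ch s a u : Lambda_kM_sa M s a u -> Ch_mem s a (app Phi u).
Proof.
pose P := Subgroup (@Ch0 k M s a) (@ChB k M s a).
apply: (gen_preim (P := P) (appB Phi)) => _ [m [I [x [hI sI dI ->]]]] J m' o.
apply: val_inj; apply: functional_extensionality_dep => z.
change (app (app Phi (elt (lam_mon I) x) J m') z = 0).
rewrite Phi_mon //; case: ifP => // /andP[hJ /eqP e]; subst J.
have [e|ne] := eqVneq m' m; last first.
  by rewrite tr_neq ?raddf0 // => -[e]; rewrite e eqxx in ne.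
by case/negP: o; rewrite /ok hJ sI e dI !eqxx.
Qed.

(** Inverse to [Phi] in bidegree (s, a), where a cochain has only finitely many coordinates. *)
Definition Psi s a (c : Cf M) : Lambda_kM M :=
  \sum_(0 <= m < a.+1) \sum_(J <- bwords s (a - m) | ok k s a J m) elt (lam_mon J) (c J m).

Lemma PsiB s a : zmod_morphism (Psi s a).
Proof.
move=> c c'; rewrite /Psi -sumrB; apply: eq_bigr => m _; rewrite -sumrB.
by apply: eq_bigr => J _; rewrite -elt_Br.
Qed.

Lemma Psi_sa s a c : Lambda_kM_sa M s a (Psi s a c).
Proof.
apply: sg_sum => m _; rewrite big_mkcond; apply: sg_sum => J _; case: ifP => o; last exact: sg_mem0.
case/and3P: o => h1 /eqP h2 /eqP h3; apply: gen_in; exists m, J, (c J m); split=> //.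
exact: in_basis_Lambda h1.
Qed.

Lemma Phi_Psi s a c : Ch_mem s a c -> app Phi (Psi s a c) = c.
Proof.
move=> hc; apply: Cf_ext => J m z.
have EB : zmod_morphism (fun u => app (app Phi u J m) z).
  by move=> u v; rewrite appB.
pose F m' J' := if in_basis k m J && (J' == J) then app (c J' m') (tr m'%:Z z) else 0.
have F0 m' J' : m' != m -> F m' J' = 0.
  move=> ne; rewrite /F tr_neq ?raddf0 ?if_same // => -[e].
  by rewrite e eqxx in ne.
have -> : app (app Phi (Psi s a c) J m) z =
   \sum_(0 <= m' < a.+1) \sum_(J' <- bwords s (a - m') | ok k s a J' m') F m' J'.
  rewrite -[LHS]/(app (mkHom EB) (Psi s a c)) /Psi raddf_sum; apply: eq_bigr => m' _.
  rewrite raddf_sum; apply: eq_bigr => J' /and3P[h _ _].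
  exact: (Phi_mon _ _ _ (in_basis_Lambda h)).
have [o|o] := boolP (ok k s a J m); last first.
  rewrite hc // big1 // => m' _; have [e|ne] := eqVneq m' m; last by rewrite big1 // => J' _; rewrite F0.
  subst m'; rewrite big1 // => J' o'; rewrite /F; case: ifP => // /andP[_ /eqP e].
  by rewrite -e o' in o.
have ma : (m < a.+1)%N by case/and3P: o => _ _ /eqP; lia.
rewrite (@sum_single _ _ _ m) //; last by move=> j _ jm; rewrite big1 // => J' _; rewrite F0.
have hu : uniq (bwords s (a - m)) by apply/filter_uniq/words_uniq.
have hJ := ok_bwords o.
rewrite big_mkcond (bigD1_seq J) //=.
rewrite o /F eqxx andbT ifT; last by case/and3P: o.
rewrite tr_id big1 ?addr0 // => J' /negbTE ->.
by rewrite andbF if_same.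
Qed.

Lemma Psi_Phi s a u : Lambda_kM_sa M s a u -> Psi s a (app Phi u) = u.
Proof.
move=> hu; apply/eqP; rewrite -subr_eq0; apply/eqP; move: u hu.
have DB : zmod_morphism (fun u => Psi s a (app Phi u) - u).
  by move=> u v; rewrite appB PsiB subrACA.
apply: (gen_min (P := kersg (mkHom DB))) => _ [m [I [x [hI sI dI ->]]]].
change (Psi s a (app Phi (elt (lam_mon I) x)) - elt (lam_mon I) x = 0).
apply/eqP; rewrite subr_eq0; apply/eqP.
have [gI|nG] := boolP (in_Gamma m k I).
  rewrite elt_Gamma; [|exact: in_Lambda_sub|by apply: gen_in; exists I].
  by rewrite raddf0 (zmorph0 (PsiB s a)).
have bI : in_basis k m I by rewrite /in_basis hI.
have o : ok k s a I m by rewrite /ok bI sI dI !eqxx.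
have ma : (m < a.+1)%N by lia.
have P0 m' J : ~~ ((m' == m) && (I == J)) -> app Phi (elt (lam_mon I) x) J m' = 0.
  move=> h; apply: val_inj; apply: functional_extensionality_dep => z.
  change (app (app Phi (elt (lam_mon I) x) J m') z = 0); rewrite Phi_mon //.
  case: ifP => // /andP[_ IJ]; rewrite tr_neq ?raddf0 // => -[e].
  by rewrite e eqxx IJ in h.
rewrite /Psi (@sum_single _ _ _ m) //; last first.
  move=> m' _ ne; rewrite big1 // => J _.
  by rewrite P0 ?(negbTE ne) // (zmorph0 (elt_Br _)).
have hu : uniq (bwords s (a - m)) by apply/filter_uniq/words_uniq.
have hI' := ok_bwords o.
rewrite big_mkcond (bigD1_seq I) //=.
rewrite o big1 ?addr0 => [|J ne].
  congr elt; apply: val_inj; apply: functional_extensionality_dep => z.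
  change (app (app Phi (elt (lam_mon I) x) I m) z = app x z).
  by rewrite Phi_mon // bI eqxx tr_id.
by case: ifP => // _; rewrite P0 ?(zmorph0 (elt_Br _)) // eq_sym (negbTE ne) andbF.
Qed.

Lemma Phi_inj s a u : Lambda_kM_sa M s a u -> app Phi u = 0 -> u = 0.
Proof. by move=> hu h0; rewrite -(Psi_Phi hu) h0 (zmorph0 (PsiB s a)). Qed.

Lemma elt_sa m s n a y x : (m + n = a)%N -> HL m s n y -> Lambda_kM_sa M s a (@elt k M m y x).
Proof.
move=> e; elim=> {y} [y [J [h1 h2 h3 ->]]||y y' hy IHy hy' IHy'].
- by apply: gen_in; exists m, J, x; split=> //; rewrite h3.
- have e0 : elt 0 x = 0 :> Lambda_kM M.
    by have := elt_Bl x (sg_mem0 (Lambda_sub m)) (sg_mem0 (Lambda_sub m)); rewrite !subrr.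
  by rewrite e0; apply: sg_mem0.
rewrite elt_Bl; [exact: sg_memB|exact: HL_sub hy|exact: HL_sub hy'].
Qed.

Lemma d_sa s a u : Lambda_kM_sa M s a u -> Lambda_kM_sa M s.+1 a (app (Lambda_kM_d M) u).
Proof.
apply: (gen_preim (appB (Lambda_kM_d M))) => _ [m [I [x [hI sI dI ->]]]].
rewrite (Lambda_kM_dP x hI); apply: sg_memD.
  by apply: (elt_sa _ dI); rewrite -sI; apply: dL_mon.
rewrite big_nat_cond big_mkcond; apply: sg_sum => i _; case: ifP => [/andP[im /andP[i2 _]]|_]; last exact: sg_mem0.
apply: (@elt_sa _ _ ((i - 1).+1 + deg I)); first by lia.
rewrite -sI; apply: prodL_mon; first by lia.
by have -> : ((m - i + (i - 1)).+1 = m)%N by lia.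
Qed.
End Comparison.

Section Final.
Variables (k : nat) (M : rmodule (Qk k)).

Lemma dual_Sq_tr m m' i (x : dual M m) (z : M m'%:Z) : (0 < i)%N -> (2 * i <= m)%N ->
  (m - 2 * i < k)%N ->
  app (dual_Sq i x) (tr (m - i)%N%:Z z) = if i == (m - m')%N then app x (@msqr k M k i m' m z) else 0.
Proof.
move=> i0 im mk; have [e|ne] := eqVneq (m - i)%N m'; last first.
  rewrite tr_neq ?raddf0; last by move=> [e]; rewrite e eqxx in ne.
  case: eqP => // e; rewrite msqr_eq0 ?raddf0 //; lia.
subst m'; rewrite tr_id ifT; last by lia.
rewrite /msqr ifT; last by lia.
by rewrite msqE; [|lia|lia|lia|lia].
Qed.

(** Evaluated at z of degree m', both sums over i reduce to the single term i = m - m'. *)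
Lemma Phi_d_mon s a m I (x : dual M m) J m' z : in_basis k m I -> size I = s -> (m + deg I)%N = a ->
  ok k s.+1 a J m' -> forall c : Ch M s a, val c = app (Phi M) (elt (lam_mon I) x) ->
  app (app (Phi M) (app (Lambda_kM_d M) (elt (lam_mon I) x)) J m') z =
  coef J (@Dc k M k (toL c) m' z).
Proof.
move=> bI sI dI o c cE; have hI := in_basis_Lambda bI.
have TE n w : @toL k M s a c n w = scF (app x (tr m%:Z w)) (lam_mon I).
  have e J' : @cv k M s a c J' n w = if in_basis k n J' && (I == J') then app x (tr m%:Z w) else 0.
    by rewrite /cv cE Phi_mon.
  rewrite /toL /lsum; have [en|ne] := eqVneq n m; last first.
    rewrite tr_neq ?raddf0 ?scF0; last by move=> [e']; rewrite e' eqxx in ne.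
    rewrite big1 // => J' _; rewrite e tr_neq ?raddf0 ?if_same ?scF0 //.
    by move=> [e']; rewrite e' eqxx in ne.
  subst n; have oI : ok k s a I m by rewrite /ok bI sI dI !eqxx.
  have hI' := ok_bwords oI.
  have hu : uniq (bwords s (a - m)) by apply/filter_uniq/words_uniq.
  rewrite (bigD1_seq I) //= e bI eqxx big1 ?addr0 // => J' ne.
  by rewrite e eq_sym (negbTE ne) andbF scF0.
have bJ : in_basis k m' J by case/and3P: o.
pose X i := coef J (lam (i - 1) * lam_mon I).
pose S := if (m' <= m)%N then X (m - m')%N * app x (@msqr k M k (m - m') m' m z) else 0.
have L : \sum_(1 <= i < m.+1 | (2 * i <= m)%N && (m - 2 * i < k)%N)
    X i * app (dual_Sq i x) (tr (m - i)%N%:Z z) = S.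
  rewrite (@sum_range _ _ _ _ _ m.+1) // (@sum_single _ _ _ (m - m')%N); [|by lia|]; last first.
    move=> i im ne; case: ifP => // c1; rewrite dual_Sq_tr; [|lia|lia|lia].
    by rewrite (negbTE ne) mulr0.
  rewrite /S; case: ifP => c1.
    by rewrite dual_Sq_tr; [rewrite eqxx ifT //; lia|lia|lia|lia].
  case: ifP => // mm; rewrite msqr_eq0 ?raddf0 ?mulr0 //; lia.
have R : \sum_(0 <= i < m'.+1) X i * app x (tr m%:Z (@msqr k M k i m' (m' + i) z)) = S.
  have T0 i w : (m' + i)%N != m -> app x (tr m%:Z (w : M (m' + i)%N%:Z)) = 0.
    by move=> ne; rewrite tr_neq ?raddf0 // => -[e]; rewrite e eqxx in ne.
  have [c1|c1] := boolP ((m' <= m) && (m - m' <= m'))%N; last first.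
    rewrite big_nat big1; last by move=> i im; rewrite T0 ?mulr0 //; lia.
    rewrite /S; case: ifP => // mm; rewrite msqr_eq0 ?raddf0 ?mulr0 //; lia.
  rewrite (@sum_single _ _ _ (m - m')%N); [|by lia|]; last first.
    by move=> i im ne; rewrite T0 ?mulr0 //; lia.
  by rewrite /S ifT; [rewrite tr_msqr //; lia|lia].
transitivity (coef J (ld (lam_mon I)) * app x (tr m%:Z z) + S).
  rewrite (Lambda_kM_dP x hI) -L.
  pose E := mkHom (fun u v => congr1 (fun c : Cf M => app (c J m') z) (appB (Phi M) u v) :
     app (app (Phi M) (u - v) J m') z = app (app (Phi M) u J m') z - app (app (Phi M) v J m') z).
  have EE y n (w : dual M n) : Lambda_sub n y ->
      app E (elt y w) = coef J y * app w (tr n%:Z z).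
    move=> hy; apply: (etrans (congr1 (fun c : Cf M => app (c J m') z) (PhiE w hy))).
    by rewrite app_PhiB bJ.
  apply: (etrans (zmorphD (appB E) _ _)); congr (_ + _).
    exact: EE (ld_sub (in_Lambda_sub hI)).
  rewrite raddf_sum big_nat_cond [RHS]big_nat_cond; apply: eq_bigr => i /andP[im /andP[i2 _]].
  by apply: EE; apply: lam_sub; [lia|lia|apply: in_Lambda_sub].
rewrite /Dc TE.
transitivity (coef J (ld (scF (app x (tr m%:Z z)) (lam_mon I))) + coef J (
  \sum_(0 <= i < m'.+1) lam (i - 1) * @toL k M s a c (m' + i)%N (@msqr k M k i m' (m' + i) z))); last first.
  by apply: esym; apply: (zmorphD (coef_zmod J)).
congr (_ + _).
  rewrite (scFf _ _ (appB lambda_d)) (scFf _ _ (coef_zmod J)) scF_F2; exact: mulrC.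
rewrite -R raddf_sum; apply: eq_bigr => i _; rewrite TE.
apply: esym; transitivity (scF (app x (tr m%:Z (@msqr k M k i m' (m' + i) z))) (coef J (lam (i - 1) * lam_mon I))).
  transitivity (coef J (scF (app x (tr m%:Z (@msqr k M k i m' (m' + i) z))) (lam (i - 1) * lam_mon I))).
    by congr (coef J _); apply: (scFf (f := fun y => lam (i - 1) * y)); apply: mull_zmod.
  exact: (scFf _ _ (coef_zmod J)).
by rewrite scF_F2 mulrC.
Qed.

Definition related s a (u : Lambda_kM M) (c : Ch M s a) : Prop :=
  Lambda_kM_sa M s a u /\ val c = app (Phi M) u.

Lemma related_ex s a u : Lambda_kM_sa M s a u -> exists c, @related s a u c.
Proof. by move=> hu; exists (mksub (P := Subgroup (@Ch0 k M s a) (@ChB k M s a)) (Phi_Ch hu)). Qed.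

Lemma related_ex' s a (c : Ch M s a) : exists u, related u c.
Proof.
by exists (Psi s a (val c)); split; [apply: Psi_sa|rewrite Phi_Psi //; apply: (subP c)].
Qed.

Lemma related_eq s a u (c c' : Ch M s a) : related u c -> related u c' -> c = c'.
Proof. by move=> [_ h] [_ h']; apply: val_inj; rewrite h h'. Qed.

Lemma relatedB s a u v (c c' : Ch M s a) : related u c -> related v c' -> related (u - v) (c - c').
Proof.
by move=> [h e] [h' e']; split; [exact: sg_memB|rewrite appB; exact: (congr2 (fun x y : Cf M => x - y) e e')].
Qed.

Lemma related0 s a u (c : Ch M s a) : related u c -> (u = 0 <-> c = 0).
Proof.
move=> [h e]; split=> [u0|c0]; last by apply: (Phi_inj h); rewrite -e c0.
by apply: val_inj; rewrite e u0 raddf0.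
Qed.

(** By additivity it suffices to treat monomials; those in Gamma vanish on both sides, the others
    are covered by [Phi_d_mon]. *)
Lemma related_d s a u (c : Ch M s a) : related u c ->
  related (app (Lambda_kM_d M) u) (app (dCh M a s) c).
Proof.
move=> uc; have hu := uc.1.
suff [c' [uc' h]] : exists c' : Ch M s a, related u c' /\ related (app (Lambda_kM_d M) u) (app (dCh M a s) c').
  by rewrite (related_eq uc uc').
elim: {c uc} hu => {u} [_ [m [I [x [hI sI dI ->]]]]||u v hu [c [uc dc]] hv [c' [vc' dc']]].
- set u := elt _ _; have hu : Lambda_kM_sa M s a u by apply: gen_in; exists m, I, x.
  have [c uc] := related_ex hu; exists c; split=> //.
  have [c2 uc2] := related_ex (d_sa hu).
  suff <- : c2 = app (dCh M a s) c by [].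
  apply: Ch_ext => J m' z o; apply: etrans (esym (@cv_dChf k M a s c J m' z o)).
  rewrite /cv uc2.2; have [gI|nG] := boolP (in_Gamma m k I); last first.
    by apply: Phi_d_mon => //; [rewrite /in_basis hI|exact: uc.2].
  have u0 : u = 0 by apply: elt_Gamma; [exact: in_Lambda_sub|apply: gen_in; exists I].
  have c0 : c = 0 by apply/(related0 uc).
  rewrite u0 !raddf0 c0; transitivity (@cv k M s.+1 a (app (dCh M a s) 0) J m' z).
    by rewrite raddf0.
  exact: (@cv_dChf k M a s 0 J m' z o).
- have r0 t : @related t a 0 0 by split; [exact: sg_mem0|exact: esym (raddf0 (app (Phi M)))].
  have e1 : app (Lambda_kM_d M) 0 = 0 by exact: raddf0.
  have e2 : app (dCh M a s) 0 = 0 by exact: raddf0.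
  by exists 0; rewrite e1 e2.
by exists (c - c'); split; rewrite ?appB; apply: relatedB.
Qed.

Lemma Hsa_Hmod s a : isomorphic (Hsa M s a) (Hmod M a s).
Proof.
apply: (subquo_iso (R := @related s a)).
- by move=> u v u' v'; apply: relatedB.
- move=> u [hu du]; have [c uc] := related_ex hu; exists c => //.
  exact: (related0 (related_d uc)).1.
- move=> c dc; have [u uc] := related_ex' c; exists u => //; split; first exact: uc.1.
  exact: (related0 (related_d uc)).2.
move=> u c _ _; case: s u c => [|s] u c uc; first exact: related0 uc.
split=> [[v hv eu]|[y ey]].
  have [y vy] := related_ex hv; exists y; apply: related_eq uc _.
  by rewrite eu; apply: related_d.
have [v vy] := related_ex' y; exists v; first exact: vy.1.
have := relatedB uc (related_d vy); rewrite -ey subrr => /related0 [_ /(_ erefl) e].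
by apply/eqP; rewrite -subr_eq0 e.
Qed.

Lemma Lambda_kM_long s u : (k < s)%N -> Lambda_kM_s M s u -> u = 0.
Proof.
move=> ks; elim=> {u} [u [m [I [x [hI sI ->]]]]||u v _ -> _ ->]; last by rewrite subrr.
  apply: elt_Gamma; first exact: in_Lambda_sub.
  by apply: gen_in; exists I; split=> //; apply: in_Gamma_long => //; rewrite sI.
by [].
Qed.

End Final.

Theorem theorem5p21 (k : nat) (M : rmodule (Qk k)) :
  (forall s : nat, (k < s)%N ->
     forall u : Lambda_kM M, Lambda_kM_s M s u -> u = 0) /\
  (forall (P : projective_resolution M) (s a : nat),
     isomorphic (Hsa M s a) (Ext P (sphere k a) s)).
Proof.
split=> [s ks u|P s a]; first exact: Lambda_kM_long.
apply: isomorphic_trans (Hsa_Hmod M s a) _.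
apply: isomorphic_trans (Hmod_T0s P a s) _.
apply: isomorphic_trans (Ts0_Ext P a s).
apply: staircase.
- exact: dc_dd.
- exact: dc_hh.
- exact: dc_hd.
- exact: dc_d_exact.
exact: dc_h_exact.
Qed.
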